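(* Let $T$ be a non-empty set, and let $\ell^\infty(T)$ be the set of all bounded functions on $T$ endowed with the sup-norm. Let $W(t)$, $t\in T$, be a centered tight Gaussian random element in $\ell^\infty(T)$ such that $\bar\sigma_W^2:=\sup_{t\in T}\mathrm{Var}(W(t))>0$. Let $\bar\sigma_{W,0}=\bar\sigma_W\,\Phi^{-1}(0.95)$ and $\mathcal{A}=[\bar\sigma_{W,0},\infty)$. Define $d(s,t)=\sqrt{\mathbb{E}[(W(t)-W(s))^2]}$ for $s,t\in T$, and for $\delta>0$ define $\phi(\delta)=\mathbb{E}\big[\sup_{(s,t)\in T_\delta}|W(t)-W(s)|\big]$, where $T_\delta=\{(s,t)\in T\times T:d(s,t)\le\delta\}$. Then for every $0<\epsilon<\frac1{16}\bar\sigma_{W,0}$, $$\sup_{x\in\mathcal{A}}\mathbb{P}\Big(\Big|\sup_{t\in T}W(t)-x\Big|\le\epsilon\Big)\le\inf_{\substack{\delta,\kappa>0\\ \phi(\delta)+\kappa\delta\le\bar\sigma_{W,0}/16}}\Big\{\frac{2}{\bar\sigma_W}\big(\epsilon+\phi(\delta)+\kappa\delta\big)\sqrt{\log N(T,d,\delta)}\,\big(\sqrt{2\log N(T,d,\delta)}+3\big)+e^{-\kappa^2/2}\Big\}.$$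
   Context: $\Phi$ denotes the cumulative distribution function of a standard normal random variable. For a (semi)metric space $(T,d)$ and $\delta>0$, $N(T,d,\delta)$ is the $\delta$-covering number: the minimum cardinality of a subset $T'\subset T$ such that every $t\in T$ satisfies $d(t,t')\le\delta$ for some $t'\in T'$.
   Formalization: The infimum is taken only over δ, κ that also satisfy N(T,d,δ) ≥ 2; without this the claim fails, e.g. for T a singleton and W(t) standard normal, where log N = 0 and the infimum of e^{-κ²/2} is 0 while the left side is positive. *)

(* Defs.v *)
From HB Require Import structures.
From mathcomp Require Import all_boot all_order all_algebra.
From mathcomp Require Import all_classical all_reals all_analysis.

Set Implicit Arguments.
Unset Strict Implicit.
Unset Printing Implicit Defensive.

Import Order.TTheory GRing.Theory Num.Theory.
Import numFieldNormedType.Exports.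

Local Open Scope classical_set_scope.
Local Open Scope ring_scope.

(* The space l^oo(T) of bounded real functions, normed by the supremum. *)
Section linf.
Variables (T : Type) (R : realType).

Definition bounded_pred : {pred (T -> R)} := mem (bounded_fun : set (T -> R^o)).

Record linf := Linf { linf_fun :> T -> R ; _ : linf_fun \in bounded_pred }.

HB.instance Definition _ := [isSub for linf_fun].
HB.instance Definition _ := [Choice of linf by <:].

Lemma bounded_predP (f : T -> R) :
  reflect (exists M, forall t, `|f t| <= M) (f \in bounded_pred).
Proof.
apply: (iffP idP) => [/set_mem [M [Mr]] /(_ (M + 1))|[M fM]].
- rewrite ltrDl ltr01 => /(_ isT) h.
  by exists (M + 1) => t; exact: h.
- apply/mem_set; exists M; split; first exact: num_real.
  by move=> x Mx t _; exact: (le_trans (fM t) (ltW Mx)).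
Qed.

Lemma bounded_submod_closed : submod_closed bounded_pred.
Proof.
split=> [|a f g /bounded_predP[M fM] /bounded_predP[N gN]].
- by apply/bounded_predP; exists 0 => t; rewrite normr0.
- apply/bounded_predP; exists (`|a| * M + N) => t.
  apply: (le_trans (ler_normD _ _)); apply: lerD; last exact: gN.
  by rewrite normrM ler_wpM2l.
Qed.

HB.instance Definition _ :=
  GRing.isSubmodClosed.Build R (T -> R) bounded_pred bounded_submod_closed.
HB.instance Definition _ := [SubChoice_isSubLmodule of linf by <:].

Definition sup_norm (f : linf) : R := sup (range (fun t => `|f t|)).

Lemma sup_norm_ub (f : linf) t : `|f t| <= sup_norm f.
Proof.
apply: ub_le_sup; last by exists t.
case: f => f /= /bounded_predP[M fM].
by exists M => _ [s _ <-]; exact: fM.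
Qed.

Lemma sup_norm_le (f : linf) M : 0 <= M ->
  (forall t, `|f t| <= M) -> sup_norm f <= M.
Proof.
move=> M0 fM; have [[t0 _]|T0] := pselect (exists t : T, True).
- apply: ge_sup => [|x [s _ <-]]; last exact: fM.
  by exists `|f t0|, t0.
- rewrite /sup_norm [X in sup X](_ : _ = set0) ?sup0//.
  by apply/seteqP; split=> // x [t _ _]; apply: T0; exists t.
Qed.

Lemma sup_norm_ge0 (f : linf) : 0 <= sup_norm f.
Proof.
have [[t0 _]|T0] := pselect (exists t : T, True).
- exact: le_trans (normr_ge0 _) (sup_norm_ub f t0).
- rewrite /sup_norm [X in sup X](_ : _ = set0) ?sup0//.
  by apply/seteqP; split=> // x [t _ _]; apply: T0; exists t.
Qed.

Lemma sup_normD (f g : linf) : sup_norm (f + g) <= sup_norm f + sup_norm g.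
Proof.
apply: sup_norm_le => [|t]; first by rewrite addr_ge0 ?sup_norm_ge0.
by rewrite (le_trans (ler_normD _ _))// lerD ?sup_norm_ub.
Qed.

Lemma sup_normZ (a : R) (f : linf) : sup_norm (a *: f) = `|a| * sup_norm f.
Proof.
have le_Z b (g : linf) : sup_norm (b *: g) <= `|b| * sup_norm g.
  apply: sup_norm_le => [|t]; first by rewrite mulr_ge0 ?sup_norm_ge0.
  by rewrite normrM ler_wpM2l ?sup_norm_ub.
apply/eqP; rewrite eq_le le_Z /=.
have [->|a0] := eqVneq a 0; first by rewrite normr0 mul0r sup_norm_ge0.
rewrite -ler_pdivlMl ?normr_gt0// -normfV -[leLHS](_ : sup_norm (a^-1 *: (a *: f)) = _).
  exact: le_Z.
by rewrite scalerA mulVf// scale1r.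
Qed.

Lemma sup_norm_eq0 (f : linf) : sup_norm f = 0 -> f = 0.
Proof.
move=> f0; apply/val_inj/funext => t /=; apply/normr0_eq0/le_anti.
by rewrite normr_ge0 andbT -f0 sup_norm_ub.
Qed.

HB.instance Definition _ :=
  Lmodule_isNormed.Build R linf sup_normD sup_normZ sup_norm_eq0.

Definition borel_linf := g_sigma_algebraType (@open linf).

End linf.

Section normal.
Variable R : realType.

(* normal_prob m s is the Gaussian law only for s != 0; the degenerate laws are
   Dirac masses. *)
Definition normal_law (mu : set R -> \bar R) :=
  (exists m, forall B, measurable B -> mu B = \d_m B) \/
  (exists m s, 0 < s /\ forall B, measurable B -> mu B = normal_prob m s B).

Definition Phi (x : R) : R := fine (normal_prob 0 1 `]-oo, x]).

Definition Phi_inv : R -> R := 'pinv_(fun=> 0) setT Phi.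

End normal.

(* An R^n-valued vector is multivariate normal when all linear combinations of
   its coordinates are (possibly degenerate) normal variables. *)
Definition multivariate_normal (R : realType) (d : measure_display)
    (Omega : measurableType d) (P : probability Omega R) (n : nat)
    (X : 'I_n -> Omega -> R) :=
  forall a : 'I_n -> R,
    normal_law (fun B => P ((fun w => \sum_(i < n) a i * X i w) @^-1` B)).

(* +oo when there is no finite delta-net *)
Definition covering_number (R : realType) (T : Type) (rho : T -> T -> R)
    (delta : R) : \bar R :=
  ereal_inf [set (n%:R)%:E | n in [set n : nat | exists A : set T,
    (A #= `I_n)%card /\ forall t, exists2 t', A t' & rho t t' <= delta]].

Section gaussian_element.
Context (R : realType) (d : measure_display) (Omega : measurableType d)
  (P : probability Omega R) (T : Type).
Variable W : {RV P >-> borel_linf T R}.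

Definition eval_at (t : T) (w : Omega) : R := (W w : linf T R) t.

Definition tight := forall eps : R, 0 < eps ->
  exists2 K : set (linf T R), compact K & ((1 - eps)%:E <= distribution P W K)%E.

Definition gaussian := forall (n : nat) (t : 'I_n -> T),
  multivariate_normal P (fun i => eval_at (t i)).

Definition centered := forall t, 'E_P[eval_at t]%E = 0%E.

Definition sup_variance : \bar R := ereal_sup (range (fun t => 'V_P[eval_at t]%E)).

(* sup_variance is finite for a tight Gaussian W *)
Definition sigma_bar : R := Num.sqrt (fine sup_variance).

Definition sigma_bar0 : R := sigma_bar * Phi_inv (95%:R / 100%:R).

Definition semimetric (s t : T) : R :=
  Num.sqrt (fine 'E_P[fun w => ((eval_at t w - eval_at s w) ^+ 2)%R]%E).

Definition phi (delta : R) : \bar R :=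
  'E_P[fun w => sup [set `|eval_at st.2 w - eval_at st.1 w|%R |
    st in [set st : T * T | (semimetric st.1 st.2 <= delta)%R]]]%E.

(* When this is 1 the factor sqrt(log N) vanishes and the anti-concentration
   bound degenerates to exp(- kappa^2 / 2), which is false in general: for T a
   singleton, delta -> 0 and kappa -> +oo send it to 0. The bound is therefore
   only meant at scales delta where cov_num delta >= 2. *)
Definition cov_num (delta : R) : \bar R := covering_number semimetric delta.

Definition admissible (delta kappa : R) :=
  [/\ 0 < delta, 0 < kappa &
      (phi delta + (kappa * delta)%:E <= (sigma_bar0 / 16%:R)%:E)%E].

End gaussian_element.

(* Main.v *)
Require Import Defs.
From HB Require Import structures.
From mathcomp Require Import all_boot all_order all_algebra.
From mathcomp Require Import all_classical all_reals all_analysis.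
From mathcomp Require Import measurable_realfun.
From mathcomp Require Import ring lra.

(** The supremum of W differs from its maximum over a delta-net of N points by
    at most the oscillation zeta of W at scale delta.  Hence, for every level u,
      P (|sup W - x| <= eps) <=
        P (max over the net in [x - eps - u, x + eps + u]) + P (zeta >= u),
    and u is taken slightly above phi delta + kappa * delta, then sent to that
    value.

    Second term (oscillation_tail).  By tightness, finitely many increments of W
    witness the event zeta >= u up to small probability, and their maximum has
    expectation at most phi delta.  So it is enough to bound the upper tail of
    the maximum of a centered Gaussian vector with variances at most delta ^ 2
    (gaussian_max_tail).  This follows from the Prekopa-Leindler inequality,
    applied to the indicator of {max >= r} and to expR (- th * max): the strict
    log-concavity of the Gaussian law leaves exactly the Gaussian tail, without
    any loss in the constant.  The inequality is proved on the line from
    Brunn-Minkowski for level sets, multiplied by a normal density, and carried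
    to Gaussian vectors by conditioning on one coordinate at a time.

    First term (gaussian_max_anti_concentration).  Let p_j z be the conditional
    probability that the maximum is attained at j given X_j = z, and f_j the
    density of X_j, so that the maximum has density \sum_j p_j z * f_j z.  Consider
    the events {X_j > z, and the maximum is at j once X is moved down to X_j = z
    along the regression on X_j}, of probability p_j z * P (X_j > z).  They are
    disjoint, because a common point of two of them would violate the
    Cauchy-Schwarz inequality for the covariances; hence
    \sum_j p_j z * P (X_j > z) <= 1.  With L = sqrt (2 log N), the Mills ratio
    bounds f_j z by (L ^ 2 + 1) / a times P (X_j > z) up to an error of order
    L / (a N), for z >= a = x - eps - u.  The density of the maximum above a is
    therefore at most (L ^ 2 + 1 + L / 2) / a.  The bound of the theorem needs
    a >= sqrt 2 * sigma_bar, which holds since a is at least 7 / 8 of sigma_bar0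
    and the 0.95-quantile exceeds 1.617 > 8 * sqrt 2 / 7.

    Both parts use that X minus its regression on X_j is independent of X_j
    (gaussian_split).  As normality is only known for linear combinations, this
    rests on the Cramer-Wold theorem, which is proved here by approximating
    indicators of boxes by trigonometric polynomials. *)

Set Implicit Arguments.
Unset Strict Implicit.
Unset Printing Implicit Defensive.

Import Order.TTheory GRing.Theory Num.Theory.
Import numFieldNormedType.Exports.

Local Open Scope classical_set_scope.
Local Open Scope ring_scope.

(** * Moments of normal laws *)

Section density.
Local Open Scope ereal_scope.
Context d (T : measurableType d) (R : realType).
Variables (nu mu : {measure set T -> \bar R}) (p : T -> R).
Hypotheses (mp : measurable_fun setT p) (p0 : forall x, (0 <= p x)%R).
Hypothesis nuE : forall A, measurable A -> nu A = \int[mu]_(x in A) (p x)%:E.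

Import HBNNSimple.

(** Monotone convergence reduces the change of measure to simple functions. *)
Lemma ge0_integral_density (f : T -> \bar R) :
  measurable_fun setT f -> (forall x, 0 <= f x) ->
  \int[nu]_x f x = \int[mu]_x (f x * (p x)%:E).
Proof.
move=> mf f0.
pose f_ := nnsfun_approx measurableT mf.
have f_f x : EFin \o f_ ^~ x @ \oo --> f x by exact: cvg_nnsfun_approx.
transitivity (limn (fun n => \int[nu]_x (f_ n x)%:E)).
  rewrite -monotone_convergence//.
  - by apply: eq_integral => y _; apply/esym/cvg_lim => //; exact: f_f.
  - by move=> n; exact/measurable_EFinP/measurable_funP.
  - by move=> n y _; rewrite lee_fin.
  - by move=> y _ m n mn; rewrite lee_fin; exact/lefP/nd_nnsfun_approx.
transitivity (limn (fun n => \int[mu]_x (f_ n x * p x)%:E)); last first.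
  rewrite -monotone_convergence//.
  - apply: eq_integral => y _; apply/cvg_lim => //.
    under eq_fun do rewrite EFinM.
    by apply: cvgeMr => //; exact: f_f.
  - by move=> n; apply/measurable_EFinP/measurable_funM => //; exact/measurable_funP.
  - by move=> n y _; rewrite lee_fin mulr_ge0.
  - move=> y _ m n mn; rewrite lee_fin ler_wpM2r//.
    exact/lefP/nd_nnsfun_approx.
congr (limn _); apply/funext => n.
transitivity (\sum_(k \in range (f_ n)) (k%:E * nu (f_ n @^-1` [set k]))).
  under eq_integral do rewrite fimfunE -fsumEFin//.
  rewrite ge0_integral_fsum//; last 2 first.
  - by move=> y; exact/measurable_EFinP/measurable_funM.
  - by move=> y x _; rewrite nnfun_muleindic_ge0.
  apply: eq_fsbigr => r _; rewrite integralZl_indic_nnsfun// integral_indic//=.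
  by rewrite setIT.
transitivity (\int[mu]_x (\sum_(k \in range (f_ n))
    (k * \1_(f_ n @^-1` [set k]) x)%:E * (p x)%:E)); last first.
  apply: eq_integral => x _; rewrite EFinM [in RHS]fimfunE -fsumEFin//.
  rewrite fsbig_finite//= [in RHS]fsbig_finite//= ge0_sume_distrl// => r _.
  by rewrite nnfun_muleindic_ge0.
rewrite ge0_integral_fsum//; last 2 first.
- move=> r; apply: emeasurable_funM; last exact/measurable_EFinP.
  exact/measurable_EFinP/measurable_funM.
- move=> r x _; apply: mule_ge0; last by rewrite lee_fin.
  by rewrite EFinM nnfun_muleindic_ge0.
apply: eq_fsbigr => r; rewrite inE => -[t _ <-].
have ft0 : (0 <= f_ n t)%R by [].
rewrite nuE// integral_mkcond -ge0_integralZl//=; last 2 first.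
- apply/(measurable_restrictT _ _).1 => //.
  by apply/measurable_EFinP; exact: measurable_funS mp.
- by move=> x _; rewrite patchE; case: ifPn => // _; rewrite lee_fin.
apply: eq_integral => x _; rewrite patchE indicE.
rewrite EFinM.
by case: ifPn => _; rewrite ?mule1 ?mule0 ?mul0e// mulr1 EFinM.
Qed.

End density.

Section lebesgue_affine.
Context {R : realType}.
Local Notation mu := (@lebesgue_measure R).
Implicit Types f : R -> \bar R.

Lemma lebesgue_measure_shift (c : R) (A : set R) : measurable A ->
  pushforward mu ((fun x => x + c) : R -> measurableTypeR R) A = mu A.
Proof.
move=> mA; apply/esym/lebesgue_measure_unique => //=.
  exact: measurable_funD.
move=> mf _ [[a b]] _ <-.
rewrite /pushforward.
rewrite (_ : _ @^-1` _ = `]a - c, b - c]%classic); last first.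
  by apply/seteqP; split=> x /=; rewrite !in_itv/= ltrBlDr lerBrDr.
rewrite !lebesgue_measure_itv/= !lte_fin ltrD2r.
by case: ifPn => // _; rewrite -!EFinD; congr EFin; ring.
Qed.

Lemma lebesgue_measure_scale (c : R) (A : set R) : 0 < c -> measurable A ->
  pushforward mu ((fun x => c * x) : R -> measurableTypeR R) A =
  (c^-1%:E * mu A)%E.
Proof.
move=> c0 mA.
suff -> : mu A = mscale (NngNum (ltW c0))
    (pushforward mu ((fun x => c * x) : R -> measurableTypeR R)) A.
- exact: measurable_funM.
- by move=> ?; rewrite /mscale/= muleA -EFinM mulVf ?mul1e// gt_eqF.
move=> mf; apply: lebesgue_measure_unique => //= _ [[a b]] _ <-.
rewrite /mscale/=; rewrite /pushforward.
rewrite (_ : _ @^-1` _ = `]a / c, b / c]%classic); last first.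
  by apply/seteqP; split=> x /=; rewrite !in_itv/= ltr_pdivrMr// ler_pdivlMr// ![x * c]mulrC.
rewrite !lebesgue_measure_itv/= !lte_fin ltr_pM2r ?invr_gt0//.
case: ifPn => // _; last by rewrite mule0.
by rewrite -!EFinD -EFinM; congr EFin; field; rewrite gt_eqF.
Qed.

Lemma ge0_integral_shift f (c : R) : measurable_fun setT f ->
  (forall x, (0 <= f x)%E) -> (\int[mu]_x f (x + c)%R = \int[mu]_x f x)%E.
Proof.
move=> mf f0.
have mg : measurable_fun setT ((fun x => x + c) : measurableTypeR R -> measurableTypeR R).
  exact: measurable_funD.
rewrite -[LHS](@ge0_integral_pushforward _ _ _ _ _ _ mg mu setT)//.
by apply: eq_measure_integral => A mA _; exact: lebesgue_measure_shift.
Qed.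

End lebesgue_affine.

Section normal_moments.
Context {R : realType}.
Local Notation mu := (@lebesgue_measure R).

Lemma normal_pdf_expE (m s x : R) : s != 0 ->
  normal_pdf m s x = normal_peak s * expR (- (x - m) ^+ 2 / (s ^+ 2 *+ 2)).
Proof. by move=> s0; rewrite normal_pdfE. Qed.

Lemma normal_peakM (q s : R) : 0 < q ->
  normal_peak (q * s) = q^-1 * normal_peak s.
Proof.
move=> q0; rewrite /normal_peak exprMn -mulrA -mulrnAr sqrtrM ?sqr_ge0//.
by rewrite sqrtr_sqr gtr0_norm// invfM.
Qed.

Lemma ge0_integral_normal (m s : R) (f : R -> \bar R) :
  measurable_fun setT f -> (forall x, (0 <= f x)%E) ->
  (\int[normal_prob m s]_x f x = \int[mu]_x (f x * (normal_pdf m s x)%:E))%E.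
Proof.
move=> mf f0; apply: ge0_integral_density => //.
- exact: measurable_normal_pdf.
- by move=> x; exact: normal_pdf_ge0.
Qed.

(** The exponential factor translates the density by t * s ^+ 2. *)
Lemma normal_mgf (m s t : R) : 0 < s ->
  (\int[normal_prob m s]_x (expR (t * (x - m)))%:E =
   (expR (t ^+ 2 * s ^+ 2 / 2))%:E)%E.
Proof.
move=> s0; rewrite ge0_integral_normal//; last first.
  apply/measurable_EFinP/measurableT_comp => //.
  by apply: measurable_funM => //; exact: measurable_funB.
have sN0 : s != 0 by rewrite gt_eqF.
transitivity (\int[mu]_x ((expR (t ^+ 2 * s ^+ 2 / 2))%:E *
   (normal_pdf (m + t * s ^+ 2) s x)%:E))%E; last first.
  rewrite ge0_integralZl//=.
  - by rewrite integral_normal_pdf mule1.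
  - by apply/measurable_EFinP; exact: measurable_normal_pdf.
  - by move=> x _; rewrite lee_fin normal_pdf_ge0.
apply: eq_integral => x _; rewrite -!EFinM !normal_pdf_expE//; congr EFin.
rewrite mulrCA [RHS]mulrCA; congr (_ * _); rewrite -!expRD; congr expR.
by rewrite -[s ^+ 2 *+ 2]mulr_natr; field.
Qed.

(** The exponential factor turns the density of N(m, s^2) into q times the
    density of N(m, (q s)^2).  Values q > 1 give the integrability of the square,
    and letting q tend to 1 gives the variance. *)
Lemma normal_sqr_mgf (m s q : R) : 0 < s -> 0 < q ->
  (\int[normal_prob m s]_x
     (expR ((1 - q ^- 2) * ((x - m) ^+ 2 / (s ^+ 2 *+ 2))))%:E = q%:E)%E.
Proof.
move=> s0 q0; rewrite ge0_integral_normal//; last first.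
  apply/measurable_EFinP/measurableT_comp => //.
  apply: measurable_funM => //; apply: measurable_funM => //.
  by apply: measurable_funX; exact: measurable_funB.
have sN0 : s != 0 by rewrite gt_eqF.
have qN0 : q != 0 by rewrite gt_eqF.
transitivity (\int[mu]_x (q%:E * (normal_pdf m (q * s) x)%:E))%E; last first.
  rewrite ge0_integralZl//=.
  - by rewrite integral_normal_pdf mule1.
  - by apply/measurable_EFinP; exact: measurable_normal_pdf.
  - by move=> x _; rewrite lee_fin normal_pdf_ge0.
  - by rewrite lee_fin ltW.
apply: eq_integral => x _; rewrite -!EFinM !normal_pdf_expE ?mulf_neq0//.
rewrite normal_peakM//; congr EFin.
rewrite -[q^-1 * _ * _]mulrA [RHS]mulrA divff// mul1r mulrCA.
congr (_ * _); rewrite -!expRD; congr expR.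
rewrite -[s ^+ 2 *+ 2]mulr_natr -[(q * s) ^+ 2 *+ 2]mulr_natr; field.
by rewrite sN0 qN0.
Qed.

End normal_moments.

(** With u = e * c ^+ 2 and w = e * s ^+ 2, the inequality t * c <= t ^+ 2 * s ^+ 2
    at t = e * c reads u <= u * w; it is impossible when w < 1. *)
Fact mean_arith (R : realFieldType) (u w e : R) :
  0 < e -> 0 < u -> 0 < w -> e + w + u = 1 -> u * w <= 1 /\ ~ u <= u * w.
Proof. by move=> *; split; [|move=> ?]; nra. Qed.

Section moments_from_mgf.
Local Open Scope ereal_scope.
Context d (T : measurableType d) (R : realType) (P : probability T R).
Variables (Y : T -> R) (s : R).
Hypotheses (mY : measurable_fun setT Y) (s0 : (0 < s)%R).
Hypothesis mgf : forall t,
  \int[P]_x (expR (t * Y x))%:E = (expR (t ^+ 2 * s ^+ 2 / 2))%:E.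
Hypothesis sqr_mgf : forall q, (0 < q)%R ->
  \int[P]_x (expR ((1 - q ^- 2) * (Y x ^+ 2 / (s ^+ 2 *+ 2))))%:E = q%:E.

Let mE t : measurable_fun setT (fun x => (expR (t * Y x))%:E).
Proof.
by apply/measurable_EFinP/measurableT_comp => //; exact: measurable_funM.
Qed.

Let int1 : \int[P]__ 1 = 1.
Proof. by rewrite -[LHS]/(\int[P]_x (cst 1 x)) integral_cst//= probability_setT mule1. Qed.

Lemma mgf_integrable t : P.-integrable setT (fun x => (expR (t * Y x))%:E).
Proof.
apply/integrableP; split => //.
under eq_integral do rewrite /= ger0_norm ?expR_ge0//.
by rewrite mgf ltry.
Qed.

Lemma mgf_integrable_id : P.-integrable setT (EFin \o Y).
Proof.
apply: (@le_integrable _ _ _ P setT measurableT _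
  (fun x => (expR (1 * Y x))%:E + (expR (- 1 * Y x))%:E)).
- exact/measurable_EFinP.
- move=> x _; rewrite -EFinD /= lee_fin mul1r mulN1r.
  have h1 := expR_ge1Dx (Y x); have h2 := expR_ge1Dx (- Y x)%R.
  have g1 := expR_gt0 (Y x); have g2 := expR_gt0 (- Y x)%R.
  rewrite [leRHS]ger0_norm; last by rewrite addr_ge0// ltW.
  by rewrite ler_norml; apply/andP; split; lra.
- by apply: integrableD => //; exact: mgf_integrable.
Qed.

(** Jensen gives 1 + t * c <= expR (t ^+ 2 * s ^+ 2 / 2) for the mean c and all t;
    to first order at t = 0 this forces c = 0. *)
Lemma mgf_mean : \int[P]_x (Y x)%:E = 0.
Proof.
have ix := mgf_integrable_id.
pose c := fine (\int[P]_x (Y x)%:E).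
have cE : \int[P]_x (Y x)%:E = c%:E.
  by rewrite fineK//; exact: integrable_fin_num.
have key t : (1 + t * c <= expR (t ^+ 2 * s ^+ 2 / 2))%R.
  rewrite -lee_fin -mgf.
  have -> : (1 + t * c)%:E = \int[P]_x (1 + t%:E * (Y x)%:E).
    rewrite integralD//=; last 2 first.
    - exact: finite_measure_integrable_cst.
    - exact: integrableZl.
    by rewrite int1 integralZl// cE.
  apply: le_integral => //.
  - by apply: integrableD => //; [exact: finite_measure_integrable_cst|exact: integrableZl].
  - exact: mgf_integrable.
  - by move=> x _; rewrite -EFinM -EFinD lee_fin expR_ge1Dx.
have key2 t : (t ^+ 2 * s ^+ 2 <= 1 -> t * c <= t ^+ 2 * s ^+ 2)%R.
  move=> t1; have := key t; set u := (t ^+ 2 * s ^+ 2)%R in t1 *.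
  have u0 : (0 <= u)%R by rewrite mulr_ge0 ?sqr_ge0.
  have := expR_ge1Dx (- (u / 2)); have := expR_gt0 (u / 2).
  have : (expR (- (u / 2)) * expR (u / 2) = 1)%R by rewrite -expRD addNr expR0.
  move: (expR (u / 2)) (expR (- (u / 2))) => E F; nra.
rewrite cE; congr EFin; apply/eqP/negPn/negP => cN0.
have c2 : (0 < c ^+ 2)%R by rewrite exprn_even_gt0.
have s2 : (0 < s ^+ 2)%R by rewrite exprn_gt0.
(* small enough for t = e * c to contradict the first-order bound *)
pose e := ((1 + s ^+ 2 + c ^+ 2)^-1)%R.
have e0 : (0 < e)%R by rewrite invr_gt0; lra.
have eE : (e * (1 + s ^+ 2 + c ^+ 2) = 1)%R by rewrite mulVf// gt_eqF//; lra.
pose u := (e * c ^+ 2)%R; pose w := (e * s ^+ 2)%R.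
have u0 : (0 < u)%R by rewrite mulr_gt0.
have w0 : (0 < w)%R by rewrite mulr_gt0.
have uw : (e + w + u = 1)%R by rewrite -eE /u /w; ring.
have := key2 (e * c)%R.
have -> : (e * c * c = u)%R by rewrite /u; ring.
have -> : ((e * c) ^+ 2 * s ^+ 2 = u * w)%R by rewrite /u /w; ring.
have [h1 h2] := mean_arith e0 u0 w0 uw.
by move=> /(_ h1).
Qed.

Lemma sqr_mgf_integrable : P.-integrable setT (fun x => (Y x ^+ 2)%:E).
Proof.
apply: (@le_integrable _ _ _ P setT measurableT _
  (fun x => (s ^+ 2 *+ 4)%:E *
     (expR ((1 - 2 ^- 2) * (Y x ^+ 2 / (s ^+ 2 *+ 2))))%:E)).
- by apply/measurable_EFinP; exact: measurable_funX.
- move=> x _ /=; rewrite lee_fin ger0_norm ?sqr_ge0//.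
  have s2 : (0 < s ^+ 2)%R by rewrite exprn_gt0.
  have s4 : (s ^+ 2 *+ 4 = s ^+ 2 * 4)%R by rewrite mulr_natr.
  rewrite ger0_norm; last by rewrite mulr_ge0 ?expR_ge0// mulrn_wge0// ltW.
  have := expR_ge1Dx ((1 - 2 ^- 2) * (Y x ^+ 2 / (s ^+ 2 *+ 2)))%R.
  set E := expR _.
  have -> : ((1 - 2 ^- 2) * (Y x ^+ 2 / (s ^+ 2 *+ 2)) =
    3 / 8 * (Y x ^+ 2 / s ^+ 2))%R.
    by rewrite -[(s ^+ 2 *+ 2)%R]mulr_natr; field; rewrite gt_eqF.
  move=> h.
  have -> : (Y x ^+ 2 = s ^+ 2 * (Y x ^+ 2 / s ^+ 2))%R.
    by rewrite mulrCA divff ?mulr1// gt_eqF.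
  rewrite s4 -[X in (_ <= X)%R]mulrA ler_pM2l//.
  have : (0 <= Y x ^+ 2 / s ^+ 2)%R by rewrite divr_ge0 ?sqr_ge0.
  move: (Y x ^+ 2 / s ^+ 2)%R h => z; lra.
- apply: integrableZl => //; apply/integrableP; split.
    apply/measurable_EFinP/measurableT_comp => //.
    apply: measurable_funM => //; apply: measurable_funM => //.
    exact: measurable_funX.
  under eq_integral do rewrite /= ger0_norm ?expR_ge0//.
  by rewrite sqr_mgf ?ltry.
Qed.

(** Jensen gives 1 + (1 - q ^- 2) / (2 s ^+ 2) * v <= q for the second moment v.
    Equality holds at q = 1, so both sides have the same derivative there, which
    determines v. *)
Lemma sqr_mgf_moment : \int[P]_x (Y x ^+ 2)%:E = (s ^+ 2)%:E.
Proof.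
have ix := sqr_mgf_integrable.
have s2 : (0 < s ^+ 2)%R by rewrite exprn_gt0.
have imE k : P.-integrable setT (fun x => k%:E * (Y x ^+ 2)%:E).
  exact: integrableZl.
pose v := fine (\int[P]_x (Y x ^+ 2)%:E).
have vE : \int[P]_x (Y x ^+ 2)%:E = v%:E.
  by rewrite fineK//; exact: integrable_fin_num.
have v0 : (0 <= v)%R by rewrite fine_ge0// integral_ge0// => x _; rewrite lee_fin sqr_ge0.
have key q : (0 < q -> 1 + (1 - q ^- 2) / (s ^+ 2 *+ 2) * v <= q)%R.
  move=> q0; rewrite -lee_fin -(sqr_mgf q0).
  set k := ((1 - q ^- 2) / (s ^+ 2 *+ 2))%R.
  have -> : (1 + k * v)%:E = \int[P]_x (1 + k%:E * (Y x ^+ 2)%:E).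
    rewrite integralD//=; last exact: finite_measure_integrable_cst.
    by rewrite int1 integralZl// vE.
  apply: le_integral => //.
  - by apply: integrableD => //; exact: finite_measure_integrable_cst.
  - apply/integrableP; split.
      apply/measurable_EFinP/measurableT_comp => //.
      apply: measurable_funM => //; apply: measurable_funM => //.
      exact: measurable_funX.
    under eq_integral do rewrite /= ger0_norm ?expR_ge0//.
    by rewrite sqr_mgf ?ltry.
  - move=> x _; rewrite -EFinM -EFinD lee_fin.
    rewrite [X in (_ <= expR X)%R](_ : _ = k * Y x ^+ 2)%R ?expR_ge1Dx//.
    by rewrite /k mulrA mulrAC.
rewrite vE; congr EFin.
pose w := (v / s ^+ 2)%R.
have w0 : (0 <= w)%R by rewrite divr_ge0// ltW.
suff w1 : w = 1%R.
  by rewrite -[RHS]mulr1 -w1 /w mulrCA divff ?mulr1// gt_eqF.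
(* dividing by q - 1 leaves (q + 1) * w <= 2 * q ^+ 2 for q > 1, and the reverse
   inequality for q < 1 *)
have {}key q : (0 < q -> (q - 1) * ((q + 1) * w) <= (q - 1) * (2 * q ^+ 2))%R.
  move=> q0; have := key q q0.
  have -> : ((1 - q ^- 2) / (s ^+ 2 *+ 2) * v = (q ^+ 2 - 1) * w / (2 * q ^+ 2))%R.
    rewrite /w -[(s ^+ 2 *+ 2)%R]mulr_natr; field.
    by rewrite !gt_eqF.
  rewrite -lerBrDl ler_pdivrMr; last by rewrite mulr_gt0// exprn_gt0.
  by move=> h; lra.
apply/eqP; rewrite eq_le; apply/andP; split; rewrite leNgt; apply/negP => w1.
- pose e := ((w - 1) / (4 + 2 * (w - 1)))%R.
  have D0 : (0 < 4 + 2 * (w - 1))%R by lra.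
  have e0 : (0 < e)%R by rewrite divr_gt0//; lra.
  have eE : (e * (4 + 2 * (w - 1)) = w - 1)%R by rewrite divfK// gt_eqF.
  have := key (1 + e)%R; rewrite addrAC subrr add0r ler_pM2l// => h.
  have {}h : ((1 + e + 1) * w <= 2 * (1 + e) ^+ 2)%R by apply: h; lra.
  nra.
- pose e := ((1 - w) / 4)%R.
  have e0 : (0 < e)%R by rewrite divr_gt0//; lra.
  have e1 : (e <= 1 / 4)%R by rewrite /e; lra.
  have := key (1 - e)%R; rewrite addrAC subrr add0r !mulNr lerN2 ler_pM2l// => h.
  have {}h : (2 * (1 - e) ^+ 2 <= (1 - e + 1) * w)%R by apply: h; lra.
  have : (w = 1 - 4 * e)%R by rewrite /e; lra.
  nra.
Qed.

End moments_from_mgf.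

Section centered_normal.
Local Open Scope ereal_scope.
Context {d} {T : measurableType d} {R : realType} (P : probability T R).

(** The family N(0, s ^ 2), s >= 0, including its degenerate member s = 0. *)
Definition cnormal_law (s : R) (B : set R) : \bar R :=
  if s == 0%R then \d_(0%R : R) B else normal_prob 0 s B.

Definition cnormal (Y : T -> R) (s : R) :=
  [/\ measurable_fun setT Y, (0 <= s)%R &
      forall B, measurable B -> P (Y @^-1` B) = cnormal_law s B].

Lemma ge0_integral_law (Y : T -> R) (m s : R) (f : R -> \bar R) :
  measurable_fun setT Y ->
  (forall B, measurable B -> P (Y @^-1` B) = normal_prob m s B) ->
  measurable_fun setT f -> (forall x, 0 <= f x) ->
  \int[P]_x f (Y x) = \int[normal_prob m s]_x f x.
Proof.
move=> mY PY mf f0.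
have mY' : measurable_fun setT (Y : T -> measurableTypeR R).
  by move=> _ B mB; exact: mY.
pose X : {RV P >-> measurableTypeR R} :=
  HB.pack (Y : T -> measurableTypeR R) (isMeasurableFun.Build _ _ _ _ _ mY').
rewrite -[LHS](ge0_integral_distribution X mf f0).
apply: eq_measure_integral => A mA _; exact: PY.
Qed.

Lemma normal_law_mgf (Y : T -> R) (m s t : R) : (0 < s)%R ->
  measurable_fun setT Y ->
  (forall B, measurable B -> P (Y @^-1` B) = normal_prob m s B) ->
  \int[P]_x (expR (t * (Y x - m)))%:E = (expR (t ^+ 2 * s ^+ 2 / 2))%:E.
Proof.
move=> s0 mY PY; rewrite -(normal_mgf m t s0).
apply: (ge0_integral_law mY PY (f := fun x => (expR (t * (x - m)))%:E)).
- apply/measurable_EFinP/measurableT_comp => //.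
  by apply: measurable_funM => //; exact: measurable_funB.
- by move=> x; rewrite lee_fin expR_ge0.
Qed.

Lemma normal_law_sqr_mgf (Y : T -> R) (m s q : R) : (0 < s)%R -> (0 < q)%R ->
  measurable_fun setT Y ->
  (forall B, measurable B -> P (Y @^-1` B) = normal_prob m s B) ->
  \int[P]_x (expR ((1 - q ^- 2) * ((Y x - m) ^+ 2 / (s ^+ 2 *+ 2))))%:E = q%:E.
Proof.
move=> s0 q0 mY PY; rewrite -(normal_sqr_mgf m s0 q0).
apply: (ge0_integral_law mY PY
  (f := fun x => (expR ((1 - q ^- 2) * ((x - m) ^+ 2 / (s ^+ 2 *+ 2))))%:E)).
- apply/measurable_EFinP/measurableT_comp => //.
  apply: measurable_funM => //; apply: measurable_funM => //.
  by apply: measurable_funX; exact: measurable_funB.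
- by move=> x; rewrite lee_fin expR_ge0.
Qed.

Lemma cnormal0_ae (Y : T -> R) : cnormal Y 0 -> {ae P, forall x, Y x = 0%R}.
Proof.
move=> [mY _ PY].
have mN : measurable (Y @^-1` [set~ 0%R]).
  by rewrite -[X in measurable X]setTI; apply: mY => //; exact: measurableC.
exists (Y @^-1` [set~ 0%R]); split => //.
- rewrite /= PY; last exact: measurableC.
  by rewrite /cnormal_law eqxx diracE memNset//; apply.
Qed.

Lemma cnormal_pos_facts (Y : T -> R) (s : R) : (0 < s)%R -> cnormal Y s ->
  [/\ P.-integrable setT (EFin \o Y), \int[P]_x (Y x)%:E = 0,
      P.-integrable setT (fun x => (Y x ^+ 2)%:E) &
      \int[P]_x (Y x ^+ 2)%:E = (s ^+ 2)%:E].
Proof.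
move=> s0 [mY _ PY].
have {}PY B : measurable B -> P (Y @^-1` B) = normal_prob 0 s B.
  by move=> mB; rewrite PY// /cnormal_law gt_eqF.
have h1 t : \int[P]_x (expR (t * Y x))%:E = (expR (t ^+ 2 * s ^+ 2 / 2))%:E.
  by rewrite -(normal_law_mgf t s0 mY PY); apply: eq_integral => x _; rewrite subr0.
have h2 q : (0 < q)%R ->
    \int[P]_x (expR ((1 - q ^- 2) * (Y x ^+ 2 / (s ^+ 2 *+ 2))))%:E = q%:E.
  move=> q0; rewrite -(normal_law_sqr_mgf s0 q0 mY PY).
  by apply: eq_integral => x _; rewrite subr0.
split.
- exact: mgf_integrable_id mY h1.
- exact: mgf_mean mY s0 h1.
- exact: sqr_mgf_integrable mY s0 h2.
- exact: sqr_mgf_moment mY s0 h2.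
Qed.

Lemma cnormal_facts (Y : T -> R) (s : R) : cnormal Y s ->
  [/\ P.-integrable setT (EFin \o Y), \int[P]_x (Y x)%:E = 0,
      P.-integrable setT (fun x => (Y x ^+ 2)%:E) &
      \int[P]_x (Y x ^+ 2)%:E = (s ^+ 2)%:E].
Proof.
move=> cY; have [mY s_ge0 PY] := cY.
have [s0|] := eqVneq s 0%R; last first.
  by move=> sN0; apply: cnormal_pos_facts => //; rewrite lt_neqAle eq_sym sN0.
subst s; have Y0 := cnormal0_ae cY.
have e1 : ae_eq P setT (EFin \o Y) (cst 0).
  by apply: filterS Y0 => x /= -> _.
have e2 : ae_eq P setT (fun x => (Y x ^+ 2)%:E) (cst 0).
  by apply: filterS Y0 => x /= -> _; rewrite expr0n.
have m1 : measurable_fun setT (EFin \o Y) by exact/measurable_EFinP.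
have m2 : measurable_fun setT (fun x => (Y x ^+ 2)%:E).
  by apply/measurable_EFinP; exact: measurable_funX.
have int0 (f : T -> \bar R) : measurable_fun setT f -> ae_eq P setT f (cst 0) ->
    P.-integrable setT f /\ \int[P]_x f x = 0.
  move=> mf f0; split; last by rewrite (ae_eq_integral (cst 0))// integral0.
  apply/integrableP; split => //.
  have -> : \int[P]_x `|f x| = \int[P]_x (cst 0) x; last by rewrite integral0 ltry.
  apply: ae_eq_integral => //; first exact: measurableT_comp.
  by apply: filterS f0 => x /= /(_ I) ->; rewrite abse0.
have [i1 j1] := int0 _ m1 e1; have [i2 j2] := int0 _ m2 e2.
by split=> //; rewrite expr0n.
Qed.

(** The location parameter of a normal law is its mean. *)
Lemma normal_law_cnormal (Y : T -> R) : measurable_fun setT Y ->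
  normal_law (fun B => P (Y @^-1` B)) -> \int[P]_x (Y x)%:E = 0 ->
  exists s, cnormal Y s.
Proof.
move=> mY [[m Ym]|[m [s [s0 Ym]]]] EY.
- exists 0%R; split => // B mB; rewrite Ym// /cnormal_law eqxx.
  suff -> : m = 0%R by [].
  have mN : measurable (Y @^-1` [set~ m]).
    by rewrite -[X in measurable X]setTI; apply: mY => //; exact: measurableC.
  have Yae : ae_eq P setT (EFin \o Y) (cst m%:E).
    exists (Y @^-1` [set~ m]); split => //.
    + by rewrite /= Ym; [rewrite diracE memNset//; apply|exact: measurableC].
    + by move=> x /= h ym; apply: h => _; rewrite ym.
  have : \int[P]_x (Y x)%:E = \int[P]_x (cst m%:E) x.
    by apply: ae_eq_integral => //; exact/measurable_EFinP.
  by rewrite EY integral_cst//= probability_setT mule1 => -[].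
- suff m0 : m = 0%R.
    exists s; split=> //; first exact: ltW.
    by move=> B mB; rewrite Ym// m0 /cnormal_law gt_eqF.
  have mB : measurable_fun setT (fun x => Y x - m)%R by exact: measurable_funB.
  have h1 t := normal_law_mgf t s0 mY Ym.
  have E0 := mgf_mean mB s0 h1.
  have iB := mgf_integrable_id mB h1.
  have iY : P.-integrable setT (EFin \o Y).
    rewrite (_ : EFin \o Y = (EFin \o (fun x => Y x - m)%R) \+ (EFin \o cst m)).
      by apply: integrableD => //; exact: finite_measure_integrable_cst.
    by apply/funext => x /=; rewrite -EFinD subrK.
  move: E0; rewrite (eq_integral (fun x => (Y x)%:E + (cst (- m)%:E x))); last first.
    by move=> x _; rewrite -EFinD.
  rewrite integralD//=; last exact: finite_measure_integrable_cst.
  rewrite EY add0e -[X in X = _]/(\int[P]_x (cst (- m)%:E x)).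
  by rewrite integral_cst//= probability_setT mule1 => -[/eqP]; rewrite oppr_eq0 => /eqP.
Qed.

End centered_normal.

(** * Convolution of normal laws *)

Section normal_convolution.
Context {R : realType}.
Local Notation mu := (@lebesgue_measure R).

(** Completing the square in x: the second factor on the right is the density of
    the first summand conditioned on the value z of the sum, so it integrates
    to 1 in x. *)
Lemma normal_pdf_conv (s1 s2 x z : R) : 0 < s1 -> 0 < s2 ->
  let r := Num.sqrt (s1 ^+ 2 + s2 ^+ 2) in
  normal_pdf 0 s1 x * normal_pdf 0 s2 (z - x) =
  normal_pdf 0 r z * normal_pdf (z * s1 ^+ 2 / r ^+ 2) (s1 * s2 / r) x.
Proof.
move=> s10 s20 r.
have D0 : 0 < s1 ^+ 2 + s2 ^+ 2 by rewrite addr_gt0 ?exprn_gt0.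
have r0 : 0 < r by rewrite sqrtr_gt0.
have r2 : r ^+ 2 = s1 ^+ 2 + s2 ^+ 2 by rewrite sqr_sqrtr// ltW.
have t0 : 0 < s1 * s2 / r by rewrite divr_gt0 ?mulr_gt0.
rewrite !normal_pdf_expE ?gt_eqF// mulrACA [RHS]mulrACA; congr (_ * _).
  have peakE (s : R) : 0 < s -> normal_peak s = s^-1 * normal_peak 1.
    by move=> s0; rewrite -normal_peakM// mulr1.
  rewrite (peakE _ s10) (peakE _ s20) (peakE _ r0) (peakE _ t0).
  rewrite mulrACA [RHS]mulrACA; congr (_ * _).
  by field; rewrite !gt_eqF.
rewrite -!expRD; congr expR.
rewrite !subr0 [in RHS]exprMn exprVn [(s1 * s2) ^+ 2]exprMn r2.
have a0 : 0 < s1 ^+ 2 by rewrite exprn_gt0.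
have b0 : 0 < s2 ^+ 2 by rewrite exprn_gt0.
move: (s1 ^+ 2) (s2 ^+ 2) a0 b0 D0 => a b a0 b0 D0 {s1 s2 s10 s20 r r0 r2 t0}.
by field; rewrite !gt_eqF.
Qed.

Lemma normal_conv (s1 s2 : R) (f : R -> \bar R) : 0 < s1 -> 0 < s2 ->
  measurable_fun setT f -> (forall x, (0 <= f x)%E) ->
  (\int[normal_prob 0 s1]_x \int[normal_prob 0 s2]_y f (x + y)%R =
   \int[normal_prob 0 (Num.sqrt (s1 ^+ 2 + s2 ^+ 2))]_x f x)%E.
Proof.
move=> s10 s20 mf f0.
have mfD : measurable_fun [set: measurableTypeR R * measurableTypeR R]
    (fun z => f ((z.1 : R) + (z.2 : R))).
  apply: (measurableT_comp mf); exact: measurable_funD.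
rewrite ge0_integral_normal; last 2 first.
- exact: (@measurable_fun_fubini_tonelli_F _ _ _ _ R (normal_prob 0 s2) _ mfD (fun z => f0 _)).
- by move=> x; apply: integral_ge0.
pose g (z : measurableTypeR R * measurableTypeR R) := (f z.2 * (normal_pdf 0 s1 z.1 * normal_pdf 0 s2 (z.2 - z.1))%:E)%E.
have pdf_ge0 := normal_pdf_ge0.
have mpdf := measurable_normal_pdf.
have mg : measurable_fun [set: measurableTypeR R * measurableTypeR R] g.
  apply: emeasurable_funM; first exact: measurableT_comp.
  apply/measurable_EFinP; apply: measurable_funM.
    exact: (measurableT_comp (mpdf R 0 s1) measurable_fst).
  apply: (measurableT_comp (mpdf R 0 s2)).
  exact: (measurable_funB measurable_snd measurable_fst).
have g0 z : (0 <= g z)%E.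
  apply: mule_ge0; first exact: f0.
  by rewrite lee_fin; apply: mulr_ge0; exact: normal_pdf_ge0.
transitivity (\int[mu]_x \int[mu]_z g (x, z))%E.
  apply: eq_integral => x _.
  have mfx : measurable_fun setT (fun y : R => f (x + y)).
    by apply: measurableT_comp => //; exact: measurable_funD.
  rewrite ge0_integral_normal// -ge0_integralZr//=; last 3 first.
  - apply: emeasurable_funM => //; apply/measurable_EFinP.
    exact: measurable_normal_pdf.
  - by move=> y _; rewrite mule_ge0// lee_fin normal_pdf_ge0.
  - by rewrite lee_fin normal_pdf_ge0.
  rewrite -(@ge0_integral_shift R (fun z => g (x, z)) x)//; last exact: measurableT_comp.
  apply: eq_integral => y _; rewrite /g/= addrK -muleA -EFinM.
  by rewrite addrC [X in (_ * X%:E)%E]mulrC.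
rewrite (fubini_tonelli (m1 := mu) (m2 := mu))// ge0_integral_normal//.
apply: eq_integral => z _; rewrite /g/=.
under eq_integral do rewrite normal_pdf_conv// EFinM muleA.
rewrite ge0_integralZl//=.
- by rewrite integral_normal_pdf mule1.
- by apply/measurable_EFinP; exact: measurable_normal_pdf.
- by move=> x _; rewrite lee_fin normal_pdf_ge0.
- by rewrite mule_ge0// lee_fin normal_pdf_ge0.
Qed.

End normal_convolution.

Section cnormal_integral.
Local Open Scope ereal_scope.
Context {R : realType}.

Definition cnormal_int (s : R) (f : R -> \bar R) : \bar R :=
  if s == 0%R then f 0%R else \int[normal_prob 0 s]_x f x.

Lemma cnormal_int_conv (s1 s2 : R) (f : R -> \bar R) : (0 <= s1)%R -> (0 <= s2)%R ->
  measurable_fun setT f -> (forall x, 0 <= f x) ->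
  cnormal_int s1 (fun x => cnormal_int s2 (fun y => f (x + y)%R)) =
  cnormal_int (Num.sqrt (s1 ^+ 2 + s2 ^+ 2)) f.
Proof.
rewrite le_eqVlt => /predU1P[<- s2_ge0|s10].
  have -> : Num.sqrt (0 ^+ 2 + s2 ^+ 2) = s2.
    by rewrite expr0n add0r sqrtr_sqr ger0_norm.
  rewrite /cnormal_int eqxx => mf f0; case: ifPn => _; rewrite ?add0r//.
  by under eq_integral do rewrite add0r.
rewrite le_eqVlt => /predU1P[<-|s20] mf f0; rewrite /cnormal_int.
  have -> : Num.sqrt (s1 ^+ 2 + 0 ^+ 2) = s1.
    by rewrite expr0n addr0 sqrtr_sqr gtr0_norm.
  rewrite eqxx gt_eqF//; by under eq_integral do rewrite addr0.
have D0 : (0 < s1 ^+ 2 + s2 ^+ 2)%R by rewrite addr_gt0 ?exprn_gt0.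
have r0 : (0 < Num.sqrt (s1 ^+ 2 + s2 ^+ 2))%R by rewrite sqrtr_gt0.
rewrite (gt_eqF s10) (gt_eqF s20) (gt_eqF r0).
exact: normal_conv.
Qed.

Lemma cnormal_int_ge0 (s : R) (f : R -> \bar R) :
  (forall x, 0 <= f x) -> 0 <= cnormal_int s f.
Proof. by move=> f0; rewrite /cnormal_int; case: ifPn => // _; exact: integral_ge0. Qed.

Lemma measurable_cnormal_int (s : R) (f : R -> \bar R) :
  measurable_fun setT f -> (forall x, 0 <= f x) ->
  measurable_fun setT (fun x : R => cnormal_int s (fun y => f (x + y)%R)).
Proof.
move=> mf f0; rewrite /cnormal_int; case: (s == 0%R).
  by apply: measurableT_comp => //; exact: measurable_funD.
have mfD : measurable_fun [set: measurableTypeR R * measurableTypeR R]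
    (fun z => f ((z.1 : R) + (z.2 : R))%R).
  apply: (measurableT_comp mf); exact: measurable_funD.
exact: (@measurable_fun_fubini_tonelli_F _ _ _ _ R (normal_prob 0 s) _ mfD (fun z => f0 _)).
Qed.

Context d (T : measurableType d) (P : probability T R).

Lemma cnormal_integral (Y : T -> R) (s : R) (f : R -> \bar R) :
  cnormal P Y s -> measurable_fun setT f -> (forall x, 0 <= f x) ->
  \int[P]_x f (Y x) = cnormal_int s f.
Proof.
move=> cY mf f0; have [mY s_ge0 PY] := cY; rewrite /cnormal_int.
case: (eqVneq s 0%R) => [s0|sN0]; last first.
  apply: ge0_integral_law => // B mB.
  by rewrite PY// /cnormal_law (negbTE sN0).
subst s; have -> : \int[P]_x f (Y x) = \int[P]_x (cst (f 0%R) x).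
  apply: ae_eq_integral => //; first exact: measurableT_comp.
  by apply: filterS (cnormal0_ae cY) => x /= ->.
by rewrite integral_cst//= probability_setT mule1.
Qed.

Lemma cnormalE (Y : T -> R) (s : R) : measurable_fun setT Y -> (0 <= s)%R ->
  (forall B, measurable B -> P (Y @^-1` B) = cnormal_int s (EFin \o \1_B)) ->
  cnormal P Y s.
Proof.
move=> mY s0 PY; split=> // B mB; rewrite PY// /cnormal_int /cnormal_law.
case: ifPn => _; first by rewrite diracE /= indicE.
by rewrite integral_indic// setIT.
Qed.

End cnormal_integral.

Section cnormal_product.
Local Open Scope ereal_scope.
Context {R : realType} d1 d2 (T1 : measurableType d1) (T2 : measurableType d2).
Variables (P1 : probability T1 R) (P2 : probability T2 R).

Lemma cnormal_indep_sum (Y1 : T1 -> R) (Y2 : T2 -> R) (s1 s2 : R) :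
  cnormal P1 Y1 s1 -> cnormal P2 Y2 s2 ->
  cnormal (P1 \x P2) (fun z => Y1 z.1 + Y2 z.2)%R (Num.sqrt (s1 ^+ 2 + s2 ^+ 2)).
Proof.
move=> c1 c2; have [m1 s10 _] := c1; have [m2 s20 _] := c2.
have mY : measurable_fun setT (fun z : T1 * T2 => Y1 z.1 + Y2 z.2)%R.
  by apply: measurable_funD; exact: measurableT_comp.
apply: (cnormalE mY (sqrtr_ge0 _)) => B mB.
have mI : measurable_fun setT (EFin \o (\1_B : R -> R)) by exact/measurable_EFinP.
have I0 x : 0 <= (EFin \o (\1_B : R -> R)) x by rewrite lee_fin.
rewrite -cnormal_int_conv// -(cnormal_integral c1); last 2 first.
- exact: measurable_cnormal_int.
- by move=> x; exact: cnormal_int_ge0.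
have mYB : measurable ((fun z : T1 * T2 => Y1 z.1 + Y2 z.2)%R @^-1` B).
  by rewrite -[X in measurable X]setTI; exact: mY.
rewrite /product_measure1/=; apply: eq_integral => x _.
rewrite -(cnormal_integral c2); last 2 first.
- by apply: (measurableT_comp mI); exact: measurable_funD.
- by move=> y; rewrite lee_fin.
transitivity (\int[P2]_y (\1_(xsection ((fun z : T1 * T2 => Y1 z.1 + Y2 z.2)%R @^-1` B) x) y)%:E).
  by rewrite integral_indic ?setIT//; exact: measurable_xsection.
apply: eq_integral => y _; rewrite !indicE; congr (_%:R%:E).
by rewrite mem_xsection; congr nat_of_bool; apply/idP/idP; rewrite !inE.
Qed.

End cnormal_product.

(** * The Cramer-Wold theorem *)

Section sine_threshold.
Context {R : realType}.
Implicit Types x y t : R.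

Lemma sin_le_id x : 0 <= x -> sin x <= x.
Proof.
rewrite le_eqVlt => /predU1P[<-|x0]; first by rewrite sin0.
have [|c _] := @MVT R sin cos 0 x x0.
  by apply: continuous_subspaceT => c; exact: continuous_sin.
rewrite sin0 !subr0 => ->; by rewrite ler_piMl ?cos_le1// ltW.
Qed.

Lemma cos_ge_half x : 0 <= x <= 1 -> 1 / 2 <= cos x.
Proof.
move=> /andP[]; have [y ->] : exists y, x = y *+ 2.
  by exists (x / 2); lra.
move=> x0 x1; rewrite cos_mulr2n.
have s0 : 0 <= sin y.
  by apply: sin_ge0_pi; have := pi_ge2 R => p; apply/andP; split; lra.
have s1 : sin y <= y by apply: sin_le_id; lra.
have := cos2Dsin2 y.
move: (sin _) (cos _) s0 s1 => S C; nra.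
Qed.

Lemma sin_ge_half x : 0 <= x <= 1 -> x / 2 <= sin x.
Proof.
move=> /andP[]; rewrite le_eqVlt => /predU1P[<-|x0] x1.
  by rewrite sin0 mul0r.
have [|c] := @MVT R sin cos 0 x x0.
  by apply: continuous_subspaceT => c; exact: continuous_sin.
rewrite in_itv/= => /andP[c0 cx]; rewrite sin0 !subr0 => ->.
rewrite mulrC ler_pM2r//.
have := @cos_ge_half c; rewrite mul1r => -> //.
by rewrite ltW// (le_trans (ltW cx)).
Qed.

Lemma expr_ge1DMn x (n : nat) : -1 <= x -> 1 + n%:R * x <= (1 + x) ^+ n.
Proof.
move=> x1; elim: n => [|n IH]; first by rewrite mul0r addr0 expr0.
rewrite exprS; apply: le_trans (ler_wpM2l _ IH); last lra.
rewrite -natr1; have : 0 <= n%:R * x ^+ 2 by rewrite mulr_ge0 ?sqr_ge0.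
move: (n%:R) => N; lra.
Qed.

Lemma expr_1B_le x (n : nat) : 0 <= x <= 1 -> (1 - x) ^+ n * (1 + n%:R * x) <= 1.
Proof.
move=> /andP[x0 x1].
apply: (@le_trans _ _ ((1 - x) ^+ n * (1 + x) ^+ n)).
  by rewrite ler_wpM2l ?exprn_ge0 ?subr_ge0// expr_ge1DMn//; lra.
rewrite -exprMn exprn_ile1//; nra.
Qed.

(** The polynomial (1 - v ^ k) ^ (2 ^ k) is a soft threshold at v = 1 / 2: in
    the variable v = (1 + e) / 2 it is within 1 / (1 + k |e|) of the indicator of
    e <= 0. Both bounds are Bernoulli inequalities. *)
Definition threshold (k : nat) (v : R) : R := (1 - v ^+ k) ^+ (2 ^ k).

Lemma threshold01 k v : 0 <= v <= 1 -> 0 <= threshold k v <= 1.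
Proof.
move=> /andP[v0 v1].
have : 0 <= v ^+ k <= 1 by rewrite exprn_ge0// exprn_ile1.
move=> /andP[a b]; rewrite exprn_ge0/= ?exprn_ile1//; lra.
Qed.

Lemma threshold_neg k e : 0 <= e <= 1 ->
  `|1 - threshold k ((1 - e) / 2)| * (1 + k%:R * e) <= 1.
Proof.
move=> /andP[e0 e1]; set v := (1 - e) / 2.
have v0 : 0 <= v by rewrite /v; lra.
have v1 : v <= 1 by rewrite /v; lra.
have /andP[t0 t1] := @threshold01 k v ltac:(by rewrite v0 v1).
rewrite ger0_norm ?subr_ge0//.
apply: le_trans (@expr_1B_le e k _); last by rewrite e0.
have K0 : 0 <= 1 + k%:R * e by rewrite addr_ge0// mulr_ge0.
apply: ler_wpM2r => //; rewrite lerBlDr -lerBlDl.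
have -> : (1 - e) ^+ k = (2 ^ k)%:R * v ^+ k.
  by rewrite natrX -exprMn /v; congr (_ ^+ _); field.
have := @expr_ge1DMn (- v ^+ k) (2 ^ k)%N; rewrite mulrN /threshold; apply.
by rewrite lerN2 exprn_ile1.
Qed.

Lemma threshold_pos k e : 0 <= e <= 1 ->
  threshold k ((1 + e) / 2) * (1 + k%:R * e) <= 1.
Proof.
move=> /andP[e0 e1]; set v := (1 + e) / 2.
have v0 : 0 <= v by rewrite /v; lra.
have v1 : v <= 1 by rewrite /v; lra.
have vk : 0 <= v ^+ k <= 1 by rewrite exprn_ge0// exprn_ile1.
apply: le_trans (@expr_1B_le (v ^+ k) (2 ^ k)%N vk).
rewrite /threshold; apply: ler_wpM2l.
  by rewrite exprn_ge0// subr_ge0; case/andP: vk.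
have -> : (2 ^ k)%:R * v ^+ k = (1 + e) ^+ k.
  by rewrite natrX -exprMn /v; congr (_ ^+ _); field.
apply: (@le_trans _ _ ((1 + e) ^+ k)); last by rewrite lerDr.
by apply: expr_ge1DMn; lra.
Qed.

Definition ray_approx (m : nat) (y : R) : R :=
  threshold (m.+1 ^ 3) ((1 + sin (m.+1%:R^-1 * y - m.+1%:R^-1 ^+ 2)) / 2).

Lemma ray_approx01 m y : 0 <= ray_approx m y <= 1.
Proof.
apply: threshold01.
have := sin_geN1 (m.+1%:R^-1 * y - m.+1%:R^-1 ^+ 2).
have := sin_le1 (m.+1%:R^-1 * y - m.+1%:R^-1 ^+ 2).
by move: (sin _) => z *; apply/andP; split; lra.
Qed.

(** The shift by h ^ 2 makes the limit correct at y = 0; the exponent h ^ -3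
    beats the angle, which is at least h ^ 2 in absolute value. *)
Lemma cvg_ray_approx y : ray_approx m y @[m --> \oo] --> ((y <= 0)%R%:R : R).
Proof.
have bound m : `|y| + 1 <= m.+1%:R -> (0 < y -> 2 <= m.+1%:R * y) ->
    `|(y <= 0)%R%:R - ray_approx m y| <= 2 * m.+1%:R^-1.
  move=> my ypos; set M : R := m.+1%:R in my ypos *.
  have M0 : 0 < M by rewrite ltr0n.
  rewrite /ray_approx -/M; set h := M^-1.
  have h0 : 0 < h by rewrite invr_gt0.
  have hM : h * M = 1 by rewrite mulVf// gt_eqF.
  have h1 : h * (`|y| + 1) <= 1 by rewrite -[leRHS]hM ler_pM2l.
  have hle1 : h <= 1 by have := normr_ge0 y; nra.
  have kE : (m.+1 ^ 3)%:R = M ^+ 3 by rewrite natrX.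
  have fin (D e : R) : 0 <= D -> h ^+ 2 / 2 <= e ->
      D * (1 + (m.+1 ^ 3)%:R * e) <= 1 -> D <= 2 * h.
    move=> D0 he; rewrite kE => De.
    have : D * (M / 2) <= 1.
      apply: le_trans De; apply: ler_wpM2l => //.
      have : M ^+ 3 * (h ^+ 2 / 2) <= M ^+ 3 * e by rewrite ler_pM2l// exprn_gt0.
      have -> : M ^+ 3 * (h ^+ 2 / 2) = M / 2.
        by rewrite /h; field; rewrite gt_eqF.
      lra.
    by move=> DM; rewrite /h ler_pdivlMr//; lra.
  have [y0|y0] := leP y 0.
  - pose t := h ^+ 2 - h * y.
    have t0 : h ^+ 2 <= t by rewrite /t; nra.
    have tp : 0 <= t by apply: le_trans t0; exact: sqr_ge0.
    have t1 : t <= 1 by move: h1; rewrite /t ler0_norm//; nra.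
    have -> : h * y - h ^+ 2 = - t by rewrite /t opprB.
    have s1 := @sin_ge_half t; have {}s1 : t / 2 <= sin t by apply: s1; rewrite tp.
    rewrite sinN; apply: (fin _ (sin t)) => //; first lra.
    by apply: threshold_neg; rewrite sin_le1 andbT; lra.
  - pose t := h * y - h ^+ 2.
    have t0 : h ^+ 2 <= t.
      have := ypos y0 => My; rewrite /t.
      have : h * h * 2 <= h * h * (M * y) by rewrite ler_pM2l// mulr_gt0.
      have -> : h * h * (M * y) = h * y * (h * M) by ring.
      by rewrite hM expr2; lra.
    have tp : 0 <= t by apply: le_trans t0; exact: sqr_ge0.
    have t1 : t <= 1 by move: h1; rewrite /t gtr0_norm//; nra.
    have s1 := @sin_ge_half t; have {}s1 : t / 2 <= sin t by apply: s1; rewrite tp.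
    have sb : 0 <= sin t <= 1 by rewrite sin_le1 andbT; lra.
    rewrite -/t sub0r normrN ger0_norm; last first.
      by apply: (proj1 (andP (@threshold01 _ _ _))); lra.
    apply: (fin _ (sin t)) => //; last exact: threshold_pos.
    + by apply: (proj1 (andP (@threshold01 _ _ _))); lra.
    + lra.
apply/cvgrPdist_le => e e0; near=> m.
apply: le_trans (bound m _ _) _.
- near: m.
  by exists (Num.truncn (`|y| + 1)) => // m /= h; apply: le_trans (ltW (truncnS_gt _)) _; rewrite ler_nat.
- move=> y0; rewrite -ler_pdivrMr//; near: m.
  by exists (Num.truncn (2 / y)) => // m /= h; apply: le_trans (ltW (truncnS_gt _)) _; rewrite ler_nat.
- rewrite ler_pdivrMr ?ltr0n// mulrC -ler_pdivrMr//; near: m.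
  by exists (Num.truncn (2 / e)) => // m /= h; apply: le_trans (ltW (truncnS_gt _)) _; rewrite ler_nat.
Unshelve. all: by end_near. Qed.

End sine_threshold.

Section cramer_wold.
Context {R : realType} d1 d2 (T1 : measurableType d1) (T2 : measurableType d2).
Variables (P1 : probability T1 R) (P2 : probability T2 R) (n : nat).

Definition lincomb (a : 'I_n -> R) (x : n.-tuple R) : R :=
  \sum_(i < n) a i * tnth x i.

Lemma measurable_lincomb a : measurable_fun setT (lincomb a).
Proof.
apply: measurable_sum => i; apply: measurable_funM => //.
exact: measurable_tnth.
Qed.

Variables (X : T1 -> n.-tuple R) (Y : T2 -> n.-tuple R).
Hypotheses (mX : measurable_fun setT X) (mY : measurable_fun setT Y).
Hypothesis XY : forall a B, measurable B ->
  P1 ((fun w => lincomb a (X w)) @^-1` B) = P2 ((fun w => lincomb a (Y w)) @^-1` B).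

Definition same_integral (G : n.-tuple R -> R) :=
  [/\ measurable_fun setT G, exists M : R, forall x, `|G x| <= M &
      (\int[P1]_w (G (X w))%:E = \int[P2]_w (G (Y w))%:E)%E].

(** The equality of integrals is not stable under products; it becomes so when it
    is required after multiplication by every cosine of a linear form. *)
Definition trig_stable (G : n.-tuple R -> R) :=
  forall a c, same_integral (fun x => cos (lincomb a x + c) * G x).

Lemma bounded_RV_integrable d (T : measurableType d) (P : probability T R)
    (G : T -> R) (M : R) : measurable_fun setT G -> (forall x, `|G x| <= M) ->
  P.-integrable setT (EFin \o G).
Proof.
move=> mG GM; apply: measurable_bounded_integrable => //.
  by rewrite /= probability_setT ltry.
exists M; split; first exact: num_real.
by move=> x Mx t _ /=; apply: (le_trans (GM t)); exact: ltW.
Qed.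

Lemma same_integral_lin G1 G2 k1 k2 : same_integral G1 -> same_integral G2 ->
  same_integral (fun x => k1 * G1 x + k2 * G2 x).
Proof.
move=> [m1 [M1 b1] e1] [m2 [M2 b2] e2]; split.
- by apply: measurable_funD; exact: measurable_funM.
- exists (`|k1| * M1 + `|k2| * M2) => x; rewrite (le_trans (ler_normD _ _))//.
  by rewrite !normrM lerD// ler_wpM2l.
- have lin d (T : measurableType d) (P : probability T R) (Z : T -> n.-tuple R) :
      measurable_fun setT Z ->
      (\int[P]_w (k1 * G1 (Z w) + k2 * G2 (Z w))%:E =
       k1%:E * \int[P]_w (G1 (Z w))%:E + k2%:E * \int[P]_w (G2 (Z w))%:E)%E.
    move=> mZ.
    have i1 : P.-integrable setT (fun w => (G1 (Z w))%:E).
      exact: (@bounded_RV_integrable _ _ P (G1 \o Z) M1 (measurableT_comp m1 mZ) (fun w => b1 (Z w))).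
    have i2 : P.-integrable setT (fun w => (G2 (Z w))%:E).
      exact: (@bounded_RV_integrable _ _ P (G2 \o Z) M2 (measurableT_comp m2 mZ) (fun w => b2 (Z w))).
    under eq_integral do rewrite EFinD 2!EFinM.
    by rewrite integralD//; [rewrite !integralZl|exact: integrableZl|exact: integrableZl].
  by rewrite !lin// e1 e2.
Qed.

Lemma same_integral_lim (G_ : nat -> n.-tuple R -> R) (G : n.-tuple R -> R) (M : R) :
  (forall m, same_integral (G_ m)) -> (forall m x, `|G_ m x| <= M) ->
  (forall x, G_ m x @[m --> \oo] --> G x) -> same_integral G.
Proof.
move=> sG bG cG.
have mG_ m : measurable_fun setT (G_ m) by have [] := sG m.
have mG : measurable_fun setT G by apply: (measurable_fun_cvg (h := G_)).
have GM x : `|G x| <= M.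
  have h : `|G_ m x| @[m --> \oo] --> `|G x| by apply: cvg_norm; exact: cG.
  rewrite -(cvg_lim _ h)//; apply: limr_le; first by apply/cvg_ex; exists `|G x|.
  by near=> m; exact: bG.
split=> //; first by exists M.
have dc d (T : measurableType d) (P : probability T R) (Z : T -> n.-tuple R) :
    measurable_fun setT Z ->
    (\int[P]_w (G_ m (Z w))%:E @[m --> \oo] --> \int[P]_w (G (Z w))%:E)%E.
  move=> mZ.
  have mf m : measurable_fun setT (fun w => (G_ m (Z w))%:E).
    by apply/measurable_EFinP; exact: measurableT_comp.
  have mf' : measurable_fun setT (fun w => (G (Z w))%:E).
    by apply/measurable_EFinP; exact: measurableT_comp.
  have cf : {ae P, forall w, setT w -> (G_ m (Z w))%:E @[m --> \oo] --> (G (Z w))%:E}.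
    by apply: aeW => w _; apply: cvg_EFin; [exact: nearW|exact: cG].
  have ic : P.-integrable setT (cst M%:E) by exact: finite_measure_integrable_cst.
  have bd : {ae P, forall w m, setT w -> (`|(G_ m (Z w))%:E| <= (cst M%:E) w)%E}.
    by apply: aeW => w m _; rewrite lee_fin.
  by have [_ _] := dominated_convergence measurableT mf mf' cf ic bd.
have h1 := dc _ _ P1 _ mX; have h2 := dc _ _ P2 _ mY.
rewrite -(cvg_lim _ h1)// -(cvg_lim _ h2)//.
by congr (limn _); apply/funext => m; have [] := sG m.
Unshelve. all: by end_near. Qed.

Lemma trig_stable_same G : trig_stable G -> same_integral G.
Proof.
move=> /(_ (fun=> 0) 0); congr same_integral; apply/funext => x.
rewrite /lincomb big1 ?add0r ?cos0 ?mul1r// => i _; exact: mul0r.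
Qed.

Lemma trig_stable1 : trig_stable (fun=> 1).
Proof.
move=> a c; have mcos : measurable_fun setT (fun x : R => cos (x + c)).
  apply: measurableT_comp; last exact: measurable_funD.
  by apply: continuous_measurable_fun => x; exact: continuous_cos.
have mG : measurable_fun setT (fun x => cos (lincomb a x + c)).
  exact: (measurableT_comp mcos (measurable_lincomb a)).
under eq_fun do rewrite mulr1.
split => //; first by exists 1 => x; rewrite ler_norml cos_geN1 cos_le1.
have law d (T : measurableType d) (P : probability T R) (Z : T -> R) (mZ : measurable_fun setT Z) :
    (\int[P]_w (cos (Z w + c))%:E =
     \int[distribution P (HB.pack_for {mfun T >-> R} Z (isMeasurableFun.Build _ _ _ _ _ mZ))]_x
        (cos (x + c))%:E)%E.
  rewrite integral_distribution//; first exact/measurable_EFinP.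
  have b w : `|cos (Z w + c)| <= 1 by rewrite ler_norml cos_geN1 cos_le1.
  exact: (bounded_RV_integrable P (measurableT_comp mcos mZ) b).
have m1 : measurable_fun setT (fun w => lincomb a (X w)).
  by apply: measurableT_comp => //; exact: measurable_lincomb.
have m2 : measurable_fun setT (fun w => lincomb a (Y w)).
  by apply: measurableT_comp => //; exact: measurable_lincomb.
rewrite (law _ _ _ _ m1) (law _ _ _ _ m2).
by apply: eq_measure_integral => B mB _; exact: XY.
Qed.

(** The multipliers of the class trig_stable form an algebra closed under bounded
    pointwise limits, which plays the role of Stone-Weierstrass and of Fourier
    uniqueness. *)
Definition multiplier (f : n.-tuple R -> R) :=
  (exists M : R, forall x, `|f x| <= M) /\
  forall G, trig_stable G -> trig_stable (fun x => f x * G x).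

(** The product of two cosines is a mean of two cosines. *)
Lemma multiplier_cos a c : multiplier (fun x => cos (lincomb a x + c)).
Proof.
split; first by exists 1 => x; rewrite ler_norml cos_geN1 cos_le1.
move=> G sG b e.
have -> : (fun x => cos (lincomb b x + e) * (cos (lincomb a x + c) * G x)) =
  (fun x => 2^-1 * (cos (lincomb (fun i => b i + a i) x + (e + c)) * G x) +
            2^-1 * (cos (lincomb (fun i => b i - a i) x + (e - c)) * G x)).
  apply/funext => x; rewrite mulrA -mulrDr -mulrDl mulrA; congr (_ * _).
  have -> : lincomb (fun i => b i + a i) x + (e + c) = (lincomb b x + e) + (lincomb a x + c).
    rewrite /lincomb addrACA; congr (_ + _); rewrite -big_split/=.
    by apply: eq_bigr => i _; rewrite mulrDl.
  have -> : lincomb (fun i => b i - a i) x + (e - c) = (lincomb b x + e) - (lincomb a x + c).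
    rewrite /lincomb opprD addrACA; congr (_ + _); rewrite -sumrB.
    by apply: eq_bigr => i _; rewrite mulrBl.
  move: (lincomb b x + e) (lincomb a x + c) => u v.
  by rewrite cosD cosB; field.
exact: same_integral_lin.
Qed.

Lemma multiplier_lin f g k1 k2 : multiplier f -> multiplier g ->
  multiplier (fun x => k1 * f x + k2 * g x).
Proof.
move=> [[M1 b1] m1] [[M2 b2] m2]; split.
  exists (`|k1| * M1 + `|k2| * M2) => x; rewrite (le_trans (ler_normD _ _))//.
  by rewrite !normrM lerD// ler_wpM2l.
move=> G sG a c.
have := @same_integral_lin _ _ k1 k2 (m1 _ sG a c) (m2 _ sG a c).
by congr same_integral; apply/funext => x; ring.
Qed.

Lemma multiplierM f g : multiplier f -> multiplier g ->
  multiplier (fun x => f x * g x).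
Proof.
move=> [[M1 b1] m1] [[M2 b2] m2]; split.
  by exists (M1 * M2) => x; rewrite normrM ler_pM.
move=> G sG a c.
have := m1 _ (m2 _ sG) a c.
by congr same_integral; apply/funext => x; rewrite !mulrA.
Qed.

Lemma multiplier1 : multiplier (fun=> 1).
Proof.
split; first by exists 1 => x; rewrite normr1.
by move=> G sG; under eq_fun do rewrite mul1r.
Qed.

Lemma multiplierX f k : multiplier f -> multiplier (fun x => f x ^+ k).
Proof.
move=> mf; elim: k => [|k IH]; first exact: multiplier1.
by under eq_fun do rewrite exprS; exact: multiplierM.
Qed.

Lemma multiplier_lim (f_ : nat -> n.-tuple R -> R) (f : n.-tuple R -> R) (M : R) :
  (forall m, multiplier (f_ m)) -> (forall m x, `|f_ m x| <= M) ->
  (forall x, f_ m x @[m --> \oo] --> f x) -> multiplier f.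
Proof.
move=> mf bf cf; split.
  exists M => x.
  have h : `|f_ m x| @[m --> \oo] --> `|f x| by apply: cvg_norm; exact: cf.
  rewrite -(cvg_lim _ h)//; apply: limr_le; first by apply/cvg_ex; exists `|f x|.
  by near=> m; exact: bf.
move=> G sG a c; have [_ [N bN] _] := trig_stable_same sG.
apply: (@same_integral_lim (fun m x => cos (lincomb a x + c) * (f_ m x * G x)) _ (1 * (M * N))).
- by move=> m; exact: (mf m).2.
- move=> m x; rewrite !normrM ler_pM// ?mulr_ge0//; last exact: ler_pM.
  by rewrite ler_norml cos_geN1 cos_le1.
- by move=> x; apply: cvgMr; apply: cvgMl; exact: cf.
Unshelve. all: by end_near. Qed.

(** The soft threshold of an affine function of a cosine is a polynomial in this
    cosine, and such polynomials converge to the indicator of a half-space. *)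
Lemma multiplier_ray i c : multiplier (fun x => (tnth x i <= c)%R%:R).
Proof.
apply: (@multiplier_lim (fun m x => ray_approx m (tnth x i - c)) _ 1).
- move=> m; set h : R := m.+1%:R^-1.
  pose v x := (1 + sin (h * (tnth x i - c) - h ^+ 2)) / 2.
  have mv : multiplier v.
    have -> : v = (fun x => 2^-1 * 1 + 2^-1 *
        cos (lincomb (fun j => if j == i then h else 0) x + (- h * c - h ^+ 2 - pi / 2))).
      apply/funext => x; rewrite addrA cosBpihalf /v.
      have -> : lincomb (fun j => if j == i then h else 0) x = h * tnth x i.
        rewrite /lincomb (bigD1 i)//= eqxx big1 ?addr0// => j /negPf ->.
        exact: mul0r.
      have -> : h * tnth x i + (- h * c - h ^+ 2) = h * (tnth x i - c) - h ^+ 2 by ring.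
      by field.
    by apply: multiplier_lin; [exact: multiplier1|exact: multiplier_cos].
  rewrite /ray_approx /threshold -/h -/v.
  apply: (multiplierX (f := fun x => 1 - v x ^+ (m.+1 ^ 3))).
  have := @multiplier_lin _ _ 1 (- 1) multiplier1 (multiplierX (m.+1 ^ 3) mv).
  by congr multiplier; apply/funext => x; rewrite mul1r mulN1r.
- by move=> m x; have /andP[a b] := ray_approx01 m (tnth x i - c); rewrite ger0_norm.
- by move=> x; rewrite -subr_le0; exact: cvg_ray_approx.
Qed.

Definition box (s : seq ('I_n * R)) : set (n.-tuple R) :=
  [set x | all (fun p => tnth x p.1 <= p.2) s].

Lemma multiplier_box s : multiplier (\1_(box s)).
Proof.
have -> : \1_(box s) = (fun x => \prod_(p <- s) (tnth x p.1 <= p.2)%R%:R) :> (n.-tuple R -> R).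
  apply/funext => x; rewrite indicE -natr_prod.
  have -> : (x \in box s) = all (fun p => tnth x p.1 <= p.2) s.
    by apply/idP/idP; rewrite inE.
  elim: s => [|p s IH]; first by rewrite big_nil.
  by rewrite big_cons/= natrM -IH -natrM mulnb.
elim: s => [|p s IH].
  by under eq_fun do rewrite big_nil; exact: multiplier1.
under eq_fun do rewrite big_cons; apply: multiplierM => //.
exact: multiplier_ray.
Qed.

Lemma boxes_generate :
  (measurable : set (set (n.-tuple R))) = <<s [set A | exists s, A = box s] >>.
Proof.
apply/seteqP; split.
- apply: smallest_sub; first exact: smallest_sigma_algebra.
  rewrite -bigcup_seq/= => A [i /= _ [B mB <-]]; rewrite setTI.
  pose C := [set B : set R | <<s [set A | exists s, A = box s] >> ((fun x : n.-tuple R => tnth x i) @^-1` B)].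
  suff : measurable `<=` C by apply.
  rewrite [X in X `<=` _]RGenOInfty.measurableE => D; apply: smallest_sub.
    split.
    - by rewrite /C/= preimage_set0; exact: sigma_algebra0.
    - move=> E; rewrite /C/= setTD preimage_setC -setTD.
      exact: sigma_algebraCD.
    - move=> F CF; rewrite /C/= preimage_bigcup; exact: sigma_algebra_bigcup.
  move=> _ [c ->]; rewrite /C/=.
  have -> : (tnth (T:=R))^~ i @^-1` `]c, +oo[ = setT `\` box [:: (i, c)].
    apply/seteqP; split => x /=; rewrite /box/= in_itv/= !andbT.
      by move=> h; split=> //; rewrite leNgt h.
    by move=> [_ /negP]; rewrite -ltNge.
  by apply: sigma_algebraCD; apply: sub_sigma_algebra; exists [:: (i, c)].
- apply: smallest_sub; first exact: sigma_algebra_measurable.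
  move=> _ [s ->].
  elim: s => [|p s IH]; first by rewrite (_ : box [::] = setT)//; apply/seteqP; split.
  have -> : box (p :: s) = ((fun x : n.-tuple R => tnth x p.1) @^-1` `]-oo, p.2]) `&` box s.
    by apply/seteqP; split => x /=; rewrite /box/= in_itv/= => /andP.
  apply: measurableI => //; rewrite -[X in measurable X]setTI.
  exact: measurable_tnth.
Qed.

(** Indicators of boxes are multipliers, and boxes are closed under intersection
    and generate the sigma-algebra. *)
Theorem cramer_wold (S : set (n.-tuple R)) : measurable S ->
  P1 (X @^-1` S) = P2 (Y @^-1` S).
Proof.
pose X' : {RV P1 >-> n.-tuple R} := HB.pack X (isMeasurableFun.Build _ _ _ _ _ mX).
pose Y' : {RV P2 >-> n.-tuple R} := HB.pack Y (isMeasurableFun.Build _ _ _ _ _ mY).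
move=> mS; rewrite -[LHS]/(distribution P1 X' S) -[RHS]/(distribution P2 Y' S).
apply: (measure_unique [set A | exists s, A = box s] (fun=> box [::])) => //.
- exact: boxes_generate.
- move=> _ _ [s ->] [t ->]; exists (s ++ t).
  by apply/seteqP; split => x /=; rewrite /box/= all_cat => /andP.
- by move=> _; exists [::].
- by apply/seteqP; split => // x _; exists 0%N.
- move=> _ [s ->].
  have mb : measurable (box s).
    by rewrite boxes_generate; apply: sub_sigma_algebra; exists s.
  have [_ Gst] := multiplier_box s.
  have [_ _] := trig_stable_same (Gst _ trig_stable1).
  under eq_integral do rewrite mulr1.
  under [X in _ = X -> _]eq_integral do rewrite mulr1.
  have mX1 : measurable (X @^-1` box s).
    by rewrite -[X in measurable X]setTI; exact: mX.
  have mY1 : measurable (Y @^-1` box s).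
    by rewrite -[X in measurable X]setTI; exact: mY.
  by rewrite !integral_indic// !setIT.
- move=> _; have -> : box [::] = setT by apply/seteqP; split.
  change (P1 (X @^-1` setT) < +oo)%E.
  by rewrite preimage_setT probability_setT ltry.
Qed.

End cramer_wold.

(** * Gaussian vectors and regression on a coordinate *)

Section square_integrable.
Context {R : realType} d (T : measurableType d) (P : probability T R).
Implicit Types Y Z : T -> R.

Definition sq_integrable Y :=
  measurable_fun setT Y /\ P.-integrable setT (fun w => (Y w ^+ 2)%:E).

Definition ip Y Z : R := (\int[P]_w (Y w * Z w))%R.

Lemma ip_integrable Y Z : sq_integrable Y -> sq_integrable Z ->
  P.-integrable setT (EFin \o (fun w => Y w * Z w)).
Proof.
move=> [mY iY] [mZ iZ].
apply: (@le_integrable _ _ _ P setT measurableT _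
  (fun w => (Y w ^+ 2)%:E + (Z w ^+ 2)%:E)%E).
- by apply/measurable_EFinP; exact: measurable_funM.
- move=> w _; rewrite /= lee_fin [leRHS]ger0_norm ?addr_ge0 ?sqr_ge0//.
  by rewrite ler_norml; apply/andP; split; nra.
- exact: integrableD.
Qed.

Lemma sq_integrableZ k Y : sq_integrable Y -> sq_integrable (fun w => k * Y w).
Proof.
move=> [mY iY]; split; first exact: measurable_funM.
have := integrableZl measurableT (k ^+ 2) iY.
by congr (P.-integrable _ _); apply/funext => w; rewrite exprMn EFinM.
Qed.

Lemma sq_integrableD Y Z : sq_integrable Y -> sq_integrable Z ->
  sq_integrable (fun w => Y w + Z w).
Proof.
move=> sY sZ; have := ip_integrable sY sZ; move: sY sZ => [mY iY] [mZ iZ] iYZ.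
split; first exact: measurable_funD.
have := integrableD measurableT (integrableD measurableT iY iZ) (integrableZl measurableT 2 iYZ).
congr (P.-integrable _ _); apply/funext => w /=.
by rewrite -EFinM -!EFinD; congr EFin; ring.
Qed.

Lemma ipC Y Z : ip Y Z = ip Z Y.
Proof. by rewrite /ip; under eq_Rintegral do rewrite mulrC. Qed.

Lemma ipDl Y1 Y2 Z : sq_integrable Y1 -> sq_integrable Y2 -> sq_integrable Z ->
  ip (fun w => Y1 w + Y2 w) Z = ip Y1 Z + ip Y2 Z.
Proof.
move=> s1 s2 sZ; rewrite /ip -RintegralD//; [|exact: ip_integrable..].
by apply: eq_Rintegral => w _; rewrite mulrDl.
Qed.

Lemma ipZl k Y Z : sq_integrable Y -> sq_integrable Z ->
  ip (fun w => k * Y w) Z = k * ip Y Z.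
Proof.
move=> sY sZ; rewrite /ip -RintegralZl//; last exact: ip_integrable.
by apply: eq_Rintegral => w _; rewrite mulrA.
Qed.

Lemma ipDr Y Z1 Z2 : sq_integrable Y -> sq_integrable Z1 -> sq_integrable Z2 ->
  ip Y (fun w => Z1 w + Z2 w) = ip Y Z1 + ip Y Z2.
Proof. by move=> sY s1 s2; rewrite ipC ipDl// ![ip _ Y]ipC. Qed.

Lemma ipZr k Y Z : sq_integrable Y -> sq_integrable Z ->
  ip Y (fun w => k * Z w) = k * ip Y Z.
Proof. by move=> sY sZ; rewrite ipC ipZl// [ip Z Y]ipC. Qed.

Lemma ip_sqrD Y Z : sq_integrable Y -> sq_integrable Z ->
  ip (fun w => Y w + Z w) (fun w => Y w + Z w) = ip Y Y + 2 * ip Y Z + ip Z Z.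
Proof.
move=> sY sZ; have sYZ := sq_integrableD sY sZ.
by rewrite ipDl// ipDr// ipDr// [ip Z Y]ipC; ring.
Qed.

Lemma ip_sqrZ k Y : sq_integrable Y ->
  ip (fun w => k * Y w) (fun w => k * Y w) = k ^+ 2 * ip Y Y.
Proof.
by move=> sY; rewrite ipZl ?ipZr//; [ring|exact: sq_integrableZ].
Qed.

Lemma ip_ge0 Y : 0 <= ip Y Y.
Proof. by apply: Rintegral_ge0 => w _; rewrite -expr2 sqr_ge0. Qed.

Lemma ip_cauchy_schwarz Y Z : sq_integrable Y -> sq_integrable Z ->
  ip Y Z ^+ 2 <= ip Y Y * ip Z Z.
Proof.
move=> sY sZ.
have quad t : 0 <= ip Y Y + 2 * t * ip Y Z + t ^+ 2 * ip Z Z.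
  have := ip_ge0 (fun w => Y w + t * Z w).
  have stZ := sq_integrableZ t sZ.
  by rewrite ip_sqrD// ip_sqrZ// ipZr// mulrA.
have := ip_ge0 Y; have := ip_ge0 Z.
move: (ip Y Y) (ip Z Z) (ip Y Z) quad => A C B quad.
rewrite le_eqVlt => /predU1P[C0|C0] A0.
- rewrite -C0 mulr0; rewrite -C0 in quad.
  have [->|B0] := eqVneq B 0; first by rewrite expr0n.
  have := quad (- (A + 1) / B); rewrite mulr0 addr0.
  have -> : 2 * (- (A + 1) / B) * B = - 2 * (A + 1) by field.
  lra.
- have := quad (- B / C).
  have -> : A + 2 * (- B / C) * B + (- B / C) ^+ 2 * C = A - B ^+ 2 / C.
    by field; rewrite gt_eqF.
  by rewrite subr_ge0 ler_pdivrMr.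
Qed.

Lemma cnormal_sq_integrable Y s : cnormal P Y s -> sq_integrable Y.
Proof. by move=> cY; have [mY _ _] := cY; have [_ _ iY _] := cnormal_facts cY. Qed.

Lemma cnormal_ip Y s : cnormal P Y s -> ip Y Y = s ^+ 2.
Proof.
move=> cY; have [_ _ _ EY] := cnormal_facts cY.
rewrite /ip /Rintegral; under eq_integral do rewrite -expr2.
by rewrite EY.
Qed.

Lemma cnormal_eq_law d' (T' : measurableType d') (P' : probability T' R)
    Y (Y' : T' -> R) s s' : cnormal P Y s -> cnormal P' Y' s' ->
  s ^+ 2 = s' ^+ 2 ->
  forall B, measurable B -> P (Y @^-1` B) = P' (Y' @^-1` B).
Proof.
move=> [_ s0 lY] [_ s0' lY'] ss B mB; rewrite lY// lY'//.
congr (cnormal_law _ _).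
by apply/eqP; rewrite -(@eqrXn2 _ 2)//; apply/eqP.
Qed.

End square_integrable.

Section gaussian_vector.
Context {R : realType} d (T : measurableType d) (P : probability T R) (n : nat).
Implicit Types (X : T -> n.-tuple R) (a b : 'I_n -> R).

(** Centered Gaussian vectors, in the Cramer-Wold form. *)
Definition gaussian_vector X :=
  forall a, exists s, cnormal P (fun w => lincomb a (X w)) s.

Lemma lincombD a b (x : n.-tuple R) :
  lincomb (fun i => a i + b i) x = lincomb a x + lincomb b x.
Proof. by rewrite /lincomb -big_split/=; apply: eq_bigr => i _; rewrite mulrDl. Qed.

Lemma lincombZ k a (x : n.-tuple R) :
  lincomb (fun i => k * a i) x = k * lincomb a x.
Proof. by rewrite /lincomb big_distrr/=; apply: eq_bigr => i _; rewrite mulrA. Qed.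

Definition coord_vec (i : 'I_n) : 'I_n -> R := fun j => (j == i)%:R.

Lemma lincomb_coord i (x : n.-tuple R) : lincomb (coord_vec i) x = tnth x i.
Proof.
rewrite /lincomb (bigD1 i)//= /coord_vec eqxx mul1r big1 ?addr0// => j /negPf ->.
by rewrite mul0r.
Qed.

Variable X : T -> n.-tuple R.
Hypothesis gX : gaussian_vector X.

Lemma gaussian_vector_coord i : exists s, cnormal P (fun w => tnth (X w) i) s.
Proof.
have [s] := gX (coord_vec i).
by under eq_fun do rewrite lincomb_coord; exists s.
Qed.

Lemma gaussian_vector_measurable : measurable_fun setT X.
Proof.
apply/measurable_fun_tnthP => i.
by have [s []] := gaussian_vector_coord i.
Qed.

Lemma coord_sq i : sq_integrable P (fun w => tnth (X w) i).
Proof. by have [s /cnormal_sq_integrable] := gaussian_vector_coord i. Qed.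

Definition cov i j := ip P (fun w => tnth (X w) i) (fun w => tnth (X w) j).

Definition var_lin a := ip P (fun w => lincomb a (X w)) (fun w => lincomb a (X w)).

Lemma ip_lincomb a j :
  ip P (fun w => lincomb a (X w)) (fun w => tnth (X w) j) = \sum_(i < n) a i * cov i j.
Proof.
rewrite /ip /lincomb.
transitivity (\int[P]_w \sum_(i < n) (a i * (tnth (X w) i * tnth (X w) j)))%R.
  by apply: eq_Rintegral => w _; rewrite mulr_suml; apply: eq_bigr => i _; rewrite mulrA.
have ii i : P.-integrable setT (fun w => (a i * (tnth (X w) i * tnth (X w) j))%:E).
  under eq_fun do rewrite EFinM.
  by apply: integrableZl => //; apply: ip_integrable; exact: coord_sq.
rewrite /Rintegral.
under eq_integral do rewrite -sumEFin.
rewrite integral_sum//= -[RHS]/(fine (\sum_(i < n) a i * cov i j)%:E) -sumEFin.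
congr fine; apply: eq_bigr => i _; under eq_integral do rewrite EFinM.
have iij : P.-integrable setT (fun w => (tnth (X w) i * tnth (X w) j)%:E).
  by apply: ip_integrable; exact: coord_sq.
rewrite integralZl// EFinM; congr (_ * _)%E.
by rewrite /cov /ip /Rintegral fineK//; exact: integrable_fin_num.
Qed.

Variable j : 'I_n.
Hypothesis sj : 0 < cov j j.

(** The vector X is recombined from its j-th coordinate and from the residual of
    the regression on it: X i = regr i * X j + residual i. *)
Definition regr i := cov i j / cov j j.

Definition residual w : n.-tuple R :=
  [tuple tnth (X w) i - regr i * tnth (X w) j | i < n].

Definition recombine (x : R) (v : n.-tuple R) : n.-tuple R :=
  [tuple regr i * x + tnth v i | i < n].

Lemma regr_self : regr j = 1.
Proof. by rewrite /regr divff// gt_eqF. Qed.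

Let slope a := \sum_(i < n) a i * regr i.

Lemma lincomb_residual a w :
  lincomb a (residual w) = lincomb (fun i => a i + - slope a * coord_vec j i) (X w).
Proof.
rewrite lincombD lincombZ lincomb_coord /lincomb /slope mulNr mulr_suml -sumrB.
by apply: eq_bigr => i _; rewrite tnth_mktuple mulrBr mulrA.
Qed.

Lemma residual_gaussian : gaussian_vector residual.
Proof.
move=> a; have [s cs] := gX (fun i => a i + - slope a * coord_vec j i).
by exists s; under eq_fun do rewrite lincomb_residual.
Qed.

Lemma residual_self w : tnth (residual w) j = 0.
Proof. by rewrite tnth_mktuple regr_self mul1r subrr. Qed.

Lemma lincomb_recombine a x v :
  lincomb a (recombine x v) = slope a * x + lincomb a v.
Proof.
rewrite /lincomb /slope mulr_suml -big_split/=; apply: eq_bigr => i _.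
by rewrite tnth_mktuple mulrDr mulrA.
Qed.

Lemma residual_orth a :
  ip P (fun w => lincomb a (residual w)) (fun w => tnth (X w) j) = 0.
Proof.
under [X in ip P X _]eq_fun do rewrite lincomb_residual.
rewrite ip_lincomb.
under eq_bigr do rewrite mulrDl -mulrA.
rewrite big_split/= -big_distrr/=.
have -> : \sum_(i < n) coord_vec j i * cov i j = cov j j.
  rewrite (bigD1 j)//= /coord_vec eqxx mul1r big1 ?addr0// => i /negPf ->.
  by rewrite mul0r.
rewrite /slope mulNr mulr_suml -sumrB big1// => i _.
by rewrite /regr -mulrA divfK ?subrr// gt_eqF.
Qed.

(** Pythagoras, since the residual is orthogonal to the j-th coordinate. *)
Lemma var_lin_split a :
  var_lin a = slope a ^+ 2 * cov j j +
    ip P (fun w => lincomb a (residual w)) (fun w => lincomb a (residual w)).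
Proof.
have sr : sq_integrable P (fun w => lincomb a (residual w)).
  by have [s /cnormal_sq_integrable] := residual_gaussian a.
have sx := coord_sq j; have ssx := sq_integrableZ (slope a) sx.
have -> : var_lin a = ip P (fun w => slope a * tnth (X w) j + lincomb a (residual w))
                           (fun w => slope a * tnth (X w) j + lincomb a (residual w)).
  congr ip; apply/funext => w;
  by rewrite lincomb_residual lincombD lincombZ lincomb_coord mulNr addrC addrNK.
rewrite ip_sqrD// ip_sqrZ// ipZl// [ip P _ (fun w => lincomb a (residual w))]ipC.
by rewrite residual_orth !mulr0 addr0.
Qed.

Lemma measurable_recombine :
  measurable_fun setT (fun z : T * T => recombine (tnth (X z.1) j) (residual z.2)).
Proof.
apply/measurable_fun_tnthP => i.
have mr := (@residual_gaussian).
have [s [mXj _ _]] := gaussian_vector_coord j.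
have [s' [mXi _ _]] := gaussian_vector_coord i.
have -> : tnth (T:=R) ^~ i \o (fun z : T * T => recombine (tnth (X z.1) j) (residual z.2)) =
  (fun z => regr i * tnth (X z.1) j + (tnth (X z.2) i - regr i * tnth (X z.2) j)).
  by apply/funext => z /=; rewrite !tnth_mktuple.
apply: measurable_funD.
  by apply: measurable_funM => //; exact: (measurableT_comp mXj measurable_fst).
apply: measurable_funB; first exact: (measurableT_comp mXi measurable_snd).
by apply: measurable_funM => //; exact: (measurableT_comp mXj measurable_snd).
Qed.

(** The residual is uncorrelated with the j-th coordinate, hence independent of
    it: X has the law of the recombination of two independent copies. *)
Theorem gaussian_split (S : set (n.-tuple R)) : measurable S ->
  P (X @^-1` S) = (P \x P)%E
    ((fun z : T * T => recombine (tnth (X z.1) j) (residual z.2)) @^-1` S).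
Proof.
apply: (@cramer_wold R _ _ _ _ P (P \x P)%E).
- exact: gaussian_vector_measurable.
- exact: measurable_recombine.
move=> a.
have [s cs] := gX a.
have [s1 c1] := gX (fun i => slope a * coord_vec j i).
have [s2 c2] := residual_gaussian a.
have c12 := cnormal_indep_sum c1 c2.
have E z : lincomb (fun i => slope a * coord_vec j i) (X z.1) + lincomb a (residual z.2) =
    lincomb a (recombine (tnth (X z.1) j) (residual z.2)).
  by rewrite lincombZ lincomb_coord lincomb_recombine.
have {}c12 : cnormal (P \x P)%E (fun z : T * T =>
    lincomb a (recombine (tnth (X z.1) j) (residual z.2))) (Num.sqrt (s1 ^+ 2 + s2 ^+ 2)).
  by move: c12; congr cnormal; apply/funext => z; exact: E.
move=> B; apply: (cnormal_eq_law cs c12).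
rewrite sqr_sqrtr ?addr_ge0 ?sqr_ge0//.
rewrite -(cnormal_ip cs) -(cnormal_ip c1) -(cnormal_ip c2).
rewrite -/(var_lin a) var_lin_split; congr (_ + _).
have -> : (fun w => lincomb (fun i => slope a * coord_vec j i) (X w)) =
    (fun w => slope a * tnth (X w) j).
  by apply/funext => w; rewrite lincombZ lincomb_coord.
have sx := coord_sq j; have ssx := sq_integrableZ (slope a) sx.
by rewrite ip_sqrZ.
Qed.

Theorem gaussian_split_integral (F : n.-tuple R -> \bar R) :
  measurable_fun setT F -> (forall x, (0 <= F x)%E) ->
  (\int[P]_w F (X w) =
   \int[P]_w \int[P]_v F (recombine (tnth (X w) j) (residual v)))%E.
Proof.
move=> mF F0.
pose X1 : {RV P >-> n.-tuple R} :=
  HB.pack X (isMeasurableFun.Build _ _ _ _ _ gaussian_vector_measurable).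
pose X2 : {RV (P \x P)%E >-> n.-tuple R} :=
  HB.pack (fun z : T * T => recombine (tnth (X z.1) j) (residual z.2))
    (isMeasurableFun.Build _ _ _ _ _ measurable_recombine).
rewrite -[LHS](ge0_integral_distribution X1 mF F0).
transitivity (\int[distribution (P \x P)%E X2]_x F x)%E.
  by apply: eq_measure_integral => A mA _; exact: gaussian_split.
rewrite (ge0_integral_distribution X2 mF F0) fubini_tonelli1//.
exact: (measurableT_comp mF measurable_recombine).
by move=> z; exact: F0.
Qed.

End gaussian_vector.

(** * The Prekopa-Leindler inequality *)

Section brunn_minkowski_line.
Context {R : realType}.
Local Notation mu := (@lebesgue_measure R).
Variable s : R.
Hypothesis s01 : 0 < s < 1.

Let s0 : 0 < s. Proof. by case/andP: s01. Qed.
Let s1 : 0 < 1 - s. Proof. by rewrite subr_gt0; case/andP: s01. Qed.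

Lemma lebesgue_measure_affine (k c : R) (K : set R) : 0 < k -> measurable K ->
  mu [set z | K (k^-1 * (z - c))] = (k%:E * mu K)%E.
Proof.
move=> k0 mK.
have ki0 : 0 < k^-1 by rewrite invr_gt0.
have mK' : measurable ((fun x : R => k^-1 * x) @^-1` K).
  by rewrite -[X in measurable X]setTI; apply: (measurable_funM) => //.
have := @lebesgue_measure_scale R _ _ ki0 mK; rewrite invrK => <-.
by rewrite /pushforward -[RHS](lebesgue_measure_shift (- c) mK').
Qed.

(** The translate of s K whose largest point is p and the translate of (1 - s) L
    whose smallest point is p both lie in H and meet only in p. *)
Lemma compact_brunn_minkowski (K L H : set R) : compact K -> compact L ->
  K !=set0 -> L !=set0 -> measurable H ->
  (forall x y, K x -> L y -> H (s * x + (1 - s) * y)) ->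
  (s%:E * mu K + (1 - s)%:E * mu L <= mu H)%E.
Proof.
move=> cK cL K0 L0 mH KLH.
have mK := compact_measurable cK; have mL := compact_measurable cL.
have cid (C : set R) : {within C, continuous (id : R -> R)}.
  exact: continuous_subspaceT (fun x => cvg_id).
have [M /set_mem KM Mub] := compact_EVT_max K0 cK (cid K).
have [m /set_mem Lm mlb] := compact_EVT_min L0 cL (cid L).
pose p := s * M + (1 - s) * m.
pose A := [set z | K (s^-1 * (z - (1 - s) * m))].
pose B := [set z | L ((1 - s)^-1 * (z - s * M))].
have maff (k c : R) : measurable_fun setT (fun z : R => k * (z - c)).
  by apply: measurable_funM => //; exact: measurable_funB.
have mA : measurable A.
  by have := maff s^-1 ((1 - s) * m) measurableT K mK; rewrite setTI.
have mB : measurable B.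
  by have := maff (1 - s)^-1 (s * M) measurableT L mL; rewrite setTI.
have AE : mu A = (s%:E * mu K)%E by exact: lebesgue_measure_affine.
have BE : mu B = ((1 - s)%:E * mu L)%E by exact: lebesgue_measure_affine.
rewrite -AE -BE.
have Ap z : A z -> z <= p.
  by move=> /mem_set/Mub; rewrite ler_pdivrMl// lerBlDr /p.
have Bp z : B z -> p <= z.
  by move=> /mem_set/mlb; rewrite ler_pdivlMl// lerBrDl /p.
have AH : A `<=` H.
  move=> z Az; have := KLH _ _ Az Lm.
  by rewrite mulrA divff ?gt_eqF// mul1r subrK.
have BH : B `<=` H.
  move=> z Bz; have := KLH _ _ KM Bz.
  by rewrite mulrA divff ?gt_eqF// mul1r addrC subrK.
apply: (@le_trans _ _ (mu (A `\` [set p]) + mu B)%E).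
  rewrite leeD2r//; apply: (@le_trans _ _ (mu (A `\` [set p]) + mu [set p])%E).
    apply: (@le_trans _ _ (mu ((A `\` [set p]) `|` [set p]))).
      apply: le_measure; rewrite ?inE//.
        by apply: measurableU => //; exact: measurableD.
      by move=> z Az; have [->|zp] := pselect (z = p); [right|left].
    by apply: measureU2 => //; exact: measurableD.
  by rewrite lebesgue_measure_set1 adde0.
rewrite -measureU//; last 2 first.
- exact: measurableD.
- apply/seteqP; split=> // z [[Az zp] Bz]; apply: zp.
  by apply/eqP; rewrite eq_le Ap// Bp.
apply: le_measure; rewrite ?inE//.
  by apply: measurableU => //; exact: measurableD.
by move=> z [[/AH]|/BH].
Qed.

(** Inner regularity extends the inequality from compact sets. *)
Lemma brunn_minkowski (A B H : set R) : measurable A -> measurable B ->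
  A !=set0 -> B !=set0 -> measurable H ->
  (forall x y, A x -> B y -> H (s * x + (1 - s) * y)) ->
  (s%:E * mu A + (1 - s)%:E * mu B <= mu H)%E.
Proof.
move=> mA mB [a Aa] [b Bb] mH ABH.
have [->|Hfin] := eqVneq (mu H) +oo%E; first by rewrite leey.
have Hr : mu H \is a fin_num by rewrite ge0_fin_numE// lt_neqAle Hfin leey.
have key K L : compact K -> K `<=` A -> compact L -> L `<=` B ->
    (s%:E * mu K + (1 - s)%:E * mu L <= mu H)%E.
  move=> cK KA cL LB.
  have cK' : compact (K `|` [set a]) by apply: compactU => //; exact: compact_set1.
  have cL' : compact (L `|` [set b]) by apply: compactU => //; exact: compact_set1.
  apply: (@le_trans _ _ (s%:E * mu (K `|` [set a]) + (1 - s)%:E * mu (L `|` [set b]))%E).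
    have s0' := ltW s0; have s1' := ltW s1.
    apply: leeD; apply: lee_wpmul2l; rewrite ?lee_fin//.
    - apply: le_measure; rewrite ?inE; [exact: compact_measurable..|].
      by move=> z; left.
    - apply: le_measure; rewrite ?inE; [exact: compact_measurable..|].
      by move=> z; left.
  have KA' z : (K `|` [set a]) z -> A z by case=> [/KA|->].
  have LB' z : (L `|` [set b]) z -> B z by case=> [/LB|->].
  apply: compact_brunn_minkowski => //.
  - by exists a; right.
  - by exists b; right.
  - by move=> x y /KA' Ax /LB' By; exact: ABH.
have fK K : compact K -> mu K \is a fin_num.
  by move=> cK; rewrite ge0_fin_numE//; exact: compact_finite_measure.
have step L : compact L -> L `<=` B ->
    (mu A <= s^-1%:E * (mu H - (1 - s)%:E * mu L))%E.
  move=> cL LB; rewrite (lebesgue_regularity_inner_sup mA).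
  apply: ge_ereal_sup => _ [K [cK KA] <-].
  rewrite lee_pdivlMl// leeBrDr//; last by rewrite fin_numM// fK.
  exact: key.
have Afin : mu A \is a fin_num.
  rewrite ge0_fin_numE//.
  apply: le_lt_trans (step set0 (@compact0 _) (@sub0set _ _)) _.
  by rewrite measure0 mule0 sube0 ltey_eq fin_numM.
have {}step : (mu B <= (1 - s)^-1%:E * (mu H - s%:E * mu A))%E.
  rewrite (lebesgue_regularity_inner_sup mB).
  apply: ge_ereal_sup => _ [L [cL LB] <-].
  have := step L cL LB.
  rewrite lee_pdivlMl// leeBrDr; last by rewrite fin_numM// fK.
  by rewrite lee_pdivlMl// leeBrDr ?fin_numM// addeC.
by rewrite addeC -leeBrDr ?fin_numM// -lee_pdivlMl.
Qed.

End brunn_minkowski_line.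

Section layer_cake.
Context {R : realType}.
Local Notation mu := (@lebesgue_measure R).

Let S (f : R -> R) : set (measurableTypeR R * measurableTypeR R) :=
  [set z | 0 < (z.2 : R) < f z.1].

Let measurable_S f : measurable_fun setT f -> measurable (S f).
Proof.
move=> mf; have mb : measurable_fun setT (fun z : measurableTypeR R * measurableTypeR R =>
    (0 < (z.2 : R)) && ((z.2 : R) < f z.1)).
  apply: measurable_and; apply: measurable_fun_ltr => //.
  exact: (measurableT_comp mf measurable_fst).
by have := mb measurableT [set true] I; rewrite setTI.
Qed.

Lemma measurable_level (f : R -> R) (t : R) : measurable_fun setT f ->
  measurable [set x | 0 < t < f x].
Proof.
move=> mf; have mb : measurable_fun setT (fun x : R => (0 < t) && (t < f x)).
  by apply: measurable_and; apply: measurable_fun_ltr.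
by have := mb measurableT [set true] I; rewrite setTI.
Qed.

Let G f z : \bar R := (\1_(S f) z)%:E.

Let measurable_G f : measurable_fun setT f -> measurable_fun setT (G f).
Proof. move=> mf; rewrite /G; apply/measurable_EFinP; apply: measurable_indic.
exact: measurable_S. Qed.

Let G_ge0 f z : (0 <= G f z)%E. Proof. by rewrite lee_fin. Qed.

Let integral_G f t : measurable_fun setT f ->
  (\int[mu]_x G f (x, t) = mu [set x | (0 < t < f x)%R])%E.
Proof.
move=> mf; transitivity (\int[mu]_x (\1_[set x | (0 < t < f x)%R] x)%:E)%E.
  by apply: eq_integral => x _; rewrite /G !indicE; congr (_%:R%:E); congr nat_of_bool.
by rewrite integral_indic ?setIT//; exact: measurable_level.
Qed.

Lemma measurable_level_measure (f : R -> R) : measurable_fun setT f ->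
  measurable_fun setT (fun t : R => mu [set x | 0 < t < f x]).
Proof.
move=> mf.
have := @measurable_fun_fubini_tonelli_G _ _ _ _ R mu (G f) (measurable_G mf) (@G_ge0 f).
by apply: eq_measurable_fun => t _; rewrite /fubini_G integral_G.
Qed.

(** Fubini for the region between the axis and the graph of f. *)
Lemma layer_cake (f : R -> R) : measurable_fun setT f -> (forall x, 0 <= f x) ->
  (\int[mu]_x (f x)%:E = \int[mu]_t mu [set x | (0 < t < f x)%R])%E.
Proof.
move=> mf f0.
transitivity (\int[mu]_x \int[mu]_t G f (x, t))%E.
  apply: eq_integral => x _.
  transitivity (\int[mu]_t (\1_(`]0, f x[%classic : set R) t)%:E)%E; last first.
    by apply: eq_integral => t _; rewrite /G !indicE; congr (_%:R%:E); congr nat_of_bool.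
  rewrite integral_indic// setIT; apply/esym/(etrans (@lebesgue_measure_itv R `]0, f x[)).
  rewrite /= lte_fin.
  by case: ifPn => [_|]; rewrite ?sube0// -leNgt => h; congr EFin; apply/eqP; rewrite eq_le h f0.
rewrite (fubini_tonelli (m1 := mu) (m2 := mu))//; last exact: measurable_G.
by apply: eq_integral => t _; rewrite integral_G.
Qed.

End layer_cake.

Section prekopa_leindler.
Context {R : realType}.
Local Notation mu := (@lebesgue_measure R).
Variable s : R.
Hypothesis s01 : 0 < s < 1.

Let s0 : 0 < s. Proof. by case/andP: s01. Qed.
Let s1 : 0 < 1 - s. Proof. by rewrite subr_gt0; case/andP: s01. Qed.
Let s0' : (0 <= s%:E)%E. Proof. by rewrite lee_fin ltW. Qed.
Let s1' : (0 <= (1 - s)%:E)%E. Proof. by rewrite lee_fin ltW. Qed.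

Lemma weighted_amgm (p q : R) : 0 <= p -> 0 <= q ->
  p `^ s * q `^ (1 - s) <= s * p + (1 - s) * q.
Proof.
move=> p0 q0.
have si0 : 0 < s^-1 by rewrite invr_gt0.
have ti0 : 0 < (1 - s)^-1 by rewrite invr_gt0.
have := @conjugate_powR R (p `^ s) (q `^ (1 - s)) _ _ (powR_ge0 _ _) (powR_ge0 _ _) si0 ti0.
rewrite !invrK addrC subrK => /(_ erefl).
by rewrite -!powRrM !divff ?gt_eqF// !powRr1// [p * s]mulrC [q * _]mulrC.
Qed.

(** Normalizing both suprema to 1 makes the level sets of u and v non-empty
    for exactly the same levels, so that Brunn-Minkowski applies to all of them. *)
Lemma prekopa_leindler_normalized (u v h : R -> R) :
  measurable_fun setT u -> measurable_fun setT v -> measurable_fun setT h ->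
  (forall x, 0 <= u x <= 1) -> (forall x, 0 <= v x <= 1) -> (forall x, 0 <= h x) ->
  (forall t, t < 1 -> exists x, t < u x) -> (forall t, t < 1 -> exists x, t < v x) ->
  (forall x y, u x `^ s * v y `^ (1 - s) <= h (s * x + (1 - s) * y)) ->
  (s%:E * \int[mu]_x (u x)%:E + (1 - s)%:E * \int[mu]_x (v x)%:E <=
   \int[mu]_x (h x)%:E)%E.
Proof.
move=> mu_ mv mh u01 v01 h0 supu supv uvh.
have u0 x : 0 <= u x by case/andP: (u01 x).
have v0 x : 0 <= v x by case/andP: (v01 x).
rewrite !layer_cake// -!ge0_integralZl//; [|exact: measurable_level_measure..].
rewrite -ge0_integralD//=; last 4 first.
- by move=> t _; apply: mule_ge0.
- by apply: emeasurable_funM => //; exact: measurable_level_measure.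
- by move=> t _; apply: mule_ge0.
- by apply: emeasurable_funM => //; exact: measurable_level_measure.
apply: ge0_le_integral => //=.
- by move=> t _; apply: adde_ge0; apply: mule_ge0.
- by apply: emeasurable_funD; apply: emeasurable_funM => //; exact: measurable_level_measure.
- exact: measurable_level_measure.
move=> t _.
have [/andP[t0 t1]|tN] := boolP (0 < t < 1); last first.
  have empty (f : R -> R) : (forall x, 0 <= f x <= 1) -> [set x | 0 < t < f x] = set0.
    move=> f01; apply/seteqP; split => // x /= /andP[t0 tf]; move: tN; rewrite t0/=.
    by rewrite (lt_le_trans tf)//; case/andP: (f01 x).
  have mu0 : mu set0 = 0%E by exact: measure0.
  by rewrite (empty u u01) (empty v v01) !mu0 !mule0 adde0 measure_ge0.
apply: brunn_minkowski => //; try exact: measurable_level.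
- by have [x ux] := supu t t1; exists x; rewrite /= t0.
- by have [x vx] := supv t t1; exists x; rewrite /= t0.
move=> x y /= /andP[_ ux] /andP[_ vy]; rewrite t0/=.
apply: lt_le_trans (uvh x y).
have -> : t = t `^ s * t `^ (1 - s).
  rewrite -powRD; last by rewrite (gt_eqF t0) implybT.
  by rewrite [s + _]addrC subrK powRr1// ltW.
have tn : t \is Num.nneg by rewrite nnegrE ltW.
have un : u x \is Num.nneg by rewrite nnegrE.
have vn : v y \is Num.nneg by rewrite nnegrE.
by apply: ltr_pM; rewrite ?powR_ge0//; exact: gt0_ltr_powR.
Qed.

Lemma powR_mulV (a r : R) : 0 < a -> a `^ r * a^-1 `^ r = 1.
Proof.
move=> a0; have a0' := ltW a0; rewrite -powRM ?invr_ge0//.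
by rewrite divff ?gt_eqF// powR1.
Qed.

(** After division by the suprema, the arithmetic mean of the two integrals
    dominates their geometric mean.  The integrals are only bounded below, by p
    and q, so that the statement makes sense when they are infinite. *)
Theorem prekopa_leindler (u v h : R -> R) (M : R) :
  measurable_fun setT u -> measurable_fun setT v -> measurable_fun setT h ->
  (forall x, 0 <= u x <= M) -> (forall x, 0 <= v x <= M) -> (forall x, 0 <= h x) ->
  (forall x y, u x `^ s * v y `^ (1 - s) <= h (s * x + (1 - s) * y)) ->
  forall p q : R, 0 <= p -> 0 <= q ->
  (p%:E <= \int[mu]_x (u x)%:E)%E -> (q%:E <= \int[mu]_x (v x)%:E)%E ->
  ((p `^ s * q `^ (1 - s))%:E <= \int[mu]_x (h x)%:E)%E.
Proof.
move=> mu_ mv mh u01 v01 h0 uvh p q p0 q0 pu qv.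
have hint0 : (0 <= \int[mu]_x (h x)%:E)%E by apply: integral_ge0 => x _; rewrite lee_fin.
have bsup (f : R -> R) : (forall x, 0 <= f x <= M) -> has_sup (range f).
  move=> f01; split; first by exists (f 0), 0.
  by exists M => _ [x _ <-]; case/andP: (f01 x).
have supge (f : R -> R) x : (forall x, 0 <= f x <= M) -> f x <= sup (range f).
  by move=> f01; apply: ub_le_sup; [exact: (bsup f f01).2|exists x].
have sup0 (f : R -> R) : (forall x, 0 <= f x <= M) -> 0 <= sup (range f).
  by move=> f01; apply: le_trans (supge f 0 f01); case/andP: (f01 0).
have int0 (f : R -> R) (r : R) : (forall x, 0 <= f x <= M) -> sup (range f) = 0 ->
    0 <= r -> (r%:E <= \int[mu]_x (f x)%:E)%E -> r = 0.
  move=> f01 fs r0; rewrite integral0_eq.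
    by rewrite lee_fin => r0'; apply/eqP; rewrite eq_le r0 r0'.
  move=> x _; congr EFin; apply/eqP; rewrite eq_le -{1}fs supge//=.
  by case/andP: (f01 x).
set A := sup (range u); set B := sup (range v).
have [A0|A0] := eqVneq A 0.
  by rewrite (int0 u p u01 A0 p0 pu) powR0 ?mul0r// gt_eqF.
have [B0|B0] := eqVneq B 0.
  by rewrite (int0 v q v01 B0 q0 qv) [X in _ * X]powR0 ?mulr0// gt_eqF.
have {}A0 : 0 < A by rewrite lt_neqAle eq_sym A0 sup0.
have {}B0 : 0 < B by rewrite lt_neqAle eq_sym B0 sup0.
set H := A `^ s * B `^ (1 - s).
have H0 : 0 < H by rewrite mulr_gt0// powR_gt0.
have norm01 (f : R -> R) x : (forall x, 0 <= f x <= M) -> 0 < sup (range f) ->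
    0 <= (sup (range f))^-1 * f x <= 1.
  move=> f01 f0; have /andP[fx0 _] := f01 x.
  apply/andP; split; first by rewrite mulr_ge0// invr_ge0 ltW.
  by rewrite mulrC ler_pdivrMr// mul1r supge.
have normsup (f : R -> R) t : (forall x, 0 <= f x <= M) -> 0 < sup (range f) -> t < 1 ->
    exists x, t < (sup (range f))^-1 * f x.
  move=> f01 f0 t1; set F := sup (range f) in f0 *.
  have e0 : 0 < (1 - t) * F by rewrite mulr_gt0// subr_gt0.
  have [_ [x _ <-]] := sup_adherent e0 (bsup f f01).
  rewrite -/F => Fx; exists x; rewrite ltr_pdivlMl//; apply: le_lt_trans Fx.
  by rewrite le_eqVlt; apply/orP; left; apply/eqP; ring.
have := @prekopa_leindler_normalized (fun x => A^-1 * u x) (fun x => B^-1 * v x) (fun x => H^-1 * h x).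
have intZ (k : R) (f : R -> R) : 0 <= k -> measurable_fun setT f -> (forall x, 0 <= f x) ->
    (\int[mu]_x (k * f x)%:E = k%:E * \int[mu]_x (f x)%:E)%E.
  move=> k0 mf f0; under eq_integral do rewrite EFinM.
  rewrite ge0_integralZl//=.
  - exact/measurable_EFinP.
  - by move=> x _; rewrite lee_fin.
have u0 x : 0 <= u x by case/andP: (u01 x).
have v0 x : 0 <= v x by case/andP: (v01 x).
have Ai : 0 <= A^-1 by rewrite invr_ge0 ltW.
have Bi : 0 <= B^-1 by rewrite invr_ge0 ltW.
have Hi : 0 <= H^-1 by rewrite invr_ge0 ltW.
rewrite !intZ// => PL.
rewrite [leRHS](_ : _ = H%:E * (H^-1%:E * \int[mu]_x (h x)%:E))%E; last first.
  by rewrite muleA -EFinM divff ?gt_eqF// mul1e.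
apply: (@le_trans _ _ (H%:E * (s%:E * (A^-1%:E * p%:E) + (1 - s)%:E * (B^-1%:E * q%:E)))%E).
  rewrite [leRHS](_ : _ = (H * (s * (A^-1 * p) + (1 - s) * (B^-1 * q)))%:E)// lee_fin.
  apply: (@le_trans _ _ (H * ((A^-1 * p) `^ s * (B^-1 * q) `^ (1 - s)))).
    rewrite !powRM// /H le_eqVlt; apply/orP; left; apply/eqP.
    have hA : A `^ s * A^-1 `^ s = 1 by exact: powR_mulV.
    have hB : B `^ (1 - s) * B^-1 `^ (1 - s) = 1 by exact: powR_mulV.
    transitivity ((A `^ s * A^-1 `^ s) * (B `^ (1 - s) * B^-1 `^ (1 - s)) * (p `^ s * q `^ (1 - s))).
      by rewrite hA hB !mul1r.
    ring.
  by rewrite ler_pM2l//; apply: weighted_amgm; rewrite mulr_ge0.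
have H0' := ltW H0.
apply: lee_wpmul2l; rewrite ?lee_fin//.
apply: le_trans (PL _ _ _ _ _ _ _ _ _).
- by apply: leeD; apply: lee_wpmul2l => //; apply: lee_wpmul2l; rewrite ?lee_fin.
- exact: measurable_funM.
- exact: measurable_funM.
- exact: measurable_funM.
- by move=> x; exact: norm01.
- by move=> x; exact: norm01.
- by move=> x; rewrite mulr_ge0.
- by move=> t; exact: normsup.
- by move=> t; exact: normsup.
- move=> x y; rewrite !powRM//.
  rewrite [leLHS](_ : _ = H^-1 * (u x `^ s * v y `^ (1 - s))); first exact: ler_wpM2l.
  have hA : (A `^ s)^-1 = A^-1 `^ s.
    by apply: mulr1_eq; exact: powR_mulV.
  have hB : (B `^ (1 - s))^-1 = B^-1 `^ (1 - s).
    by apply: mulr1_eq; exact: powR_mulV.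
  by rewrite /H invfM hA hB; ring.
Qed.

End prekopa_leindler.

Section prekopa_leindler_gauss.
Context {R : realType}.
Local Notation mu := (@lebesgue_measure R).

Lemma normal_pdf_le_peak (m s x : R) : s != 0 -> normal_pdf m s x <= normal_peak s.
Proof.
move=> s0; rewrite normal_pdf_expE// ler_piMr ?normal_peak_ge0//.
by rewrite -expR0 ler_expR mulNr oppr_le0 divr_ge0 ?mulrn_wge0 ?sqr_ge0.
Qed.

(** Multiplying by the normal density turns the defect of concavity of the
    Gaussian potential into the factor expR (s (1 - s) (x - y) ^+ 2 / 2 sg ^+ 2). *)
Lemma prekopa_leindler_normal (s sg : R) (f g : R -> R) (M K : R) :
  0 < s < 1 -> 0 < sg -> 0 <= K ->
  measurable_fun setT f -> measurable_fun setT g ->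
  (forall x, 0 <= f x <= M) -> (forall x, 0 <= g x <= M) ->
  (forall x y, f x `^ s * g y `^ (1 - s) <=
     K * expR (s * (1 - s) * ((x - y) ^+ 2 / sg ^+ 2) / 2)) ->
  forall p q : R, 0 <= p -> 0 <= q ->
  (p%:E <= \int[normal_prob 0 sg]_x (f x)%:E)%E ->
  (q%:E <= \int[normal_prob 0 sg]_x (g x)%:E)%E ->
  p `^ s * q `^ (1 - s) <= K.
Proof.
move=> s01 sg0 K0 mf mg fM gM fg p q p0 q0.
have sgN : sg != 0 by rewrite gt_eqF.
have f0 x : 0 <= f x by case/andP: (fM x).
have g0 x : 0 <= g x by case/andP: (gM x).
have pdf0 x : 0 <= normal_pdf 0 sg x :> R by exact: normal_pdf_ge0.
have M0 : 0 <= M by have /andP[_] := fM 0; apply: le_trans.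
have mpdf : measurable_fun setT (normal_pdf 0 sg) by exact: measurable_normal_pdf.
have bnd (h : R -> R) : (forall x, 0 <= h x <= M) -> forall x,
    0 <= h x * normal_pdf 0 sg x <= M * normal_peak sg.
  move=> hM x; have /andP[h0 h1] := hM x.
  by rewrite mulr_ge0//= ler_pM// normal_pdf_le_peak.
have toint (h : R -> R) : measurable_fun setT h -> (forall x, 0 <= h x) ->
    (\int[normal_prob 0 sg]_x (h x)%:E = \int[mu]_x (h x * normal_pdf 0 sg x)%:E)%E.
  move=> mh h0; rewrite ge0_integral_normal//; first exact/measurable_EFinP.
have KE : (\int[mu]_x (K * normal_pdf 0 sg x)%:E = K%:E)%E.
  have := toint (cst K) (@measurable_cst _ _ _ _ setT K) (fun=> K0); rewrite /= => <-.
  rewrite -[LHS]/(\int[normal_prob 0 sg]_x (cst K%:E x))%E integral_cst//=.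
  by rewrite probability_setT mule1.
rewrite !toint// => pf qg; rewrite -lee_fin -KE.
apply: (@prekopa_leindler R s s01 (fun x => f x * normal_pdf 0 sg x)
  (fun x => g x * normal_pdf 0 sg x) _ (M * normal_peak sg)) => //.
- exact: measurable_funM.
- exact: measurable_funM.
- exact: measurable_funM.
- exact: bnd.
- exact: bnd.
- by move=> x; rewrite mulr_ge0.
move=> x y; rewrite !powRM// !normal_pdf_expE// !subr0.
have pk0 := normal_peak_ge0 sg.
rewrite !powRM ?expR_ge0// -!expRM.
have pkE : normal_peak sg `^ s * normal_peak sg `^ (1 - s) = normal_peak sg.
  rewrite -powRD; first by rewrite [s + _]addrC subrK powRr1.
  by rewrite [s + _]addrC subrK oner_eq0.
set k := normal_peak sg in pk0 pkE *.
rewrite [leLHS](_ : _ = (f x `^ s * g y `^ (1 - s)) * k *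
  expR (- (s * x ^+ 2 + (1 - s) * y ^+ 2) / (sg ^+ 2 *+ 2))); last first.
  rewrite -[in RHS]pkE.
  rewrite (_ : - (s * x ^+ 2 + (1 - s) * y ^+ 2) / (sg ^+ 2 *+ 2) =
    - x ^+ 2 / (sg ^+ 2 *+ 2) * s + - y ^+ 2 / (sg ^+ 2 *+ 2) * (1 - s)); last first.
    by have := sqrf_eq0 sg; rewrite (negPf sgN); move: (sg ^+ 2) => v /negbT v0; field.
  by rewrite expRD; ring.
rewrite [leRHS](_ : _ = K * expR (s * (1 - s) * ((x - y) ^+ 2 / sg ^+ 2) / 2) * k *
  expR (- (s * x ^+ 2 + (1 - s) * y ^+ 2) / (sg ^+ 2 *+ 2))).
  by rewrite ler_wpM2r ?expR_ge0// ler_wpM2r.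
rewrite -!mulrA [expR _ * (k * _)]mulrCA -expRD; congr (K * (k * expR _)).
by have := sqrf_eq0 sg; rewrite (negPf sgN); move: (sg ^+ 2) => v /negbT v0; field.
Qed.

End prekopa_leindler_gauss.

(** * Concentration of Gaussian maxima *)

Section prekopa_leindler_gaussian_vector.
Context {R : realType}.
Variable s : R.
Hypothesis s01 : 0 < s < 1.

(** Prekopa-Leindler for a Gaussian vector, with the quadratic form of the
    potential replaced by its Legendre dual, which makes sense for a degenerate
    covariance.  The induction conditions on one non-degenerate coordinate. *)
Theorem prekopa_leindler_gaussian d (T : measurableType d) (P : probability T R)
    (n : nat) (X : T -> n.-tuple R) (F G : n.-tuple R -> R) (M K : R) :
  gaussian_vector P X -> 0 <= K ->
  measurable_fun setT F -> measurable_fun setT G ->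
  (forall x, 0 <= F x <= M) -> (forall x, 0 <= G x <= M) ->
  (forall x y c, (forall a, 2 * (lincomb a x - lincomb a y) - var_lin P X a <= c) ->
     F x `^ s * G y `^ (1 - s) <= K * expR (s * (1 - s) * c / 2)) ->
  forall p q : R, 0 <= p -> 0 <= q ->
  (p%:E <= \int[P]_w (F (X w))%:E)%E -> (q%:E <= \int[P]_w (G (X w))%:E)%E ->
  p `^ s * q `^ (1 - s) <= K.
Proof.
have [m] := ubnP #|[set i | cov P X i i != 0]|%SET.
elim: m => // m IH in X F G K * => /ltnSE cardm gX K0 mF mG FM GM FG p q p0 q0.
have F0 x : 0 <= F x by case/andP: (FM x).
have G0 x : 0 <= G x by case/andP: (GM x).
have [/existsP[j covj]|/existsPn cov0] := boolP [exists j, cov P X j j != 0]; last first.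
  have X0 : {ae P, forall w, X w = [tuple 0 | i < n]}.
    have : {ae P, forall w, forall i, tnth (X w) i = 0}.
      apply: filter_forall => i.
      have [t ct] := gaussian_vector_coord gX i.
      have := cov0 i; rewrite negbK /cov (cnormal_ip ct) sqrf_eq0 => /eqP t0.
      by rewrite t0 in ct; exact: cnormal0_ae ct.
    by apply: filterS => w Xw; apply: eq_from_tnth => i; rewrite tnth_mktuple Xw.
  have intE (H : n.-tuple R -> R) : measurable_fun setT H -> (forall x, 0 <= H x) ->
      (\int[P]_w (H (X w))%:E = (H [tuple 0 | i < n])%:E)%E.
    move=> mH H0; transitivity (\int[P]_w (cst (H [tuple 0 | i < n])%:E w))%E; last first.
      by rewrite integral_cst//= probability_setT mule1.
    apply: ae_eq_integral => //.
    - by apply/measurable_EFinP; apply: measurableT_comp => //; exact: gaussian_vector_measurable.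
    - by apply: filterS X0 => w -> _.
  rewrite !intE// !lee_fin => pF qG.
  have s0 : 0 <= s by case/andP: s01 => /ltW.
  have s1 : 0 <= 1 - s by rewrite subr_ge0 ltW//; case/andP: s01.
  apply: le_trans (_ : F [tuple 0 | i < n] `^ s * G [tuple 0 | i < n] `^ (1 - s) <= _).
    by apply: ler_pM; rewrite ?powR_ge0//; apply: ge0_ler_powR; rewrite ?nnegrE.
  have := FG [tuple 0 | i < n] [tuple 0 | i < n] 0.
  rewrite mulr0 mul0r expR0 mulr1; apply => a.
  by rewrite subrr mulr0 sub0r oppr_le0; exact: ip_ge0.
have sj : 0 < cov P X j j by rewrite lt_neqAle eq_sym covj; exact: ip_ge0.
have [sg csg] := gaussian_vector_coord gX j.
have covE : cov P X j j = sg ^+ 2 by rewrite /cov (cnormal_ip csg).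
have sg0 : 0 < sg.
  case: csg => _ sg_ge0 _; rewrite lt_neqAle eq_sym sg_ge0 andbT.
  by apply: contraNneq covj => sg0; rewrite covE sg0 expr0n.
have gV := residual_gaussian gX j.
pose slope a := \sum_(i < n) a i * regr P X j i.
have cardV : (#|[set i | cov P (residual P X j) i i != 0%R]%SET| < m)%N.
  apply: leq_trans cardm; apply: proper_card; apply/fintype.properP; split.
    apply/fintype.subsetP => i; rewrite !inE; apply: contraNN => /eqP Xi0.
    have := var_lin_split gX sj (coord_vec i); rewrite /var_lin.
    have E (Y : T -> n.-tuple R) : (fun w => lincomb (coord_vec i) (Y w)) = (fun w => tnth (Y w) i).
      by apply/funext => w; rewrite lincomb_coord.
    rewrite !E -/(cov P X i i) -/(cov P (residual P X j) i i) Xi0 => /eqP.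
    rewrite eq_sym paddr_eq0; [by case/andP| |exact: ip_ge0].
    by apply: mulr_ge0; [exact: sqr_ge0|exact: ltW].
  exists j; rewrite inE// negbK /cov.
  under [X in ip P X]eq_fun do rewrite residual_self//.
  by rewrite /ip; under eq_Rintegral do rewrite mul0r; rewrite Rintegral_cst// mul0r.
have mrec x : measurable_fun setT (fun v => recombine P X j x v).
  apply/measurable_fun_tnthP => i.
  have -> : tnth (T:=R) ^~ i \o (recombine P X j x) = (fun v => regr P X j i * x + tnth v i).
    by apply/funext => v /=; rewrite tnth_mktuple.
  by apply: measurable_funD => //; exact: measurable_tnth.
have mV := gaussian_vector_measurable gV.
pose avg (H : n.-tuple R -> R) x := fine (\int[P]_v (H (recombine P X j x (residual P X j v)))%:E).
have intM (H : n.-tuple R -> R) x : measurable_fun setT H -> (forall x, 0 <= H x <= M) ->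
    (0%:E <= \int[P]_v (H (recombine P X j x (residual P X j v)))%:E <= M%:E)%E.
  move=> mH HM; have H0 z : 0 <= H z by case/andP: (HM z).
  rewrite integral_ge0//=; last by move=> v _; rewrite lee_fin.
  have -> : M%:E = (\int[P]_v (cst M%:E v))%E.
    by rewrite integral_cst//= probability_setT mule1.
  apply: ge0_le_integral => //.
  - by move=> v _; rewrite lee_fin.
  - apply/measurable_EFinP; apply: (measurableT_comp mH).
    exact: (measurableT_comp (mrec x) mV).
  - by move=> v _; rewrite lee_fin; case/andP: (HM (recombine P X j x (residual P X j v))).
have avgE (H : n.-tuple R -> R) x : measurable_fun setT H -> (forall x, 0 <= H x <= M) ->
    (avg H x)%:E = (\int[P]_v (H (recombine P X j x (residual P X j v)))%:E)%E.
  move=> mH HM; have /andP[i0 iM] := intM H x mH HM.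
  by rewrite fineK// ge0_fin_numE// (le_lt_trans iM)// ltry.
have avgM (H : n.-tuple R -> R) : measurable_fun setT H -> (forall x, 0 <= H x <= M) ->
    forall x, 0 <= avg H x <= M.
  by move=> mH HM x; rewrite -!lee_fin avgE//; exact: intM.
have mavg (H : n.-tuple R -> R) : measurable_fun setT H -> (forall x, 0 <= H x <= M) ->
    measurable_fun setT (avg H).
  move=> mH HM; have H0 z : 0 <= H z by case/andP: (HM z).
  pose D (z : measurableTypeR R * T) := (H (recombine P X j z.1 (residual P X j z.2)))%:E.
  have mD : measurable_fun setT D.
    apply/measurable_EFinP; apply: (measurableT_comp mH).
    apply/measurable_fun_tnthP => i.
    have -> : tnth (T:=R) ^~ i \o (fun z : measurableTypeR R * T =>
       recombine P X j z.1 (residual P X j z.2)) =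
       (fun z => regr P X j i * z.1 + tnth (residual P X j z.2) i).
      by apply/funext => z /=; rewrite tnth_mktuple.
    apply: measurable_funD; first by apply: measurable_funM => //; exact: measurable_fst.
    have mVi : measurable_fun setT (fun w => tnth (residual P X j w) i).
      by have [t [mt _ _]] := gaussian_vector_coord gV i.
    exact: (measurableT_comp mVi measurable_snd).
  apply: measurableT_comp => //.
  have := @measurable_fun_fubini_tonelli_F _ _ _ _ R P D mD (fun z => H0 _).
  by [].
have split (H : n.-tuple R -> R) : measurable_fun setT H -> (forall x, 0 <= H x <= M) ->
    (\int[P]_w (H (X w))%:E = \int[normal_prob 0 sg]_x (avg H x)%:E)%E.
  move=> mH HM; have H0 z : (0 <= (H z)%:E)%E by rewrite lee_fin; case/andP: (HM z).
  have avg0 x : (0 <= (avg H x)%:E)%E by rewrite lee_fin; case/andP: (avgM H mH HM x).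
  rewrite (@gaussian_split_integral _ _ _ _ _ _ gX j sj (EFin \o H))//; last first.
    exact/measurable_EFinP.
  transitivity (\int[P]_w (avg H (tnth (X w) j))%:E)%E.
    by apply: eq_integral => w _; rewrite avgE.
  rewrite (@cnormal_integral _ _ _ P _ _ (fun x => (avg H x)%:E) csg)//.
    by rewrite /cnormal_int (gt_eqF sg0).
  by apply/measurable_EFinP; exact: mavg.
rewrite !split//.
apply: (@prekopa_leindler_normal R s sg _ _ M K s01 sg0 K0) => //; try exact: mavg; try exact: avgM.
move=> x y.
apply: (IH (residual P X j) (F \o recombine P X j x) (G \o recombine P X j y)) => //.
- by rewrite mulr_ge0// expR_ge0.
- exact: measurableT_comp.
- exact: measurableT_comp.
- by move=> v; exact: FM.
- by move=> v; exact: GM.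
- move=> v v' c cP /=.
  rewrite -mulrA -expRD.
  apply: le_trans (FG _ _ (c + (x - y) ^+ 2 / sg ^+ 2) _) _.
    move=> a; rewrite (var_lin_split gX sj) !lincomb_recombine -/(slope a) covE.
    have := cP a; rewrite /var_lin.
    move: (ip _ _ _) => V cV.
    have : 2 * slope a * (x - y) - slope a ^+ 2 * sg ^+ 2 <= (x - y) ^+ 2 / sg ^+ 2.
      have := sqr_ge0 ((x - y) / sg - slope a * sg).
      rewrite (_ : (_ - _) ^+ 2 = (x - y) ^+ 2 / sg ^+ 2 -
        (2 * slope a * (x - y) - slope a ^+ 2 * sg ^+ 2)) ?subr_ge0//.
      by field; rewrite gt_eqF.
    move: (slope a) (_ / _) => t r; lra.
  rewrite ler_wpM2l// ler_expR le_eqVlt; apply/orP; left; apply/eqP; ring.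
- by case/andP: (avgM F mF FM x).
- by case/andP: (avgM G mG GM y).
- by rewrite avgE.
- by rewrite avgE.
Qed.

End prekopa_leindler_gaussian_vector.

Section gaussian_max_concentration.
Context {R : realType} d (T : measurableType d) (P : probability T R) (n : nat).

(** The maximum of 0 and the coordinates; being nonnegative, it keeps
    expR (- th * pmax x) bounded. *)
Definition pmax (x : n.-tuple R) : R := \big[Num.max/0]_(i < n) tnth x i.

Lemma pmax_ge0 x : 0 <= pmax x.
Proof. by rewrite /pmax bigmax_ge_id. Qed.

Lemma pmax_ge x i : tnth x i <= pmax x.
Proof. by rewrite /pmax; exact: le_bigmax. Qed.

Lemma pmax_attained x : pmax x = 0 \/ exists i, pmax x = tnth x i.
Proof.
rewrite /pmax; elim/big_ind: _ => [|u v uP vP|i _]; [by left| |by right; exists i].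
by rewrite maxEle; case: ifP.
Qed.

Lemma measurable_pmax : measurable_fun setT pmax.
Proof.
rewrite /pmax; elim: (index_enum _) => [|i r IH].
  by rewrite (_ : (fun x => _) = cst 0)//; apply/funext => x; rewrite big_nil.
under eq_fun do rewrite big_cons.
by apply: measurable_maxr => //; exact: measurable_tnth.
Qed.

Variable X : T -> n.-tuple R.
Hypothesis gX : gaussian_vector P X.

Let mX : measurable_fun setT X := gaussian_vector_measurable gX.

Lemma jensen_expR (Z : T -> R) (th m : R) : measurable_fun setT Z ->
  (forall w, 0 <= Z w) -> 0 <= th -> (\int[P]_w (Z w)%:E <= m%:E)%E ->
  ((expR (- (th * m)))%:E <= \int[P]_w (expR (- (th * Z w)))%:E)%E.
Proof.
move=> mZ Z0 th0 Zm.
have iZ0 : (0 <= \int[P]_w (Z w)%:E)%E by apply: integral_ge0 => w _; rewrite lee_fin.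
have Zfin : (\int[P]_w (Z w)%:E)%E \is a fin_num.
  by rewrite ge0_fin_numE// (le_lt_trans Zm)// ltry.
have iZ : P.-integrable setT (fun w => (Z w)%:E).
  apply/integrableP; split; first exact/measurable_EFinP.
  under eq_integral do rewrite gee0_abs ?lee_fin//.
  by rewrite (le_lt_trans Zm)// ltry.
set k := expR (- (th * m)); have k0 : 0 <= k by exact: expR_ge0.
have mE : measurable_fun setT (fun w => (expR (- (th * Z w)))%:E).
  apply/measurable_EFinP; apply: (measurableT_comp (@measurable_expR R)).
  by apply: measurableT_comp => //; exact: measurable_funM.
have E1 w : expR (- (th * Z w)) <= 1.
  by rewrite -expR0 ler_expR oppr_le0 mulr_ge0.
have iE : P.-integrable setT (fun w => (expR (- (th * Z w)))%:E).
  apply: (@le_integrable _ _ _ P _ measurableT _ (cst 1%E)) => //.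
  - by move=> w _; rewrite /= lee_fin normr1 ger0_norm ?expR_ge0.
  - exact: finite_measure_integrable_cst.
(* tangent line of the exponential at the point m *)
have iL : P.-integrable setT (fun w => (k * (1 + th * m))%:E + (- (k * th))%:E * (Z w)%:E)%E.
  apply: integrableD => //; first exact: finite_measure_integrable_cst.
  exact: integrableZl.
apply: le_trans (_ : (\int[P]_w ((k * (1 + th * m))%:E + (- (k * th))%:E * (Z w)%:E) <= _)%E).
  rewrite integralD//; [|exact: finite_measure_integrable_cst|exact: integrableZl].
  rewrite -[X in (_ <= X + _)%E]/(\int[P]_w (cst (k * (1 + th * m))%:E w))%E.
  rewrite integral_cst//= probability_setT mule1 integralZl//.
  rewrite -(fineK Zfin) in Zm *; move: (fine _) Zm => z; rewrite lee_fin => zm.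
  rewrite -EFinM -EFinD lee_fin.
  have : 0 <= k * th * (m - z) by rewrite !mulr_ge0// subr_ge0.
  lra.
apply: le_integral => // w _; rewrite -EFinM -EFinD lee_fin.
have -> : expR (- (th * Z w)) = k * expR (th * (m - Z w)).
  by rewrite -expRD; congr expR; ring.
have := ler_wpM2l k0 (expR_ge1Dx (th * (m - Z w))); lra.
Qed.

(** Prekopa-Leindler for the indicator of {r <= pmax} and expR (- th * pmax).  The
    dual form of its hypothesis is tested on a multiple of the coordinate that
    attains pmax x. *)
Lemma gaussian_max_tail_power (dl kp m s : R) : 0 < dl -> 0 < kp -> 0 < s < 1 ->
  (forall i, cov P X i i <= dl ^+ 2) -> (\int[P]_w (pmax (X w))%:E <= m%:E)%E ->
  fine (P [set w | m + kp * dl <= pmax (X w)]) <=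
  expR (- kp ^+ 2 + kp ^+ 2 / (2 * (1 - s))).
Proof.
move=> dl0 kp0 s01 covd EM.
have /andP[s0 s1] := s01; have s1' : 0 < 1 - s by rewrite subr_gt0.
have mpX : measurable_fun setT (fun w => pmax (X w)) := measurableT_comp measurable_pmax mX.
set r := m + kp * dl; set p := fine _.
(* lam is proportional to s so that the s-th root of the final bound has a limit
   at s = 0; th makes th * (1 - s) equal to lam *)
pose lam := s * kp / dl; pose th := lam / (1 - s).
have lam0 : 0 < lam by rewrite divr_gt0// mulr_gt0.
have th0 : 0 < th by rewrite divr_gt0.
pose F (x : n.-tuple R) : R := (r <= pmax x)%R%:R.
pose G (x : n.-tuple R) : R := expR (- (th * pmax x)).
have mr : measurable [set x | r <= pmax x].
  have -> : [set x | r <= pmax x] = pmax @^-1` `[r, +oo[%classic.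
    by apply/seteqP; split=> x /=; rewrite in_itv/= andbT.
  by rewrite -[X in measurable X]setTI; exact: measurable_pmax.
have FE : F = \1_[set x | r <= pmax x].
  by apply/funext => x; rewrite /F indicE; congr (_%:R); congr nat_of_bool; rewrite mem_setE.
have mF : measurable_fun setT F by rewrite FE; exact: measurable_indic.
have mG : measurable_fun setT G.
  apply: (measurableT_comp (@measurable_expR R)).
  by apply: measurableT_comp => //; apply: measurable_funM => //; exact: measurable_pmax.
have F01 x : 0 <= F x <= 1 by rewrite /F; case: (r <= _); rewrite ?ler01 ?lexx.
have G01 x : 0 <= G x <= 1.
  by rewrite expR_ge0/= -expR0 ler_expR oppr_le0 mulr_ge0 ?pmax_ge0// ltW.
have p0 : 0 <= p by rewrite fine_ge0.
have pF : (p%:E <= \int[P]_w (F (X w))%:E)%E.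
  rewrite FE (_ : (fun w => _) = (fun w => (\1_[set w | r <= pmax (X w)] w)%:E)); last first.
    by apply/funext => w; rewrite !indicE; congr (_%:R%:E); congr nat_of_bool; rewrite !mem_setE.
  have mr' : measurable [set w | r <= pmax (X w)].
    by rewrite -[X in measurable X]setTI; exact: (mX measurableT mr).
  by rewrite integral_indic// setIT fineK// fin_num_measure.
have qG := jensen_expR mpX (fun w => pmax_ge0 _) (ltW th0) EM.
pose K := expR (- (lam * r) + lam ^+ 2 * dl ^+ 2 / (2 * s * (1 - s))).
have := @prekopa_leindler_gaussian R s s01 _ T P n X F G 1 K gX (expR_ge0 _) mF mG F01 G01 _
  p (expR (- (th * m))) p0 (expR_ge0 _) pF qG.
rewrite -expRM (_ : - (th * m) * (1 - s) = - (lam * m)); last first.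
  by rewrite /th; field; rewrite gt_eqF.
have sN : s != 0 by rewrite gt_eqF.
have s1N : 1 - s != 0 by rewrite gt_eqF.
have dN : dl != 0 by rewrite gt_eqF.
move=> H.
have {}H : p `^ s * expR (- (lam * m)) <= K.
  apply: H => x y c cP.
  have [rx|xr] := leP r (pmax x); last first.
    rewrite {1}/F (lt_geF xr) powR0// mul0r mulr_ge0 ?expR_ge0//.
  rewrite /F rx powR1 mul1r /G -expRM -expRD ler_expR.
  (* chosen so that lam * (c / (2 * mx)) is the exponent s * (1 - s) * c / 2 *)
  pose mx := lam / (s * (1 - s)).
  have xy : pmax x - pmax y <= c / (2 * mx) + mx * dl ^+ 2 / 2.
    have mx0 : 0 < mx by rewrite divr_gt0// mulr_gt0.
    have m2 : 0 < 2 * mx by exact: mulr_gt0.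
    rewrite -(ler_pM2r m2) [leRHS](_ : _ = c + mx ^+ 2 * dl ^+ 2); last first.
      by field; rewrite gt_eqF.
    have [xi|[i xi]] := pmax_attained x.
      have := cP (fun=> 0).
      have z0 z : lincomb (fun=> 0) z = 0 :> R by rewrite /lincomb big1// => i _; rewrite mul0r.
      rewrite /var_lin /ip !z0; under eq_Rintegral do rewrite z0 mul0r.
      rewrite Rintegral_cst// mul0r subrr mulr0 subr0 => c0.
      apply: (@le_trans _ _ 0).
        by rewrite xi sub0r mulNr oppr_le0; apply: mulr_ge0; [exact: pmax_ge0|exact: ltW].
      by apply: addr_ge0 => //; apply: mulr_ge0 => //; exact: sqr_ge0.
    have := cP (fun k => mx * coord_vec i k).
    rewrite !lincombZ !lincomb_coord /var_lin.
    rewrite (_ : (fun w => lincomb _ _) = (fun w => mx * tnth (X w) i)); last first.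
      by apply/funext => w; rewrite lincombZ lincomb_coord.
    rewrite ip_sqrZ; last exact: coord_sq gX i.
    rewrite -/(cov P X i i) => cc.
    have yi := pmax_ge y i.
    have h1 := covd i.
    have h2 : mx ^+ 2 * cov P X i i <= mx ^+ 2 * dl ^+ 2 by rewrite ler_wpM2l ?sqr_ge0.
    have h3 : mx * tnth y i <= mx * pmax y by rewrite ler_pM2l.
    move: cc h2 h3; rewrite xi; move: (cov _ _ _ _) (tnth x i) (tnth y i) (pmax y) (dl ^+ 2) => v a b e f.
    nra.
  have -> : - (th * pmax y) * (1 - s) = - (lam * pmax y).
    by rewrite /th; field.
  have : lam * (pmax x - pmax y) <= lam * (c / (2 * mx) + mx * dl ^+ 2 / 2) by rewrite ler_pM2l.
  rewrite (_ : lam * (c / _ + _) = lam ^+ 2 * dl ^+ 2 / (2 * s * (1 - s)) + s * (1 - s) * c / 2); last first.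
    rewrite /mx; field; rewrite s1N sN /lam !mulf_neq0 ?invr_neq0 ?gt_eqF//.
  have : lam * r <= lam * pmax x by rewrite ler_pM2l.
  lra.
have {}H : p `^ s <= expR (s * (- kp ^+ 2 + kp ^+ 2 / (2 * (1 - s)))).
  rewrite -(ler_pM2r (expR_gt0 (- (lam * m)))) -expRD (le_trans H)// ler_expR.
  rewrite le_eqVlt; apply/orP; left; apply/eqP; rewrite /r /lam; field.
  by rewrite s1N sN dN.
have -> : p = (p `^ s) `^ s^-1 by rewrite -powRrM divff// powRr1.
rewrite [leRHS](_ : _ = expR (s * (- kp ^+ 2 + kp ^+ 2 / (2 * (1 - s)))) `^ s^-1); last first.
  by rewrite -expRM; congr expR; field; rewrite sN s1N.
by apply: ge0_ler_powR; rewrite ?nnegrE ?powR_ge0 ?expR_ge0// invr_ge0 ltW.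
Qed.

(** The limit of the previous bound as s tends to 0. *)
Theorem gaussian_max_tail (dl kp m : R) : 0 < dl -> 0 < kp ->
  (forall i, cov P X i i <= dl ^+ 2) -> (\int[P]_w (pmax (X w))%:E <= m%:E)%E ->
  (P [set w | (m + kp * dl <= pmax (X w))%R] <= (expR (- kp ^+ 2 / 2))%:E)%E.
Proof.
move=> dl0 kp0 covd EM.
have mpX : measurable_fun setT (fun w => pmax (X w)) := measurableT_comp measurable_pmax mX.
have mr : measurable [set w | m + kp * dl <= pmax (X w)].
  have -> : [set w | m + kp * dl <= pmax (X w)] =
      (fun w => pmax (X w)) @^-1` `[m + kp * dl, +oo[%classic.
    by apply/seteqP; split=> x /=; rewrite in_itv/= andbT.
  by rewrite -[X in measurable X]setTI; exact: mpX.
have Pfin := fin_num_measure P _ mr.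
rewrite -(fineK Pfin) lee_fin; set p := fine _.
have p0 : 0 <= p by rewrite fine_ge0.
have p1 : p <= 1 by rewrite -lee_fin fineK// probability_le1.
apply/ler_addgt0Pr => e e0.
have kp20 : 0 < kp ^+ 2 by rewrite exprn_gt0.
(* chosen so that kp ^+ 2 / (2 * (1 - s)) = kp ^+ 2 / 2 + e *)
pose t := 2 * e / kp ^+ 2; have t0 : 0 < t by rewrite divr_gt0// mulr_gt0.
pose s := t / (1 + t).
have s01 : 0 < s < 1.
  by rewrite divr_gt0 ?addr_gt0//= ltr_pdivrMr ?addr_gt0// mul1r ltrDr.
have := gaussian_max_tail_power dl0 kp0 s01 covd EM; rewrite -/p.
have -> : - kp ^+ 2 + kp ^+ 2 / (2 * (1 - s)) = - kp ^+ 2 / 2 + e.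
  rewrite /s /t; move: (kp ^+ 2) kp20 => k k0; field.
  rewrite !gt_eqF ?addr_gt0// ?mulr_gt0//.
rewrite expRD => pe.
have h1 : p * (1 - e) <= expR (- kp ^+ 2 / 2).
  apply: le_trans (_ : p * expR (- e) <= _).
    by rewrite ler_wpM2l//; exact: expR_ge1Dx.
  by rewrite expRN ler_pdivrMr ?expR_gt0.
by nra.
Qed.

End gaussian_max_concentration.

(** * The normal tail *)

Section normal_tail.
Context {R : realType}.
Local Notation mu := (@lebesgue_measure R).
Variables (k c : R).
Hypotheses (k0 : 0 < k) (c0 : 0 <= c).

Let D x : R := x ^+ 4 + 6 * k * x ^+ 2 + 3 * k ^+ 2.
Let p x : R := c * expR (- x ^+ 2 / (k *+ 2)).
Let F x : R := - (k * p x * ((x ^+ 3 + 5 * k * x) / D x)).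
Let f x : R := p x * (1 - 24 * k ^+ 4 / D x ^+ 2).

Let D_gt0 x : 0 < D x.
Proof.
have := sqr_ge0 (x ^+ 2); have := sqr_ge0 x; have : 0 < k ^+ 2 by rewrite exprn_gt0.
rewrite /D (_ : x ^+ 4 = (x ^+ 2) ^+ 2); last by ring.
move: (x ^+ 2) => y k2 y0 y2; have := mulr_ge0 (ltW k0) y0; lra.
Qed.

Let p_ge0 x : 0 <= p x. Proof. by rewrite mulr_ge0// expR_ge0. Qed.

Let is_derive_D (x : R) : is_derive x 1 D (4 * x ^+ 3 + 12 * k * x).
Proof. by rewrite /D; apply: is_derive_eq; rewrite /GRing.scale/=; ring. Qed.

Let is_derive_p (x : R) : is_derive x 1 p (- x / k * p x).
Proof.
rewrite /p; apply: is_derive_eq; rewrite /GRing.scale/=.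
by field; rewrite gt_eqF.
Qed.

Let is_derive_Dinv (x : R) :
  is_derive x 1 (fun y => (D y)^-1) (- (D x) ^- 2 *: (4 * x ^+ 3 + 12 * k * x)).
Proof.
have DN : D x != 0 by rewrite gt_eqF.
have dD := is_derive_D x; exact: is_deriveV.
Qed.

Let is_derive_F (x : R) : is_derive x 1 F (f x).
Proof.
have DN : D x != 0 by rewrite gt_eqF.
have dp := is_derive_p x; have dDi := is_derive_Dinv x.
rewrite /F; apply: is_derive_eq.
rewrite /GRing.scale/= /f.
move: DN; rewrite /D => DN.
move: (p x) => P.
by field; rewrite DN gt_eqF.
Qed.

Let continuous_f : continuous f.
Proof.
move=> x; rewrite /f.
have DN : D x != 0 by rewrite gt_eqF.
have dp := is_derive_p x; have dDi := is_derive_Dinv x.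
have df : derivable (fun x => p x * (1 - 24 * k ^+ 4 * ((D x)^-1) ^+ 2)) x 1.
  by apply: ex_derive.
have -> : (fun x => p x * (1 - 24 * k ^+ 4 / D x ^+ 2)) =
  (fun x => p x * (1 - 24 * k ^+ 4 * ((D x)^-1) ^+ 2)).
  by apply/funext => y; rewrite exprVn.
exact/differentiable_continuous/derivable1_diffP.
Qed.

Let cvg_F : F x @[x --> +oo] --> (0 : R).
Proof.
apply/cvgrPdist_le => e e0.
near=> x.
have x0 : 0 < x by near: x; apply: nbhs_pinfty_gt; rewrite num_real.
rewrite sub0r normrN /F normrN ger0_norm; last first.
  apply: mulr_ge0; first by rewrite mulr_ge0// ltW.
  by rewrite divr_ge0 ?(ltW (D_gt0 x))// addr_ge0// ?exprn_ge0 ?mulr_ge0// ltW.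
have h1 : p x <= c.
  rewrite /p ler_piMr// -expR0 ler_expR mulNr oppr_le0 divr_ge0 ?sqr_ge0//.
  by rewrite mulrn_wge0// ltW.
have h2 : (x ^+ 3 + 5 * k * x) / D x <= x^-1.
  rewrite ler_pdivrMr// ler_pdivlMl// /D.
  have := sqr_ge0 x; have : 0 < k ^+ 2 by rewrite exprn_gt0.
  rewrite (_ : x * (x ^+ 3 + 5 * k * x) = x ^+ 4 + 5 * k * x ^+ 2); last by ring.
  move: (x ^+ 4) (x ^+ 2) => a y k2 y0; have := mulr_ge0 (ltW k0) y0; lra.
apply: (@le_trans _ _ (k * c * x^-1)).
  apply: ler_pM => //.
  - by rewrite mulr_ge0// ltW.
  - by rewrite divr_ge0 ?(ltW (D_gt0 x))// addr_ge0// ?exprn_ge0 ?mulr_ge0// ltW.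
  - by rewrite ler_pM2l.
rewrite ler_pdivrMr; last exact: x0.
rewrite -ler_pdivrMl; last exact: e0.
by near: x; apply: nbhs_pinfty_ge; rewrite num_real.
Unshelve. all: by end_near. Qed.

(** The function F tends to 0 at infinity, and its derivative f is below p. *)
Lemma gauss_tail_ge (z : R) : 0 < z -> k <= z ^+ 2 ->
  ((k * p z * ((z ^+ 3 + 5 * k * z) / D z))%:E <= \int[mu]_(x in `[z, +oo[) (p x)%:E)%E.
Proof.
move=> z0 kz.
have f0 x : z <= x -> 0 <= f x.
  move=> zx; rewrite /f mulr_ge0// subr_ge0 ler_pdivrMr ?exprn_gt0// mul1r.
  have kx : k <= x ^+ 2.
    by apply: le_trans kz _; rewrite ler_sqr ?nnegrE ?(ltW z0)// (le_trans (ltW z0) zx).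
  have kD : 10 * k ^+ 2 <= D x.
    rewrite /D (_ : x ^+ 4 = (x ^+ 2) ^+ 2); last by ring.
    rewrite -subr_ge0 in kx; have := mulr_ge0 (ltW k0) kx.
    have := sqr_ge0 (x ^+ 2 - k); move: (x ^+ 2) => y; lra.
  apply: le_trans (_ : (10 * k ^+ 2) ^+ 2 <= _).
    rewrite (_ : k ^+ 4 = (k ^+ 2) ^+ 2); last by ring.
    have := sqr_ge0 (k ^+ 2); lra.
  by rewrite ler_sqr ?nnegrE ?(ltW (D_gt0 x))// mulr_ge0// sqr_ge0.
have cF : continuous F.
  move=> x; apply/differentiable_continuous/derivable1_diffP.
  exact: (@ex_derive _ _ _ _ _ _ _ (is_derive_F x)).
have -> : k * p z * ((z ^+ 3 + 5 * k * z) / D z) = 0 - F z by rewrite /F sub0r opprK.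
have FTC : (\int[mu]_(x in `[z, +oo[) (f x)%:E = 0%:E - (F z)%:E)%E.
  apply: ge0_continuous_FTC2y.
  - exact: f0.
  - by apply: continuous_subspaceT => x; exact: continuous_f.
  - exact: cvg_F.
  - by move=> x _; exact: (@ex_derive _ _ _ _ _ _ _ (is_derive_F x)).
  - by apply: cvg_at_right_filter; exact: cF.
  - by move=> x _; rewrite derive1E; exact: (@derive_val _ _ _ _ _ _ _ (is_derive_F x)).
rewrite EFinB -FTC.
apply: ge0_le_integral.
- exact: measurable_itv.
- by move=> x; rewrite /= in_itv/= andbT => /f0; rewrite lee_fin.
- by apply/measurable_EFinP; apply: measurable_funTS; exact: continuous_measurable_fun.
- apply/measurable_EFinP; apply: measurable_funTS.
  apply: measurable_funM => //; apply: (measurableT_comp (@measurable_expR R)).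
  by apply: measurable_funM => //; apply: measurableT_comp => //; exact: measurable_funX.
- move=> x _; rewrite lee_fin /f; apply: ler_piMr; first exact: p_ge0.
  rewrite lerBlDr lerDl; apply: divr_ge0; last exact: sqr_ge0.
  by rewrite mulr_ge0// exprn_ge0// ltW.
Qed.

End normal_tail.

Section normal_tail_bound.
Context {R : realType}.
Local Notation mu := (@lebesgue_measure R).

(** A convergent of the continued fraction of the Mills ratio.  It is accurate
    enough for the 0.95-quantile, where z / (z ^+ 2 + s ^+ 2) would not do. *)
Lemma normal_tail_ge (s z : R) : 0 < s -> s <= z ->
  ((s ^+ 2 * normal_pdf 0 s z * ((z ^+ 3 + 5 * s ^+ 2 * z) /
     (z ^+ 4 + 6 * s ^+ 2 * z ^+ 2 + 3 * (s ^+ 2) ^+ 2)))%:E <=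
   normal_prob 0 s `]z, +oo[)%E.
Proof.
move=> s0 sz; have z0 := lt_le_trans s0 sz.
have pdfE x : normal_pdf 0 s x = normal_peak s * expR (- x ^+ 2 / (s ^+ 2 *+ 2)).
  by rewrite normal_pdf_expE ?gt_eqF// subr0.
rewrite pdfE; apply: le_trans (gauss_tail_ge _ (normal_peak_ge0 s) z0 _) _.
- by rewrite exprn_gt0.
- by rewrite ler_sqr ?nnegrE// ltW.
rewrite -integral_itv_obnd_cbnd//; last first.
  apply/measurable_EFinP; apply: measurable_funTS.
  apply: measurable_funM => //; apply: (measurableT_comp (@measurable_expR R)).
  by apply: measurable_funM => //; apply: measurableT_comp => //; exact: measurable_funX.
rewrite /normal_prob le_eqVlt; apply/orP; left; apply/eqP.
by apply: eq_integral => x _; rewrite pdfE.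
Qed.

End normal_tail_bound.

(** * Anti-concentration of Gaussian maxima *)

Section density_tail.
Context {R : realType}.

(** Up to the level L the Mills ratio converts density into tail probability;
    beyond it the density is negligible because r * expR (- r ^+ 2 / 2)
    decreases on r >= 1. *)
Lemma normal_pdf_le_tail (L a z s : R) : 1 <= L -> 0 < s -> s <= a -> a <= z ->
  normal_pdf 0 s z <= (L ^+ 2 + 1) / a * fine (normal_prob 0 s `]z, +oo[) +
    L * expR (- L ^+ 2 / 2) / 2 / a.
Proof.
move=> L1 s0 sa az; have a0 := lt_le_trans s0 sa; have z0 := lt_le_trans a0 az.
have sz := le_trans sa az; have L0 : 0 < L by exact: lt_le_trans L1.
have := normal_tail_ge s0 sz.
have tfin : normal_prob 0 s `]z, +oo[ \is a fin_num by exact: fin_num_measure.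
rewrite -[X in (_ <= X)%E](fineK tfin) lee_fin; move: (fine_ge0 (measure_ge0 (normal_prob 0 s) `]z, +oo[)).
set t := fine _ => t0 tail.
have pdf0 : 0 <= normal_pdf 0 s z by exact: normal_pdf_ge0.
have e0 : 0 <= L * expR (- L ^+ 2 / 2) / 2 / a.
  by rewrite !divr_ge0// ?mulr_ge0 ?expR_ge0// ltW.
have [zL|Lz] := leP z (L * s).
  have zLs : z ^+ 2 <= L ^+ 2 * s ^+ 2.
    by rewrite -exprMn ler_sqr ?nnegrE ?(ltW z0) ?(ltW (mulr_gt0 L0 s0)).
  have k0 : 0 < s ^+ 2 by rewrite exprn_gt0.
  have z20 : 0 < z ^+ 2 by rewrite exprn_gt0.
  have q : z / (z ^+ 2 + s ^+ 2) <=
     (z ^+ 3 + 5 * s ^+ 2 * z) / (z ^+ 4 + 6 * s ^+ 2 * z ^+ 2 + 3 * (s ^+ 2) ^+ 2).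
    rewrite (_ : z ^+ 4 = (z ^+ 2) ^+ 2); last by ring.
    rewrite (_ : z ^+ 3 + _ = z * (z ^+ 2 + 5 * s ^+ 2)); last by ring.
    rewrite -mulrA ler_pM2l//; move: (z ^+ 2) (s ^+ 2) z20 k0 => y k y0 k0.
    rewrite ler_pdivlMr ?addr_gt0 ?mulr_gt0 ?exprn_gt0// mulrC ler_pdivrMr ?addr_gt0//.
    have := mulr_gt0 k0 k0; have := mulr_gt0 k0 y0; nra.
  have {}tail : s ^+ 2 * normal_pdf 0 s z * (z / (z ^+ 2 + s ^+ 2)) <= t.
    by apply: le_trans tail; rewrite ler_wpM2l// mulr_ge0// ltW.
  apply: (@le_trans _ _ ((L ^+ 2 + 1) / a * t)); last by rewrite lerDl.
  apply: (@le_trans _ _ ((L ^+ 2 + 1) / a * (s ^+ 2 * normal_pdf 0 s z * (z / (z ^+ 2 + s ^+ 2))))); last first.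
    by rewrite ler_wpM2l// divr_ge0 ?(ltW a0)// addr_ge0// sqr_ge0.
  rewrite (_ : (L ^+ 2 + 1) / a * _ = normal_pdf 0 s z *
    (((L ^+ 2 * s ^+ 2 + s ^+ 2) / (z ^+ 2 + s ^+ 2)) * (z / a))); last first.
    by field; rewrite !gt_eqF// addr_gt0.
  rewrite ler_peMr//; apply: mulr_ege1.
    by rewrite ler_pdivlMr ?addr_gt0// mul1r lerD2r.
  by rewrite ler_pdivlMr// mul1r.
apply: (@le_trans _ _ (L * expR (- L ^+ 2 / 2) / 2 / a)); last first.
  by rewrite lerDr mulr_ge0// divr_ge0 ?(ltW a0)// addr_ge0// sqr_ge0.
set r := z / s; have Lr : L <= r by rewrite ler_pdivlMr// ltW.
have r0 : 0 < r by exact: lt_le_trans Lr.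
have rL : r * expR (- r ^+ 2 / 2) <= L * expR (- L ^+ 2 / 2).
  have -> : expR (- L ^+ 2 / 2) = expR ((r ^+ 2 - L ^+ 2) / 2) * expR (- r ^+ 2 / 2).
    by rewrite -expRD; congr expR; field.
  rewrite mulrA ler_pM2r ?expR_gt0// -ler_pdivrMl// mulrC.
  apply: le_trans (_ : expR (r / L - 1) <= _).
    by have := expR_ge1Dx (r / L - 1); rewrite addrC subrK.
  rewrite ler_expR (_ : r / L - 1 = (r - L) / L); last by field; rewrite gt_eqF.
  have LL : 1 <= L * L by apply: mulr_ege1.
  have rLL : L * L <= r * L by rewrite ler_pM2r.
  have : 0 <= (r - L) * ((r + L) / 2 * L - 1).
    by apply: mulr_ge0; [rewrite subr_ge0|lra].
  rewrite ler_pdivrMr//; lra.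
have pk : normal_peak 1 <= 2^-1 :> R.
  have s2 : 2 <= Num.sqrt (pi *+ 2) :> R.
    have := pi_ge2 R; move: (pi : R) => p p2.
    by rewrite -(ger0_norm (ler0n R 2)) -sqrtr_sqr ler_sqrt; lra.
  by rewrite /normal_peak expr1n mul1r lef_pV2 ?posrE// (lt_le_trans _ s2).
have -> : normal_pdf 0 s z = (r * expR (- r ^+ 2 / 2)) * normal_peak 1 / z.
  rewrite normal_pdf_expE ?gt_eqF// subr0 -[in LHS](mulr1 s) normal_peakM// mulr1.
  rewrite (_ : - z ^+ 2 / (s ^+ 2 *+ 2) = - r ^+ 2 / 2); last first.
    by rewrite /r; field; rewrite gt_eqF.
  by rewrite /r; field; rewrite !gt_eqF.
apply: ler_pM => //.
- apply: mulr_ge0; last exact: normal_peak_ge0.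
  by apply: mulr_ge0; [exact: ltW|exact: expR_ge0].
- by rewrite invr_ge0 ltW.
- apply: ler_pM => //; first by rewrite mulr_ge0 ?expR_ge0// ltW.
  exact: normal_peak_ge0.
- by rewrite lef_pV2 ?posrE.
Qed.

End density_tail.

Section anti_concentration.
Context {R : realType} d (T : measurableType d) (P : probability T R) (n : nat).
Local Notation mu := (@lebesgue_measure R).

(** Comparison with ties broken in favour of the smaller index, so that the
    maximum of a vector is attained at exactly one index. *)
Definition beaten (i j : 'I_n) (u v : R) : bool := if (i < j)%N then u < v else u <= v.

Lemma measurable_beaten d' (S : measurableType d') (j : 'I_n)
    (u : 'I_n -> S -> R) (v : S -> R) :
  (forall i, measurable_fun setT (u i)) -> measurable_fun setT v ->
  measurable [set t | forall i, beaten i j (u i t) (v t)].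
Proof.
move=> mu_ mv.
have -> : [set t | forall i, beaten i j (u i t) (v t)] =
    \bigcap_(i in [set: 'I_n]) [set t | beaten i j (u i t) (v t)].
  by apply/seteqP; split=> [t h i _|t h i]; [exact: h|exact: (h i)].
apply: fin_bigcap_measurable; first exact: finite_finset.
move=> i _.
have mb : measurable_fun setT (fun t => beaten i j (u i t) (v t)).
  by rewrite /beaten; case: (i < j)%N; [exact: measurable_fun_ltr|exact: measurable_fun_ler].
by have := mb measurableT [set true] I; rewrite setTI.
Qed.

Variable X : T -> n.-tuple R.
Hypothesis gX : gaussian_vector P X.

Let mX i : measurable_fun setT (fun w => tnth (X w) i).
Proof. by have [s []] := gaussian_vector_coord gX i. Qed.

(** The conditional probability that the maximum is at j, given that the j-th
    coordinate equals z. *)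
Definition argmax_prob j z : \bar R :=
  P [set w | forall i, beaten i j (tnth (recombine P X j z (residual P X j w)) i) z].

(** For fixed z these events are pairwise disjoint, by the Cauchy-Schwarz
    inequality. *)
Definition tail_event j z : set T :=
  [set w | z < tnth (X w) j /\
     forall i, beaten i j (tnth (X w) i - regr P X j i * (tnth (X w) j - z)) z].

Definition argmax_event (a b : R) j : set T :=
  [set w | a <= tnth (X w) j <= b /\ forall i, beaten i j (tnth (X w) i) (tnth (X w) j)].

Let argmax_prob_event j z : set T :=
  [set w | forall i, beaten i j (tnth (recombine P X j z (residual P X j w)) i) z].

Let measurable_argmax_prob_event j z : measurable (argmax_prob_event j z).
Proof.
apply: measurable_beaten => // i.
under eq_fun do rewrite tnth_mktuple.
apply: measurable_funD => //.
under eq_fun do rewrite tnth_mktuple.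
by apply: measurable_funB => //; exact: measurable_funM.
Qed.

Lemma argmax_prob_bounds j z : (0 <= argmax_prob j z <= 1)%E.
Proof. by rewrite measure_ge0 probability_le1//; exact: measurable_argmax_prob_event. Qed.

Lemma measurable_tail_event j z : measurable (tail_event j z).
Proof.
rewrite /tail_event; apply: (@measurableI _ _ [set w | z < tnth (X w) j]).
  have mb : measurable_fun setT (fun w => z < tnth (X w) j) by exact: measurable_fun_ltr.
  by have := mb measurableT [set true] I; rewrite setTI.
apply: measurable_beaten => [i|//].
apply: measurable_funB => //; apply: measurable_funM => //.
exact: measurable_funB.
Qed.

Lemma measurable_argmax_event a b j : measurable (argmax_event a b j).
Proof.
rewrite /argmax_event; apply: (@measurableI _ _ [set w | a <= tnth (X w) j <= b]).
  have mb : measurable_fun setT (fun w => (a <= tnth (X w) j) && (tnth (X w) j <= b)).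
    by apply: measurable_and; exact: measurable_fun_ler.
  by have := mb measurableT [set true] I; rewrite setTI.
exact: measurable_beaten.
Qed.

(** Let t, s > 0 be the excesses of the coordinates j and k over z.  The two events
    give s <= cov j k / cov j j * t and t < cov j k / cov k k * s, whose product
    contradicts the Cauchy-Schwarz inequality. *)
Lemma tail_event_disjoint (j k : 'I_n) z w : (j < k)%N -> 0 < cov P X j j -> 0 < cov P X k k ->
  tail_event j z w -> tail_event k z w -> False.
Proof.
move=> jk sj sk [zj /(_ k)] + [zk /(_ j)].
rewrite /beaten jk ltnNge (ltnW jk)/= /regr.
have cjk := ip_cauchy_schwarz (coord_sq gX j) (coord_sq gX k).
have ckj : cov P X k j = cov P X j k by exact: ipC.
move: cjk; rewrite -!/(cov P X _ _) ckj.
move: (cov P X j k) (cov P X j j) (cov P X k k) sj sk => c v v' v0 v'0 cc.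
set t := tnth (X w) j - z; set s := tnth (X w) k - z => kj jk'.
have t0 : 0 < t by rewrite subr_gt0.
have s0 : 0 < s by rewrite subr_gt0.
have h1 : s * v <= c * t.
  by rewrite -ler_pdivlMr// mulrAC; move: kj; rewrite /s; lra.
have h2 : t * v' < c * s.
  by rewrite -ltr_pdivlMr// mulrAC; move: jk'; rewrite /t; lra.
have c0 : 0 < c.
  by rewrite -(pmulr_lgt0 _ s0) (lt_trans _ h2)// mulr_gt0.
have h3 : s * (v * v') < s * c ^+ 2.
  apply: (@le_lt_trans _ _ (c * (t * v'))).
    by rewrite !mulrA ler_pM2r.
  rewrite (_ : s * c ^+ 2 = c * (c * s)); last by ring.
  by rewrite ltr_pM2l.
by move: h3; rewrite ltr_pM2l// ltNge cc.
Qed.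

Lemma sum_tail_event (z : R) :
  (\sum_(j < n | (0 < cov P X j j)%R) P (tail_event j z) <= 1)%E.
Proof.
rewrite -(@measure_bigsetU_ord_cond _ _ _ P n (fun j => 0 < cov P X j j)
  (fun j => tail_event j z)).
- apply: probability_le1; apply: bigsetU_measurable => j _.
  exact: measurable_tail_event.
- by move=> j _; exact: measurable_tail_event.
- move=> j k sj sk [w [wj wk]]; apply/eqP; rewrite -val_eqE.
  by case: ltngtP => // jk; exfalso; [exact: (tail_event_disjoint jk sj sk wj wk)|
    exact: (tail_event_disjoint jk sk sj wk wj)].
Qed.

(** Replacing the value of X j by z does not change the residual, which is
    independent of X j. *)
Lemma tail_event_prob j z : 0 < cov P X j j ->
  P (tail_event j z) = (P [set w | (z < tnth (X w) j)%R] * argmax_prob j z)%E.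
Proof.
move=> sj.
pose S := [set x : n.-tuple R | z < tnth x j /\
     forall i, beaten i j (tnth x i - regr P X j i * (tnth x j - z)) z].
have mt i : measurable_fun setT (fun x : n.-tuple R => tnth x i) by exact: measurable_tnth.
have mS : measurable S.
  rewrite /S; apply: (@measurableI _ _ [set x : n.-tuple R | z < tnth x j]).
    have mb : measurable_fun setT (fun x : n.-tuple R => z < tnth x j).
      by apply: measurable_fun_ltr.
    by have := mb measurableT [set true] I; rewrite setTI.
  apply: measurable_beaten => [i|//].
  apply: measurable_funB => //; apply: measurable_funM => //.
  exact: measurable_funB.
have := gaussian_split gX sj mS; rewrite -[X in P X]/(tail_event j z) => ->.
have -> : (fun z0 : T * T => recombine P X j (tnth (X z0.1) j) (residual P X j z0.2)) @^-1` S =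
    [set w | z < tnth (X w) j] `*`
    [set w | forall i, beaten i j (tnth (recombine P X j z (residual P X j w)) i) z].
  have E x v i : tnth (recombine P X j x v) i - regr P X j i * (x - z) =
      tnth (recombine P X j z v) i.
    by rewrite !tnth_mktuple; ring.
  have Ej x w : tnth (recombine P X j x (residual P X j w)) j = x.
    by rewrite tnth_mktuple regr_self// mul1r residual_self// addr0.
  apply/seteqP; split=> -[w v]; rewrite /S/= !Ej => -[zw h]; split=> // i; have := h i;
  by rewrite E.
rewrite product_measure1E//.
- have mb : measurable_fun setT (fun w => z < tnth (X w) j) by exact: measurable_fun_ltr.
  by have := mb measurableT [set true] I; rewrite setTI.
- exact: measurable_argmax_prob_event.
Qed.

Lemma measurable_argmax_prob j : measurable_fun setT (argmax_prob j).
Proof.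
pose S := [set z : measurableTypeR R * T |
  forall i, beaten i j (tnth (recombine P X j z.1 (residual P X j z.2)) i) z.1].
have mS : measurable S.
  rewrite /S; apply: measurable_beaten; last exact: measurable_fst.
  move=> i; under eq_fun do rewrite !tnth_mktuple.
  apply: measurable_funD.
    by apply: measurable_funM => //; exact: measurable_fst.
  apply: measurable_funB; first exact: (measurableT_comp (mX i) measurable_snd).
  apply: measurable_funM => //; exact: (measurableT_comp (mX j) measurable_snd).
have := measurable_fun_xsection P mS.
apply: eq_measurable_fun => z _ /=.
by rewrite /argmax_prob; congr (P _); apply/seteqP; split=> w /=; rewrite /xsection/= inE.
Qed.

Lemma argmax_event_prob a b j s : 0 < s ->
  cnormal P (fun w => tnth (X w) j) s ->
  P (argmax_event a b j) =
  (\int[mu]_(z in `[a, b]) (argmax_prob j z * (normal_pdf 0 s z)%:E))%E.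
Proof.
move=> s0 cj.
have sj : 0 < cov P X j j by rewrite /cov (cnormal_ip cj) exprn_gt0.
pose S := [set x : n.-tuple R | a <= tnth x j <= b /\
     forall i, beaten i j (tnth x i) (tnth x j)].
have mt i : measurable_fun setT (fun x : n.-tuple R => tnth x i) by exact: measurable_tnth.
have mS : measurable S.
  rewrite /S; apply: (@measurableI _ _ [set x : n.-tuple R | a <= tnth x j <= b]).
    have mb : measurable_fun setT (fun x : n.-tuple R => (a <= tnth x j) && (tnth x j <= b)).
      by apply: measurable_and; exact: measurable_fun_ler.
    by have := mb measurableT [set true] I; rewrite setTI.
  exact: measurable_beaten.
pose g (z : R) : \bar R := ((\1_(`[a, b]%classic : set R) z)%:E * argmax_prob j z)%E.
have mab : measurable_fun setT (fun z : R => (\1_(`[a, b]%classic : set R) z)%:E : \bar R).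
  by apply/measurable_EFinP; exact: measurable_indic.
have mg : measurable_fun setT g.
  by apply: emeasurable_funM => //; exact: measurable_argmax_prob.
have g0 z : (0 <= g z)%E by rewrite /g mule_ge0// lee_fin.
have Ej x w : tnth (recombine P X j x (residual P X j w)) j = x.
  by rewrite tnth_mktuple regr_self// mul1r residual_self// addr0.
have mSX : measurable (argmax_event a b j) := measurable_argmax_event a b j.
transitivity (\int[P]_w (\1_S (X w))%:E)%E.
  transitivity (\int[P]_w (\1_(argmax_event a b j) w)%:E)%E.
    by rewrite integral_indic// setIT.
  apply: eq_integral => w _; rewrite !indicE; congr (_%:R%:E); congr nat_of_bool.
have m1S : measurable_fun setT (fun x : n.-tuple R => (\1_S x)%:E : \bar R).
  by apply/measurable_EFinP; exact: measurable_indic.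
have i0 x : (0 <= (\1_S x)%:E :> \bar R)%E by rewrite lee_fin.
rewrite (gaussian_split_integral gX sj m1S i0).
transitivity (\int[P]_w g (tnth (X w) j))%E.
  apply: eq_integral => w _; set x := tnth (X w) j.
  have xin : (x \in (`[a, b]%classic : set R)) = (a <= x <= b).
    by apply/idP/idP; rewrite inE/= in_itv.
  have [xab|xab] := boolP (a <= x <= b); last first.
    rewrite /g indicE xin (negPf xab) mul0e.
    apply: integral0_eq => v _; rewrite indicE.
    have -> // : (recombine P X j x (residual P X j v) \in S) = false.
    by apply/negP; rewrite inE /S/= Ej => -[h _]; move: xab; rewrite h.
  rewrite /g indicE xin xab mul1e.
  pose B := argmax_prob_event j x.
  have mB : measurable B := measurable_argmax_prob_event j x.
  transitivity (\int[P]_v (\1_B v)%:E)%E; last by rewrite integral_indic// setIT.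
  apply: eq_integral => v _; rewrite !indicE; congr (_%:R%:E); congr nat_of_bool.
  by apply/idP/idP; rewrite !inE /S /B/= Ej; [case|move=> h; split].
rewrite (@cnormal_integral _ _ _ P _ _ g cj)// /cnormal_int (gt_eqF s0).
rewrite ge0_integral_normal//.
rewrite [RHS]integral_mkcond; apply: eq_integral => z _.
rewrite /g /patch indicE mem_setE; case: ifP => _; rewrite ?mul1e ?mul0e//.
Qed.


(** The density of the maximum at z >= a is the sum over j of argmax_prob j z times
    the density of X j.  By normal_pdf_le_tail it is at most (L ^+ 2 + 1) / a times
    a sum of probabilities of disjoint events, plus n error terms whose factor
    expR (- L ^+ 2 / 2) is 1 / n. *)
Theorem gaussian_max_anti_concentration (sb a b : R) : (1 < n)%N -> 0 < sb ->
  (forall i, cov P X i i <= sb ^+ 2) -> 0 < a -> 2 * sb ^+ 2 <= a ^+ 2 -> a <= b ->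
  (P [set w | exists j, (a <= tnth (X w) j <= b)%R /\ forall i, (tnth (X w) i <= tnth (X w) j)%R] <=
   ((b - a) / sb * Num.sqrt (ln n%:R) * (Num.sqrt (2 * ln n%:R) + 3))%:E)%E.
Proof.
move=> n1 sb0 covb a0 asb ab.
set A := [set w | _].
have sba : sb <= a.
  rewrite -(ler_sqr (ltW sb0) (ltW a0)); apply: le_trans asb.
  by have := sqr_ge0 sb; lra.
set N : R := n%:R; have N2 : 2 <= N by rewrite ler_nat.
have N0 : 0 < N by exact: lt_le_trans N2.
have lnN : 1 <= 2 * ln N.
  have ln2 : 2^-1 <= ln (2 : R).
    have h : -1 < - 2^-1 :> R by lra.
    have := le_ln1Dx h; rewrite (_ : 1 - 2^-1 = 2^-1 :> R); last by field.
    by rewrite lnV ?posrE//; lra.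
  have : ln 2 <= ln N by rewrite ler_ln ?posrE.
  lra.
set L := Num.sqrt (2 * ln N).
have L2 : L ^+ 2 = 2 * ln N by rewrite sqr_sqrtr// (le_trans _ lnN).
have L1 : 1 <= L by rewrite -sqrtr1 ler_sqrt// (le_trans _ lnN).
have L0 : 0 < L by exact: lt_le_trans L1.
have expL : expR (- L ^+ 2 / 2) = N^-1.
  by rewrite L2 (_ : - (2 * ln N) / 2 = - ln N); [rewrite expRN lnK|field].
pose sg j := Num.sqrt (cov P X j j).
have csg j : cnormal P (fun w => tnth (X w) j) (sg j).
  have [t ct] := gaussian_vector_coord gX j.
  rewrite /sg /cov (cnormal_ip ct) sqrtr_sqr ger0_norm//.
  by have [] := ct.
have sga j : sg j <= a.
  apply: le_trans sba; rewrite -(ger0_norm (ltW sb0)) -sqrtr_sqr.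
  by rewrite ler_sqrt ?sqr_ge0.
pose h j z : \bar R := if 0 < cov P X j j then
  (argmax_prob j z * (normal_pdf 0 (sg j) z)%:E)%E else 0%E.
have mab : measurable (`[a, b]%classic : set R) by exact: measurable_itv.
have hE j : P (argmax_event a b j) = (\int[mu]_(z in `[a, b]) h j z)%E.
  rewrite /h; have [sj|sj] := ltP 0 (cov P X j j).
    by apply: argmax_event_prob => //; rewrite sqrtr_gt0.
  rewrite integral0; have sg0 : sg j = 0 by rewrite /sg ler0_sqrtr.
  have := csg j; rewrite sg0 => /cnormal0_ae Xj0.
  apply: measure_negligible; first exact: measurable_argmax_event.
  apply: negligibleS Xj0 => w [/andP[aw _] _] /= w0.
  by move: aw; rewrite w0 leNgt a0.
set C := (L ^+ 2 + 1) / a + L / 2 / a.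
have C0 : 0 <= C.
  by rewrite addr_ge0// !divr_ge0 ?(ltW a0) ?(ltW L0)// addr_ge0// sqr_ge0.
have p01 j z : (0 <= argmax_prob j z <= 1)%E by exact: argmax_prob_bounds.
have h0 j z : (0 <= h j z)%E.
  by rewrite /h; case: ifP => // _; rewrite mule_ge0// ?lee_fin ?normal_pdf_ge0//; case/andP: (p01 j z).
have mh j : measurable_fun (`[a, b]%classic : set R) (h j).
  apply: measurable_funTS; rewrite /h; case: (0 < cov P X j j) => //.
  apply: emeasurable_funM; first exact: measurable_argmax_prob.
  by apply/measurable_EFinP; exact: measurable_normal_pdf.
have sumh z : a <= z -> (\sum_(j < n) h j z <= C%:E)%E.
  move=> az.
  pose K := (L ^+ 2 + 1) / a; pose B := L * N^-1 / 2 / a.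
  pose t j := if 0 < cov P X j j then fine (P (tail_event j z)) else 0.
  have K0 : 0 <= K by rewrite divr_ge0 ?(ltW a0)// addr_ge0// sqr_ge0.
  have B0 : 0 <= B by rewrite !divr_ge0 ?mulr_ge0 ?invr_ge0 ?(ltW L0) ?(ltW a0) ?(ltW N0).
  have ht j : (h j z <= (K * t j + B)%:E)%E.
    rewrite /h /t; have [sj|sj] := ltP 0 (cov P X j j); last first.
      by rewrite lee_fin mulr0 add0r.
    rewrite tail_event_prob//.
    have sgj : 0 < sg j by rewrite sqrtr_gt0.
    have -> : P [set w | (z < tnth (X w) j)%R] = normal_prob 0 (sg j) `]z, +oo[.
      have [_ _ law] := csg j.
      have := law `]z, +oo[%classic (measurable_itv _); rewrite /cnormal_law (gt_eqF sgj) => <-.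
      by congr (P _); apply/seteqP; split=> w /=; rewrite in_itv/= andbT.
    have := normal_pdf_le_tail L1 sgj (sga j) az; rewrite expL -/K -/B.
    have pf : argmax_prob j z \is a fin_num.
      by rewrite ge0_fin_numE; case/andP: (p01 j z) => // _ /le_lt_trans ->//; rewrite ltry.
    have tf : normal_prob 0 (sg j) `]z, +oo[ \is a fin_num by exact: fin_num_measure.
    have := p01 j z; rewrite -[argmax_prob j z](fineK pf) fineM// !lee_fin.
    move: (fine (argmax_prob _ _)) (fine (normal_prob _ _ _)) (normal_pdf _ _ _) => p u f.
    rewrite /= => /andP[p0 p1] fu.
    apply: (@le_trans _ _ (p * (K * u + B))); first exact: ler_wpM2l.
    have := ler_wpM2r B0 p1; rewrite mul1r /=; lra.
  apply: (@le_trans _ _ (\sum_(j < n) (K * t j + B)%:E)%E); first exact: lee_sum.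
  have tsum : \sum_(j < n) t j <= 1.
    rewrite -lee_fin; apply: le_trans (sum_tail_event z).
    rewrite -sumEFin [leRHS]big_mkcond/=; apply: lee_sum => j _; rewrite /t.
    case: (0 < cov P X j j) => //; rewrite fineK// fin_num_measure//.
    exact: measurable_tail_event.
  rewrite sumEFin lee_fin big_split/= -big_distrr/= sumr_const card_ord -mulr_natr -/N.
  rewrite /C -/K (_ : B * N = L / 2 / a); last by rewrite /B; field; rewrite !gt_eqF.
  by rewrite lerD2r ler_piMr.
apply: (@le_trans _ _ (\sum_(j < n) P (argmax_event a b j))%E).
  have -> : A = \big[setU/set0]_(j < n) argmax_event a b j.
    rewrite -bigcup_seq; apply/seteqP; split=> [w [j [jab jmax]]|w [j _ [jab jmax]]]; last first.
      exists j; split=> // i; have := jmax i; rewrite /beaten.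
      by case: (i < j)%N => // /ltW.
    (* the maximum is attributed to the smallest index that attains it *)
    case: (@arg_minnP _ j (fun i => tnth (X w) i == tnth (X w) j) id (eqxx _)) => i /eqP ij imin.
    exists i; first by rewrite /= mem_index_enum.
    split; first by rewrite ij.
    move=> k; rewrite /beaten ij; case: ifPn => ki; last exact: jmax.
    rewrite lt_neqAle jmax andbT; apply: contraTneq ki => kj.
    by rewrite -leqNgt imin// kj.
  rewrite measure_bigsetU_ord//.
  - by move=> j; exact: measurable_argmax_event.
  - move=> j k _ _ [w [[_ wj] [_ wk]]]; apply/eqP; rewrite -val_eqE.
    move: (wj k) (wk j); rewrite /beaten.
    move: (lt_leAnge (tnth (X w) j) (tnth (X w) k)) (lt_leAnge (tnth (X w) k) (tnth (X w) j)).
    by case: ltngtP => // jk e1 e2 h1 h2; move: e1 e2; rewrite ?h1 ?h2 ?(ltW h1) ?(ltW h2).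
rewrite (eq_bigr (fun j => \int[mu]_(z in `[a, b]) h j z)%E) => [|j _]; last exact: hE.
rewrite -ge0_integral_sum//.
apply: (@le_trans _ _ (\int[mu]_(z in `[a, b]) (cst C%:E z))%E).
  apply: ge0_le_integral => //.
  - by move=> z _; exact: sume_ge0.
  - by apply: emeasurable_sum => j; exact: mh.
  - by move=> z; rewrite /= in_itv/= => /andP[az _]; exact: sumh.
have muab : mu (`[a, b]%classic : set R) = (b - a)%:E.
  apply: (etrans (@lebesgue_measure_itv R `[a, b])); rewrite /= lte_fin.
  by case: ltgtP ab => // -> _; rewrite subrr.
rewrite integral_cst// [X in (_ * X <= _)%E](_ : _ = (b - a)%:E); last exact: muab.
rewrite -EFinM lee_fin.
set l := Num.sqrt (ln N).
have lnN0 : 0 <= ln N by move: lnN; lra.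
have l2 : L ^+ 2 = 2 * l ^+ 2 by rewrite L2 sqr_sqrtr.
have l0 : 0 <= l by exact: sqrtr_ge0.
have Ll : L * sb <= l * a.
  rewrite -ler_sqr ?nnegrE ?(mulr_ge0 l0 (ltW a0)) ?(ltW (mulr_gt0 L0 sb0))//.
  rewrite !exprMn l2 (_ : 2 * l ^+ 2 * sb ^+ 2 = l ^+ 2 * (2 * sb ^+ 2)); last by ring.
  by rewrite ler_wpM2l ?sqr_ge0.
rewrite mulrC -!mulrA; apply: ler_wpM2l; first by rewrite subr_ge0.
rewrite /C -mulrDl ler_pdivrMr// (_ : sb^-1 * (l * (L + 3)) * a = (l * a) * (L + 3) / sb); last by ring.
rewrite ler_pdivlMr//; apply: (@le_trans _ _ (L * sb * (L + 3))).
  have h1 : L ^+ 2 + 1 + L / 2 <= L * (L + 3) by nra.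
  by rewrite -mulrA [sb * _]mulrC mulrA ler_pM2r.
by rewrite ler_pM2r// addr_gt0.
Qed.

End anti_concentration.

(** * The 0.95-quantile of the standard normal law *)

Section normal_quantile.
Context {R : realType}.
Implicit Types x : R.

Let cos_ge_quadratic x : 0 <= x <= 1 -> 1 - x ^+ 2 / 2 <= cos x.
Proof.
move=> /andP[]; have [y ->] : exists y, x = y *+ 2 by exists (x / 2); lra.
move=> y0 y1; rewrite cos_mulr2n.
have s0 : 0 <= sin y.
  by apply: sin_ge0_pi; have := pi_ge2 R => p; apply/andP; split; lra.
have s1 : sin y <= y by apply: sin_le_id; lra.
have := cos2Dsin2 y.
by move: (sin _) (cos _) s0 s1 => S C; nra.
Qed.

Let sin_ge_cubic x : 0 < x <= 1 -> x * (1 - x ^+ 2 / 2) <= sin x.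
Proof.
move=> /andP[x0 x1]; have [|c] := @MVT R sin cos 0 x x0.
  by apply: continuous_subspaceT => c; exact: continuous_sin.
rewrite in_itv/= => /andP[c0 cx]; rewrite sin0 !subr0 => ->.
rewrite mulrC ler_pM2r//; apply: le_trans (cos_ge_quadratic _).
  have : c ^+ 2 <= x ^+ 2 by rewrite ler_sqr ?nnegrE ltW.
  by lra.
by rewrite (ltW c0) (le_trans (ltW cx)).
Qed.

(** cos (8 / 5) < 0, by duplicating the angle three times from 1 / 5. *)
Lemma pi_le_16_5 : pi <= 16 / 5 :> R.
Proof.
rewrite leNgt; apply/negP => pi_gt.
have : 0 < cos (8 / 5 : R).
  by apply: cos_gt0_pihalf; move: (pi : R) pi_gt => p pp; apply/andP; split; lra.
have e2 : 8 / 5 = (4 / 5) *+ 2 :> R by rewrite -mulr_natr; field.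
have e1 : 4 / 5 = (2 / 5) *+ 2 :> R by rewrite -mulr_natr; field.
have e0 : 2 / 5 = (1 / 5) *+ 2 :> R by rewrite -mulr_natr; field.
have s0 : 196 / 1000 <= sin (1 / 5 : R).
  by apply: le_trans (sin_ge_cubic _); lra.
have c0 : 98 / 100 <= cos (1 / 5 : R).
  by apply: le_trans (cos_ge_quadratic _); lra.
have s1 : 384 / 1000 <= sin (2 / 5 : R).
  by rewrite e0 sin_mulr2n; move: (sin _) (cos _) s0 c0 => s c s0 c0; nra.
have c1 : 68 / 100 <= cos (4 / 5 : R).
  by apply: le_trans (cos_ge_quadratic _); lra.
have c1' : cos (4 / 5 : R) <= 706 / 1000.
  rewrite e1 cos_mulr2n; have := cos2Dsin2 (2 / 5 : R).
  by move: (sin _) (cos _) s1 => s c s1; nra.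
by rewrite e2 cos_mulr2n; move: (cos _) c1 c1' => c; nra.
Qed.

(** A point above (8 / 7) * sqrt 2 and below the 0.95-quantile 1.644. *)
Let x0 : R := 1617 / 1000.

Lemma expR_x0 : 266 / 1000 <= expR (- x0 ^+ 2 / 2).
Proof.
have -> : - x0 ^+ 2 / 2 = (- x0 ^+ 2 / 2 / 64) * 64%:R by field.
rewrite expRM_natr; set y := - x0 ^+ 2 / 2 / 64.
apply: (@le_trans _ _ ((1 + y) ^+ 64)).
  by rewrite /y /x0; lra.
rewrite ler_pXn2r ?nnegrE ?expR_ge0//; first exact: expR_ge1Dx.
by rewrite /y /x0; lra.
Qed.

Lemma normal_tail_x0 : (20^-1%:E < normal_prob 0 1 `]x0, +oo[)%E.
Proof.
have x0_ge1 : 1 <= x0 by rewrite /x0; lra.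
apply: lt_le_trans (normal_tail_ge ltr01 x0_ge1); rewrite lte_fin expr1n mul1r.
rewrite normal_pdf_expE// subr0 expr1n.
have e := expR_x0.
have pk : 395 / 1000 <= normal_peak 1 :> R.
  rewrite /normal_peak expr1n mul1r.
  have pi2 : 0 < Num.sqrt (pi *+ 2) :> R.
    by rewrite sqrtr_gt0; have := pi_gt0 R; move: (pi : R) => p; lra.
  have sq : Num.sqrt (pi *+ 2) <= 1000 / 395 :> R.
    have h : 0 <= 1000 / 395 :> R by lra.
    rewrite -(ger0_norm h) -sqrtr_sqr ler_sqrt ?sqr_ge0//.
    by have := pi_le_16_5; move: (pi : R) => p; lra.
  move: (Num.sqrt _) pi2 sq => u u0 uu.
  rewrite -(ler_pM2r u0) mulVf; last by rewrite gt_eqF.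
  by lra.
have q : 482 / 1000 <= (x0 ^+ 3 + 5 * 1 * x0) / (x0 ^+ 4 + 6 * 1 * x0 ^+ 2 + 3 * 1).
  rewrite ler_pdivlMr; rewrite /x0; lra.
have k1 : 0 <= 395 / 1000 :> R by lra.
have u1 : 0 <= 266 / 1000 :> R by lra.
have v1 : 0 <= 482 / 1000 :> R by lra.
have kuv := ler_pM (mulr_ge0 k1 u1) v1 (ler_pM k1 u1 pk e) q.
apply: lt_le_trans kuv; lra.
Qed.

(** Outside the range of Phi, Phi_inv takes its default value 0. *)
Lemma Phi_inv_95_ge : Phi_inv (95 / 100) = 0 :> R \/ x0 <= Phi_inv (95 / 100).
Proof.
rewrite /Phi_inv.
have [y95|y95] := boolP ((95 / 100 : R) \in (@Phi R) @` setT).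
  right; have E : Phi ('pinv_(fun=> 0) setT (@Phi R) (95 / 100)) = 95 / 100.
    exact: (@pinvK _ _ _ _ _ (95 / 100)).
  move: E; set x := 'pinv_(_) _ _ _ => E; rewrite leNgt; apply/negP => xx0.
  have mi (u : R) : measurable (`]-oo, u]%classic : set R) by exact: measurable_itv.
  have f (u : R) : normal_prob 0 1 `]-oo, u] \is a fin_num by exact: fin_num_measure.
  have h1 : (95 / 100)%:E = normal_prob 0 1 `]-oo, x].
    by rewrite -E /Phi fineK.
  have h2 : (normal_prob 0 1 `]-oo, x] <= normal_prob 0 1 `]-oo, x0])%E.
    apply: le_measure; rewrite ?inE//.
    by move=> u; rewrite /= !in_itv/= => ux; rewrite (le_trans ux)// ltW.
  have h3 : (normal_prob 0 1 `]-oo, x0] = 1 - normal_prob 0 1 `]x0, +oo[)%E.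
    rewrite -probability_setC//; congr (normal_prob 0 1 _).
    by rewrite setCitvr.
  have := normal_tail_x0.
  have tf : normal_prob 0 1 `]x0, +oo[ \is a fin_num by exact: fin_num_measure.
  move: h2; rewrite -h1 h3 -(fineK tf) -EFinB !lee_fin lte_fin.
  by move: (fine _) => t; lra.
left.
pose fS : set_surj setT ((@Phi R) @` setT) (@Phi R) := fun _ => id.
transitivity (odflt (0 : R) (if pselect (((@Phi R) @` setT) (95 / 100)) is left By
  then some (projT1 (cid2 (fS _ By))) else None)); first by [].
by case: pselect => // By; move: y95; rewrite mem_set.
Qed.

End normal_quantile.

(** * Gaussian processes with bounded paths *)

Section linf_functionals.
Context {T : Type} {R : realType}.
Implicit Types f g : linf T R.

Let normE f : `|f| = sup_norm f. Proof. by []. Qed.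

(** One inequality suffices, as f and g can be exchanged.  Such functionals are
    continuous, hence Borel for the topology of linf. *)
Definition le_lipschitz (C : R) (h : linf T R -> R) :=
  forall f g, h f <= h g + C * sup_norm (f - g).

Lemma lipschitz_open_gt (C x : R) (h : linf T R -> R) : 0 <= C -> le_lipschitz C h ->
  open [set f | x < h f].
Proof.
move=> C0 hC; rewrite openE => f /= xf.
have C1 : 0 < C + 1 by rewrite ltr_wpDl.
have e0 : 0 < (h f - x) / (C + 1) by rewrite divr_gt0// subr_gt0.
apply/nbhs_ballP; exists ((h f - x) / (C + 1)) => //= g.
rewrite -ball_normE/= normE ltr_pdivlMr// => fg.
have := hC f g; have := sup_norm_ge0 (f - g); lra.
Qed.

Lemma lipschitz_closed_ge (C x : R) (h : linf T R -> R) : 0 <= C -> le_lipschitz C h ->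
  closed [set f | x <= h f].
Proof.
move=> C0 hC; rewrite -[X in closed X]setCK; apply: open_closedC.
rewrite openE => f /= /negP; rewrite -ltNge => xf.
have C1 : 0 < C + 1 by rewrite ltr_wpDl.
have e0 : 0 < (x - h f) / (C + 1) by rewrite divr_gt0// subr_gt0.
apply/nbhs_ballP; exists ((x - h f) / (C + 1)) => //= g.
rewrite -ball_normE/= normE ltr_pdivlMr// => fg.
apply/negP; rewrite -ltNge.
have := hC g f; have : sup_norm (g - f) = sup_norm (f - g) by rewrite -!normE distrC.
have := sup_norm_ge0 (f - g); move=> h0 ->; lra.
Qed.

Lemma lipschitz_measurable d (Omega : measurableType d) (W : Omega -> borel_linf T R)
    (C : R) (h : linf T R -> R) : 0 <= C -> le_lipschitz C h ->
  measurable_fun setT W -> measurable_fun setT (fun w => h (W w)).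
Proof.
move=> C0 hC mW; apply: (measurability (@RGenOInfty.G R)) => [|/= _ [_] [x] -> <-].
  exact: RGenOInfty.measurableE.
rewrite setTI.
have mO : measurable ([set f | x < h f] : set (borel_linf T R)).
  by apply: sub_sigma_algebra; exact: lipschitz_open_gt hC.
have := mW measurableT _ mO; rewrite setTI; congr (measurable _).
by apply/seteqP; split=> w /=; rewrite in_itv/= andbT.
Qed.

Lemma linf_subE f g t : (f - g) t = f t - g t. Proof. by []. Qed.

Lemma lipschitz_eval t : le_lipschitz 1 (fun f : linf T R => f t).
Proof.
move=> f g; have := sup_norm_ub (f - g) t; rewrite linf_subE mul1r => h.
by have := le_trans (ler_norm _) h; lra.
Qed.

Lemma has_sup_linf f (t0 : T) : has_sup (range f).
Proof.
split; first by exists (f t0), t0.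
exists (sup_norm f) => _ [t _ <-].
exact: le_trans (ler_norm _) (sup_norm_ub f t).
Qed.

Lemma lipschitz_sup (t0 : T) : le_lipschitz 1 (fun f : linf T R => sup (range f)).
Proof.
move=> f g; rewrite mul1r; apply: ge_sup; first by exists (f t0), t0.
move=> _ [t _ <-]; have := lipschitz_eval t f g; rewrite mul1r => /le_trans; apply.
by rewrite lerD2r; apply: ub_le_sup; [exact: (has_sup_linf g t0).2|exists t].
Qed.

Definition oscillation (S : set (T * T)) f : R :=
  sup [set `|f st.2 - f st.1| | st in S].

Lemma has_sup_oscillation (S : set (T * T)) f : S !=set0 ->
  has_sup [set `|f st.2 - f st.1| | st in S].
Proof.
move=> [st0 S0]; split; first by exists `|f st0.2 - f st0.1|, st0.
exists (sup_norm f + sup_norm f) => _ [st _ <-].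
by apply: le_trans (ler_normB _ _) _; apply: lerD; exact: sup_norm_ub.
Qed.

Lemma oscillation_ge (S : set (T * T)) f st : S st ->
  `|f st.2 - f st.1| <= oscillation S f.
Proof.
move=> Sst; apply: ub_le_sup; last by exists st.
by apply: (has_sup_oscillation f _).2; exists st.
Qed.

Lemma lipschitz_oscillation (S : set (T * T)) : S !=set0 ->
  le_lipschitz 2 (oscillation S).
Proof.
move=> S0 f g; apply: ge_sup; first by case: (has_sup_oscillation f S0).
move=> _ [st Sst <-].
have := oscillation_ge g Sst; have := lipschitz_eval st.2 f g; have := lipschitz_eval st.1 f g.
have := lipschitz_eval st.2 g f; have := lipschitz_eval st.1 g f.
have -> : sup_norm (g - f) = sup_norm (f - g) by rewrite -!normE distrC.
rewrite !mul1r => h1 h2 h3 h4; rewrite !ler_norml => /andP[h5 h6].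
by apply/andP; split; lra.
Qed.

End linf_functionals.

Section gaussian_process.
Context (R : realType) (d : measure_display) (Omega : measurableType d)
  (P : probability Omega R) (T : Type).
Variable W : {RV P >-> borel_linf T R}.
Hypotheses (Wg : gaussian W) (Wc : centered W).

Let mW : measurable_fun setT (W : Omega -> borel_linf T R).
Proof. exact: measurable_funPT. Qed.

Lemma measurable_eval_at t : measurable_fun setT (eval_at W t).
Proof. exact: (lipschitz_measurable ler01 (lipschitz_eval t) mW). Qed.

Lemma eval_at_cnormal t : exists s, cnormal P (eval_at W t) s.
Proof.
apply: normal_law_cnormal; first exact: measurable_eval_at.
- have := Wg (fun _ : 'I_1 => t) (fun=> 1); rewrite /normal_law.
  have -> : (fun w => \sum_(i < 1) 1 * eval_at W t w) = eval_at W t.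
    by apply/funext => w; rewrite big_ord1 mul1r.
  by [].
- by have := Wc t; rewrite unlock.
Qed.

Lemma lincomb_eval_cnormal n (t : 'I_n -> T) (a : 'I_n -> R) :
  exists s, cnormal P (fun w => \sum_(i < n) a i * eval_at W (t i) w) s.
Proof.
apply: normal_law_cnormal; last 2 first.
- exact: Wg.
- have it i : P.-integrable setT (fun w => (a i * eval_at W (t i) w)%:E).
    have [s cs] := eval_at_cnormal (t i); have [iY _ _ _] := cnormal_facts cs.
    by under eq_fun do rewrite EFinM; exact: integrableZl.
  under eq_integral do rewrite -sumEFin.
  rewrite integral_sum//= big1// => i _.
  have [s cs] := eval_at_cnormal (t i); have [iY Y0 _ _] := cnormal_facts cs.
  by under eq_integral do rewrite EFinM; rewrite integralZl// Y0 mule0.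
apply: measurable_sum => i; apply: measurable_funM => //.
exact: measurable_eval_at.
Qed.

Lemma eval_gaussian_vector n (t : 'I_n -> T) :
  gaussian_vector P (fun w => [tuple eval_at W (t i) w | i < n]).
Proof.
move=> a; have [s cs] := lincomb_eval_cnormal t a; exists s.
by move: cs; congr (cnormal P _ s); apply/funext => w; apply: eq_bigr => i _; rewrite tnth_mktuple.
Qed.

Lemma increment_gaussian_vector n (st : 'I_n -> T * T) :
  gaussian_vector P
    (fun w => [tuple eval_at W (st i).2 w - eval_at W (st i).1 w | i < n]).
Proof.
move=> a.
pose t (k : 'I_(n + n)) := match fintype.split k with inl i => (st i).2 | inr i => (st i).1 end.
pose a' (k : 'I_(n + n)) := match fintype.split k with inl i => a i | inr i => - a i end.
have [s cs] := lincomb_eval_cnormal t a'; exists s.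
move: cs; congr (cnormal P _ s); apply/funext => w.
rewrite big_split_ord/= /lincomb -big_split/=; apply: eq_bigr => i _.
rewrite tnth_mktuple /t /a'.
rewrite (unsplitK (inl i)) (unsplitK (inr i)); ring.
Qed.

End gaussian_process.

(** * Oscillation and supremum of a tight Gaussian process *)

Section oscillation_tail.
Context (R : realType) (d : measure_display) (Omega : measurableType d)
  (P : probability Omega R) (T : Type).
Variable W : {RV P >-> borel_linf T R}.
Hypotheses (Wg : gaussian W) (Wc : centered W) (Wt : tight W).
Variable delta : R.
Hypothesis delta0 : 0 < delta.

Let S : set (T * T) := [set st | semimetric W st.1 st.2 <= delta].
Let zeta (w : Omega) : R := oscillation S (W w : linf T R).

Let mW : measurable_fun setT (W : Omega -> borel_linf T R).
Proof. exact: measurable_funPT. Qed.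

Lemma cov_increment n (st : 'I_n -> T * T) i :
  cov P (fun w => [tuple eval_at W (st i).2 w - eval_at W (st i).1 w | i < n]) i i =
  semimetric W (st i).1 (st i).2 ^+ 2.
Proof.
rewrite /cov /semimetric sqr_sqrtr; last first.
  by apply: fine_ge0; rewrite unlock; apply: integral_ge0 => w _; rewrite lee_fin sqr_ge0.
rewrite /ip /Rintegral unlock; congr fine; apply: eq_integral => w _.
by rewrite tnth_mktuple expr2.
Qed.

Lemma semimetric_sym s t : semimetric W s t = semimetric W t s.
Proof.
rewrite /semimetric; congr (Num.sqrt (fine _)); rewrite unlock.
by apply: eq_integral => w _; rewrite -sqrrN opprB.
Qed.

Lemma semimetric_refl t : semimetric W t t = 0.
Proof.
rewrite /semimetric unlock integral0_eq ?sqrtr0// => w _.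
by rewrite subrr expr0n.
Qed.

Let S_nonempty (t0 : T) : S !=set0.
Proof. by exists (t0, t0); rewrite /S/= semimetric_refl ltW. Qed.

Lemma measurable_oscillation (t0 : T) : measurable_fun setT zeta.
Proof.
have two0 : 0 <= 2 :> R by [].
exact: (lipschitz_measurable two0 (lipschitz_oscillation (S_nonempty t0)) mW).
Qed.

(** The paths in a compact set with oscillation at least u are covered by the open
    sets where one increment exceeds m + kappa * delta < u, hence by finitely many
    of them.  The maximum of these increments is below the oscillation, so its
    expectation is at most m and gaussian_max_tail applies. *)
Lemma oscillation_tail (t0 : T) (kappa m u : R) : 0 < kappa ->
  (\int[P]_w (zeta w)%:E <= m%:E)%E -> m + kappa * delta < u ->
  (P [set w | (u <= zeta w)%R] <= (expR (- kappa ^+ 2 / 2))%:E)%E.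
Proof.
move=> kappa0 zm mu_.
have mz := measurable_oscillation t0.
have S0 := S_nonempty t0.
have mzu : measurable [set w | u <= zeta w].
  have mb : measurable_fun setT (fun w => u <= zeta w) by exact: measurable_fun_ler.
  by have := mb measurableT [set true] I; rewrite setTI.
apply/lee_addgt0Pr => e e0.
have [K cK PK] := Wt e0.
have two0 : 0 <= 2 :> R by [].
have lz := @lipschitz_oscillation T R S S0.
have clK : closed K by apply: compact_closed => //; exact: norm_hausdorff.
have mK : measurable (K : set (borel_linf T R)).
  rewrite -[K]setCK; apply: measurableC; apply: sub_sigma_algebra.
  by rewrite /= openC.
have mWK : measurable ((W : Omega -> borel_linf T R) @^-1` K).
  by rewrite -[X in measurable X]setTI; exact: mW.
have cK' : compact (K `&` [set f | u <= oscillation S f]).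
  by apply: compact_closedI => //; exact: lipschitz_closed_ge lz.
move: cK'; rewrite compact_cover => /(_ {classic (T * T)} S
  (fun st => [set f : linf T R | m + kappa * delta < f st.2 - f st.1])) [].
- move=> st _; apply: (@lipschitz_open_gt _ _ 2 _ (fun f : linf T R => f st.2 - f st.1)) => // f g.
  have := lipschitz_eval st.2 f g; have := lipschitz_eval st.1 g f.
  have -> : sup_norm (g - f) = sup_norm (f - g).
    by rewrite -[LHS]/(`|g - f|) distrC.
  by rewrite !mul1r; lra.
- move=> f [_ uf].
  have [_ [st Sst <-]] : exists2 y, [set `|f st.2 - f st.1| | st in S] y & m + kappa * delta < y.
    by apply: sup_gt; [case: (has_sup_oscillation f S0)|exact: lt_le_trans uf].
  have [f0|f0] := leP 0 (f st.2 - f st.1).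
    by rewrite ger0_norm// => h; exists st.
  rewrite ltr0_norm// opprB => h; exists (st.2, st.1) => //.
  by rewrite /S/= semimetric_sym.
move=> D DS DK.
pose r : seq (T * T) := finmap.enum_fset D.
pose st (i : 'I_(size r)) := tnth (in_tuple r) i.
pose Y w := [tuple eval_at W (st i).2 w - eval_at W (st i).1 w | i < size r].
have gY : gaussian_vector P Y by exact: increment_gaussian_vector.
have Sst i : S (st i).
  have := DS (st i); rewrite inE; apply.
  exact: mem_tnth.
have Yz w : pmax (Y w) <= zeta w.
  have [->|[i ->]] := pmax_attained (Y w).
    by have := oscillation_ge (W w : linf T R) (_ : S (t0, t0)); rewrite subrr normr0; apply;
      rewrite /S/= semimetric_refl ltW.
  rewrite tnth_mktuple; apply: le_trans (oscillation_ge (W w : linf T R) (Sst i)).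
  exact: ler_norm.
have mY : measurable_fun setT (fun w => pmax (Y w)).
  exact: (measurableT_comp (@measurable_pmax R _) (gaussian_vector_measurable gY)).
have EY : (\int[P]_w (pmax (Y w))%:E <= m%:E)%E.
  apply: le_trans zm; apply: ge0_le_integral => //.
  - by move=> w _; rewrite lee_fin pmax_ge0.
  - exact/measurable_EFinP.
  - exact/measurable_EFinP.
  - by move=> w _; rewrite lee_fin.
have := gaussian_max_tail gY delta0 kappa0 _ EY.
have covY i : cov P Y i i <= delta ^+ 2.
  rewrite cov_increment ler_sqr ?nnegrE ?sqrtr_ge0 ?(ltW delta0)//; exact: Sst.
move=> /(_ covY) tail.
have mYu : measurable [set w | m + kappa * delta <= pmax (Y w)].
  have mb : measurable_fun setT (fun w => m + kappa * delta <= pmax (Y w)).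
    exact: measurable_fun_ler.
  by have := mb measurableT [set true] I; rewrite setTI.
apply: (@le_trans _ _ (P [set w | m + kappa * delta <= pmax (Y w)]%R +
    P (~` ((W : Omega -> borel_linf T R) @^-1` K)))%E); last first.
  apply: leeD => //; rewrite probability_setC//.
  have : ((1 - e)%:E <= P ((W : Omega -> borel_linf T R) @^-1` K))%E by exact: PK.
  have := fin_num_measure P _ mWK => /fineK <-.
  by rewrite -EFinB !lee_fin; lra.
apply: (@le_trans _ _ (P ([set w | m + kappa * delta <= pmax (Y w)] `|`
   ~` ((W : Omega -> borel_linf T R) @^-1` K)))); last first.
  by apply: measureU2 => //; exact: measurableC.
apply: le_measure; rewrite ?inE//; first by apply: measurableU => //; exact: measurableC.
move=> w uw; have [Kw|] := pselect (K (W w)); last by right.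
left; have [st' Dst'/= h] := DK (W w) (conj Kw uw).
have idx : (index st' r < size r)%N by rewrite index_mem.
apply: le_trans (ltW h) (le_trans _ (pmax_ge (Y w) (Ordinal idx))).
rewrite tnth_mktuple /st (tnth_nth st')/= nth_index//.
Qed.

End oscillation_tail.

Section supremum.
Context (R : realType) (d : measure_display) (Omega : measurableType d)
  (P : probability Omega R) (T : Type).
Variable W : {RV P >-> borel_linf T R}.
Hypotheses (Wg : gaussian W) (Wc : centered W) (Wt : tight W).

Let mW : measurable_fun setT (W : Omega -> borel_linf T R).
Proof. exact: measurable_funPT. Qed.

Lemma variance_eval t s : cnormal P (eval_at W t) s -> 'V_P[eval_at W t]%E = (s ^+ 2)%:E.
Proof.
move=> cs; have [_ E0 _ E2] := cnormal_facts cs.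
have EX : 'E_P[eval_at W t]%E = 0%E by rewrite unlock.
rewrite /variance unlock EX unlock /= -E2; apply: eq_integral => w _.
by rewrite -[LHS]/(((eval_at W t w - 0) * (eval_at W t w - 0))%:E) subr0 expr2.
Qed.

Lemma cov_eval_le n (t : 'I_n -> T) i : (sup_variance W < +oo)%E ->
  cov P (fun w => [tuple eval_at W (t i) w | i < n]) i i <= sigma_bar W ^+ 2.
Proof.
move=> supfin; have [s cs] := eval_at_cnormal Wg Wc (t i).
have -> : cov P (fun w => [tuple eval_at W (t i) w | i < n]) i i = s ^+ 2.
  rewrite /cov -(cnormal_ip cs); congr ip; apply/funext => w; by rewrite tnth_mktuple.
have Vs : ((s ^+ 2)%:E <= sup_variance W)%E.
  by rewrite -(variance_eval cs); apply: ereal_sup_ubound; exists (t i).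
have sup0 : (0 <= sup_variance W)%E by apply: le_trans Vs; rewrite lee_fin sqr_ge0.
have supf : sup_variance W \is a fin_num by rewrite ge0_fin_numE.
by rewrite /sigma_bar sqr_sqrtr ?fine_ge0// -lee_fin fineK.
Qed.

(** An infimum of a nonempty set of natural numbers is attained. *)
Lemma covering_net delta : (2%:R%:E <= cov_num W delta < +oo)%E ->
  exists n (t : 'I_n -> T), [/\ (1 < n)%N, cov_num W delta = n%:R%:E &
    forall s, exists i, semimetric W s (t i) <= delta].
Proof.
rewrite /cov_num /covering_number; set Q := (X in [set n : nat | X n]); move=> /andP[N2 Nfin].
have exQ : exists n, `[< Q n >].
  apply/not_existsP => noQ; move: Nfin.
  rewrite (_ : [set n%:R%:E | n in _] = set0) ?ereal_inf0 ?ltxx//.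
  by rewrite -subset0 => y [n Qn _]; exact: (noQ n (asboolT Qn)).
case: (ex_minnP exQ) => n /asboolP Qn nmin.
have NE : ereal_inf [set (n%:R)%:E | n in [set n | Q n]] = n%:R%:E :> \bar R.
  apply/eqP; rewrite eq_le; apply/andP; split; first by apply: ereal_inf_lbound; exists n.
  apply: le_ereal_inf_tmp => _ [k Qk <-]; rewrite lee_fin ler_nat; apply: nmin; exact/asboolP.
have [A [An net]] := Qn.
have /card_set_bijP[f [fI finj fsurj]] := An.
have ext (i : 'I_n) : {a | A a & f a = i}.
  by apply: cid2; have [a Aa fa] := fsurj i (ltn_ord i); exists a.
exists n, (fun i => s2val (ext i)); split.
- by move: N2; rewrite NE lee_fin ler_nat.
- exact: NE.
- move=> s; have [a Aa sa] := net s.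
  have fa : (f a < n)%N by exact: fI.
  exists (Ordinal fa); case: (ext _) => /= b Ab fb.
  by rewrite (_ : b = a)//; apply: finj; rewrite ?inE.
Qed.

(** When the oscillation at scale delta is below u, the supremum is within u of the
    maximum over the net. *)
Lemma sup_near_level (t0 : T) (delta kappa m u x eps : R) n (t : 'I_n -> T) :
  0 < delta -> 0 < kappa ->
  (\int[P]_w (oscillation [set st | (semimetric W st.1 st.2 <= delta)%R] (W w : linf T R))%:E
    <= m%:E)%E ->
  m + kappa * delta < u -> (1 < n)%N ->
  (forall s, exists i, semimetric W s (t i) <= delta) ->
  0 < sigma_bar W -> (sup_variance W < +oo)%E ->
  0 < eps -> 0 <= u -> 0 < x - eps - u -> 2 * sigma_bar W ^+ 2 <= (x - eps - u) ^+ 2 ->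
  (P [set w | (`|sup (range (fun t => eval_at W t w)) - x| <= eps)%R] <=
   (2 / sigma_bar W * (eps + u) * Num.sqrt (ln n%:R) * (Num.sqrt (2 * ln n%:R) + 3))%:E +
   (expR (- kappa ^+ 2 / 2))%:E)%E.
Proof.
move=> delta0 kappa0 Em mu_ n1 net sb0 supfin eps0 u0 a0 asb.
set S := [set st | _] in Em; set M := fun w => sup (range (fun t => eval_at W t w)).
pose X w := [tuple eval_at W (t i) w | i < n].
have gX : gaussian_vector P X by exact: eval_gaussian_vector.
have S0 : S !=set0 by exists (t0, t0); rewrite /S/= semimetric_refl ltW.
have mM : measurable_fun setT M.
  exact: (lipschitz_measurable ler01 (@lipschitz_sup T R t0) mW).
have mz : measurable_fun setT (fun w => oscillation S (W w : linf T R)).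
  exact: measurable_oscillation.
have mX i : measurable_fun setT (fun w => tnth (X w) i).
  by have [s []] := gaussian_vector_coord gX i.
have mset (b : Omega -> bool) : measurable_fun setT b -> measurable [set w | b w].
  by move=> mb; have := mb measurableT [set true] I; rewrite setTI.
pose A := [set w | exists j, x - eps - u <= tnth (X w) j <= x + eps + u /\
  forall i, tnth (X w) i <= tnth (X w) j].
pose B := [set w | u <= oscillation S (W w : linf T R)].
have mB : measurable B by apply: mset; exact: measurable_fun_ler.
have mA : measurable A.
  have -> : A = \bigcup_(j in [set: 'I_n]) ([set w | x - eps - u <= tnth (X w) j <= x + eps + u] `&`
      \bigcap_(i in [set: 'I_n]) [set w | tnth (X w) i <= tnth (X w) j]).
    apply/seteqP; split=> [w [j [h1 h2]]|w [j _ [h1 h2]]]; exists j => //; split=> // i.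
      by move=> _; exact: h2.
    exact: h2.
  apply: fin_bigcup_measurable => [|j _]; first exact: finite_finset.
  apply: measurableI.
    by apply: mset; apply: measurable_and; exact: measurable_fun_ler.
  apply: fin_bigcap_measurable => [|i _]; first exact: finite_finset.
  by apply: mset; exact: measurable_fun_ler.
apply: (@le_trans _ _ (P A + P B)%E); last first.
  apply: leeD; last exact: oscillation_tail Em mu_.
  have ab : x - eps - u <= x + eps + u by lra.
  apply: le_trans (gaussian_max_anti_concentration gX n1 sb0 _ a0 asb ab) _.
    by move=> i; exact: cov_eval_le.
  rewrite lee_fin (_ : x + eps + u - (x - eps - u) = 2 * (eps + u)); last by ring.
  by rewrite (_ : 2 * (eps + u) / sigma_bar W = 2 / sigma_bar W * (eps + u)) //; ring.
apply: (@le_trans _ _ (P (A `|` B))); last exact: measureU2.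
apply: le_measure; rewrite ?inE//.
- apply: mset; apply: measurable_fun_ler => //.
  by apply: measurableT_comp => //; exact: measurable_funB.
- exact: measurableU.
move=> w /= Mx; have [uB|Bu] := leP u (oscillation S (W w : linf T R)); [by right|left].
have i0 : 'I_n := Ordinal (ltnW n1).
have [j _ jmax] := @arg_maxP _ _ _ i0 xpredT (fun i => tnth (X w) i) isT.
exists j; split; last by move=> i; exact: jmax.
have hM : has_sup (range (fun t => eval_at W t w)) := has_sup_linf (W w : linf T R) t0.
have M1 : tnth (X w) j <= M w.
  by apply: ub_le_sup; [exact: hM.2|exists (t j) => //; rewrite tnth_mktuple].
have M2 : M w <= tnth (X w) j + oscillation S (W w : linf T R).
  apply: ge_sup; first exact: hM.1.
  move=> _ [s _ <-]; have [i si] := net s.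
  have := oscillation_ge (W w : linf T R) (si : S (s, t i)).
  have Xi : tnth (X w) i = eval_at W (t i) w by rewrite tnth_mktuple.
  have /= := jmax i isT; rewrite Xi -/(eval_at W s w) -/(eval_at W (t i) w).
  by rewrite distrC => h1 /(le_trans (ler_norm _)) h2; move: h1 h2; lra.
by move: Mx; rewrite -/(M w) ler_norml => /andP[h1 h2]; apply/andP; split; lra.
Qed.

End supremum.

(** * Anti-concentration of the supremum *)

Theorem lemma10 (R : realType) (d : measure_display) (Omega : measurableType d)
    (P : probability Omega R) (T : Type) (T_nonempty : inhabited T)
    (W : {RV P >-> borel_linf T R})
    (W_tight : tight W) (W_gaussian : gaussian W) (W_centered : centered W)
    (W_var : (0 < sup_variance W)%E)
    (eps : R) (eps_gt0 : 0 < eps) (eps_lt : eps < 16%:R^-1 * sigma_bar0 W) :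
  (ereal_sup [set P [set w | (`|sup (range (fun t => eval_at W t w)) - x| <= eps)%R] |
     x in [set x : R | (sigma_bar0 W <= x)%R]]
   <=
   ereal_inf [set (2%:R / sigma_bar W)%:E *
        (eps%:E + phi W dk.1 + (dk.2 * dk.1)%:E) *
        sqrte (lne (cov_num W dk.1)) *
        (sqrte (2%:R%:E * lne (cov_num W dk.1)) + 3%:R%:E) +
        (expR (- dk.2 ^+ 2 / 2%:R))%:E |
     dk in [set dk : R * R | admissible W dk.1 dk.2 /\ 2%:R%:E <= cov_num W dk.1]])%E.
Proof.
have [t0] := T_nonempty.
have s00 : 0 < sigma_bar0 W by move: eps_gt0 eps_lt; lra.
have sb_ge0 : 0 <= sigma_bar W by exact: sqrtr_ge0.
have [q [s0E q_cases]] : exists q, sigma_bar0 W = sigma_bar W * q /\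
    (q = 0 \/ 1617 / 1000 <= q).
  by exists (Phi_inv (95%:R / 100%:R)); split; [reflexivity|exact: Phi_inv_95_ge].
have [q0 q_ge] : 0 < q /\ 2 <= (7 / 8 * q) ^+ 2.
  case: q_cases => [q0|q_ge].
    by move: s00; rewrite s0E q0 mulr0 ltxx.
  by split; nra.
have sb0 : 0 < sigma_bar W.
  rewrite lt_neqAle eq_sym sb_ge0 andbT; apply: contraTneq s00 => sb.
  by rewrite s0E sb mul0r ltxx.
have supfin : (sup_variance W < +oo)%E.
  rewrite lt_neqAle leey andbT; apply: contraTneq sb0 => sv.
  by rewrite /sigma_bar sv sqrtr0 ltxx.
apply: ge_ereal_sup => _ [x Ax <-].
apply: le_ereal_inf_tmp => _ [[delta kappa] [/= [delta0 kappa0 adm] N2] <-] /=.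
have phi0 : (0 <= phi W delta)%E.
  rewrite /phi unlock; apply: integral_ge0 => w _; rewrite lee_fin.
  apply: le_trans (oscillation_ge (W w : linf T R) (_ : _ (t0, t0))); first exact: normr_ge0.
  by rewrite /= semimetric_refl ltW.
have phifin : phi W delta \is a fin_num.
  rewrite ge0_fin_numE//; apply: le_lt_trans (ltry (sigma_bar0 W / 16)).
  by apply: le_trans adm; rewrite leeDl// lee_fin mulr_ge0// ltW.
have [m phiE] : exists m, phi W delta = m%:E by exists (fine (phi W delta)); rewrite fineK.
have m0 : 0 <= m by rewrite -lee_fin -phiE.
have Em : (\int[P]_w (oscillation [set st | (semimetric W st.1 st.2 <= delta)%R]
    (W w : linf T R))%:E <= m%:E)%E.
  by rewrite -phiE /phi unlock.
have kd0 : 0 < kappa * delta by rewrite mulr_gt0.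
(* without a finite net the right-hand side is infinite *)
have [covy|covN] := eqVneq (cov_num W delta) +oo%E.
  rewrite covy.
  have A0 : (0 < (2%:R / sigma_bar W)%:E * (eps%:E + phi W delta + (kappa * delta)%:E))%E.
    rewrite mule_gt0// ?lte_fin; first by rewrite divr_gt0.
    by rewrite phiE lte_fin; move: m0 kd0 eps_gt0; lra.
  have -> : sqrte (lne +oo) = +oo%E :> \bar R by [].
  have -> : (2%:R%:E * lne +oo)%E = +oo%E :> \bar R by rewrite /= gt0_muley// lte_fin.
  rewrite (gt0_muley A0) /= addye//.
  exact: leey.
have covfin : (2%:R%:E <= cov_num W delta < +oo)%E by rewrite N2 lt_neqAle covN leey.
have [n [t [n1 covE net]]] := covering_net covfin.
have n0 : 0 < n%:R :> R by rewrite ltr0n ltnW.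
have ln0 : 0 <= ln n%:R :> R by rewrite ln_ge0// ler1n ltnW.
rewrite covE lne_EFin// phiE [leRHS](_ : _ = (2 / sigma_bar W * (eps + m + kappa * delta) *
  Num.sqrt (ln n%:R) * (Num.sqrt (2 * ln n%:R) + 3) + expR (- kappa ^+ 2 / 2))%:E); last by [].
set l := Num.sqrt (ln n%:R); set L := Num.sqrt _ + 3.
have L0 : 0 <= L by rewrite addr_ge0.
have C0 : 0 <= 2 / sigma_bar W * l * L by rewrite !mulr_ge0 ?invr_ge0 ?sqrtr_ge0.
set C := 2 / sigma_bar W * l * L in C0.
apply/lee_addgt0Pr => e e0.
move: adm; rewrite phiE -EFinD lee_fin => adm.
(* the gap between u and m + kappa * delta: the first bound keeps
   x - eps - u above 7 / 8 of sigma_bar0, the second absorbs e *)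
pose tau := Num.min (sigma_bar0 W / 8 - eps - (m + kappa * delta)) (e / (C + 1)).
have C1 : 0 < C + 1 by rewrite ltr_wpDl.
have tau0 : 0 < tau.
  by rewrite lt_min; apply/andP; split; [move: eps_lt adm; lra|rewrite divr_gt0].
have tau1 : tau <= sigma_bar0 W / 8 - eps - (m + kappa * delta) by rewrite ge_min lexx.
have tau2 : C * tau <= e.
  have : tau <= e / (C + 1) by rewrite ge_min lexx orbT.
  rewrite ler_pdivlMr//; move: (ltW tau0); lra.
pose u := m + kappa * delta + tau.
have au : 7 / 8 * (sigma_bar W * q) <= x - eps - u.
  by rewrite -s0E; move: Ax tau1; rewrite /u /=; lra.
have a1 : 0 < sigma_bar W * q by rewrite mulr_gt0.
have mu_ : m + kappa * delta < u by rewrite /u ltrDl.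
have u0 : 0 <= u by rewrite /u; move: m0 kd0 tau0; lra.
have a0 : 0 < x - eps - u by apply: lt_le_trans au; lra.
have asb : 2 * sigma_bar W ^+ 2 <= (x - eps - u) ^+ 2.
  apply: (@le_trans _ _ ((7 / 8 * (sigma_bar W * q)) ^+ 2)).
    rewrite (_ : _ ^+ 2 = (7 / 8 * q) ^+ 2 * sigma_bar W ^+ 2); last by ring.
    by rewrite ler_wpM2r// sqr_ge0.
  by rewrite ler_sqr ?nnegrE// ?(ltW a0)//; lra.
apply: le_trans (sup_near_level W_gaussian W_centered W_tight t0 delta0 kappa0 Em mu_ n1 net
  sb0 supfin eps_gt0 u0 a0 asb) _.
rewrite -/l -/L -!EFinD lee_fin.
have -> : 2 / sigma_bar W * (eps + u) * l * L = C * (eps + u) by rewrite /C; ring.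
have -> : 2 / sigma_bar W * (eps + m + kappa * delta) * l * L = C * (eps + m + kappa * delta).
  by rewrite /C; ring.
by move: tau2; rewrite /u; lra.
Qed.
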